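(* Suppose the following Assumption holds: there is a nonrandom constant $M>1$ such that $\lim_{n\to\infty}\mathbb P(\tau_n<M|\ell_n|)=1$. Then there is a constant $h>0$ such that for all $t\ge0$, \[ \lim_{n\to\infty}\mathbb P\Big(\frac{cn+A(B,F;\bar\gamma_n)}{h\,n^{\zeta}}\ge t\Big)=\exp\big(-t^{2\kappa+3}\big). \]
   Context: Let $c>0$, $q>0$, $\kappa>-1$. $F=(F(x))_{x\in\mathbb Z}$ and $B=(B(i))_{i\in\mathbb Z}$ are mutually independent families of i.i.d. random variables, $\mathbb P(B(i)=\pm1)=1/2$, and $F(x)$ has a density $\varrho$ that is even, continuous, strictly positive on $(-c,c)$, zero outside $(-c,c)$, with $\lim_{x\to c}\varrho(x)/|c-x|^{\kappa}=q$. A lazy walk of length $n$ is $\gamma:\{0,\dots,n\}\to\mathbb Z$ with $|\gamma(i+1)-\gamma(i)|\le1$; its action is $A(B,F;\gamma)=\sum_{i=1}^nB(i)F(\gamma(i))$. $\bar\gamma_n$ denotes a minimizer of $A(B,F;\cdot)$ among lazy walks of length $n$ with $\gamma(0)=0$ (free endpoint). The discrepancy is $d(x)=2c-|F(x+1)-F(x)|$; $\ell_n=\operatorname{argmin}_{x\in\operatorname{range}(\bar\gamma_n)}d(x)$ and $\tau_n=\min\{i:\bar\gamma_n(i)\in\{\ell_n,\ell_n+1\}\}$. Let $\zeta=\frac{2\kappa+2}{2\kappa+3}$. *)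

(* Defs.v *)
From HB Require Import structures.
From mathcomp Require Import all_boot all_order all_algebra.
From mathcomp Require Import all_classical all_reals all_analysis.
Set Implicit Arguments. Unset Strict Implicit. Unset Printing Implicit Defensive.
Import Order.TTheory GRing.Theory Num.Theory.
Import numFieldNormedType.Exports.
Local Open Scope classical_set_scope.
Local Open Scope ring_scope.

Definition mutually_independent d (T : measurableType d) (R : realType)
    (P : probability T R) (I : eqType) (X : I -> T -> R) : Prop :=
  forall (S : seq I), uniq S ->
  forall (A : I -> set R), (forall i, measurable (A i)) ->
    fine (P (\bigcap_(i in [set` S]) (X i @^-1` A i))) =
    \prod_(i <- S) fine (P (X i @^-1` A i)).

(* gamma : {0,..,n} -> Z is a lazy walk of length n (values beyond n ignored). *)
Definition lazy_walk (n : nat) (gamma : nat -> int) : Prop :=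
  forall i : nat, (i < n)%N -> `|gamma i.+1 - gamma i| <= 1.

Definition action (R : realType) (n : nat) (B F : int -> R) (gamma : nat -> int) : R :=
  \sum_(1 <= i < n.+1) B i%:Z * F (gamma i).

Definition is_minimizer (R : realType) (n : nat) (B F : int -> R) (gamma : nat -> int) : Prop :=
  [/\ lazy_walk n gamma, gamma 0%N = 0 &
      forall g, lazy_walk n g -> g 0%N = 0 -> action n B F gamma <= action n B F g].

Definition discrepancy (R : realType) (c : R) (F : int -> R) (x : int) : R :=
  2 * c - `|F (x + 1) - F x|.

Definition is_ell (R : realType) (c : R) (F : int -> R) (n : nat) (gamma : nat -> int) (l : int) : Prop :=
  (exists2 i, (i <= n)%N & gamma i = l) /\
  forall i, (i <= n)%N -> discrepancy c F l <= discrepancy c F (gamma i).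

Definition tau_of (n : nat) (gamma : nat -> int) (l : int) : nat :=
  find (fun i => (gamma i == l) || (gamma i == l + 1)) (iota 0 n.+1).

(* Main.v *)
(* Adding [c] to every step turns the action into a nonnegative cost.  A walk that
   settles on an edge (l, l + 1) pays about (n / 2) d(l) there, because each window of
   fair signs has about as many + as -, and before that it pays for reaching l.  The
   cheapest crossing of a long interval using a bounded number of steps per site has, by
   subadditivity, a cost asymptotically linear in the length; call the slope alpha.  It is
   positive since every site is visited.  So, up to errors that are negligible on the scale
   n^zeta, the minimal cost is min_l (alpha |l| + (n / 2) d(l)): the upper bound comes from
   an explicit walk, and the lower bound uses the Assumption to bound the time spent on the
   way to ell_n and the absence of three neighbouring almost extremal sites to show that a
   cheap window of the walk stays on a single edge.  The tail of d(l) at 0 is a multiple of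
   x^(2 kappa + 2) (a convolution of two power tails), and the d(l) are 1-dependent, so the
   number of edges with alpha |l| + (n / 2) d(l) < s n^zeta is asymptotically Poisson with
   intensity proportional to s^(2 kappa + 3). *)
Require Import Defs.
From HB Require Import structures.
From mathcomp Require Import all_boot all_order all_algebra.
From mathcomp Require Import all_classical all_reals all_analysis.
From mathcomp Require Import measurable_realfun.
From mathcomp Require Import zify ring lra.
Import Order.TTheory GRing.Theory Num.Theory.
Import numFieldNormedType.Exports.
Set Implicit Arguments. Unset Strict Implicit. Unset Printing Implicit Defensive.
Local Open Scope classical_set_scope.
Local Open Scope ring_scope.

(** * Costs of lazy walks and passages *)

(** Two requirements compete in the choice of the threshold [eps] below which a step counts as
    cheap. Put [k = kappa + 1], [u = n^(-1/(2k+1))] and [N = n * u = n^zeta]. A walk of cost of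
    order [N] has at most about [N / eps] expensive steps, so only a small share of the windows is
    spoilt when [eps] is much larger than [u]. Three neighbouring extreme sites are absent among
    order [N] sites when [N * eps^(3k)] tends to 0, that is, when [eps] is much smaller than
    [u^(2/3)]. The choice [u^(5/6)] lies between the two. The window length is fixed and does not
    grow with [n]. The slope is an infimum of mean costs over crossings using at most [2M + 3] steps
    per site. On a mesh of width proportional to [N] this leaves finitely many candidate passages,
    so a union bound treats them all at once. Their lower tail needs no separate concentration
    inequality: a mean bounded from below and an upper tail controlled by block averages leave no
    room for low values. Sites on the negative side are handled by reflecting the environment. *)

Section Walks.
Context (R : realType) (c : R).
Implicit Types (b : nat -> bool) (f : int -> R) (g : nat -> int).

Definition wt b f (i : nat) (x : int) : R := c + (if b i then f x else - f x).

(** The position at time [s] is not charged, so consecutive pieces of a walk add up without paying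
    twice at the junction. *)
Definition cost b f (s t : nat) g : R := \sum_(s <= i < t) wt b f i.+1 (g i.+1).

Lemma wt_ge0 b f i x : `|f x| <= c -> 0 <= wt b f i x.
Proof. by rewrite /wt ler_norml => /andP[? ?]; case: (b i); lra. Qed.

Lemma wt_le b f i x : `|f x| <= c -> wt b f i x <= 2 * c.
Proof. by rewrite /wt ler_norml => /andP[? ?]; case: (b i); lra. Qed.

Lemma cost_ge0 b f s t g : (forall x, `|f x| <= c) -> 0 <= cost b f s t g.
Proof. by move=> fc; apply: sumr_ge0 => i _; exact: wt_ge0. Qed.

Lemma cost_le b f s t g : (forall x, `|f x| <= c) -> (s <= t)%N ->
  cost b f s t g <= 2 * c * (t - s)%:R.
Proof.
move=> fc st; rewrite /cost.
have -> : 2 * c * (t - s)%:R = \sum_(s <= i < t) 2 * c.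
  by rewrite sumr_const_nat mulr_natr.
by apply: ler_sum => i _; exact: wt_le.
Qed.

Lemma cost_cat b f s t u g : (s <= t)%N -> (t <= u)%N ->
  cost b f s u g = cost b f s t g + cost b f t u g.
Proof. by move=> st tu; rewrite /cost (big_cat_nat st tu). Qed.

Lemma eq_cost b b' f f' s t g g' :
  (forall i, (s < i <= t)%N -> wt b f i (g i) = wt b' f' i (g' i)) ->
  cost b f s t g = cost b' f' s t g'.
Proof.
by move=> E; apply: eq_big_nat => i /andP[si it]; apply: E; rewrite ltnS si.
Qed.

Lemma cost_shift b f s t g k :
  cost b f (k + s) (k + t) g = cost (fun i => b (k + i)%N) f s t (fun i => g (k + i)%N).
Proof.
rewrite /cost (addnC k s) big_addn addKn.
by apply: eq_bigr => i _; rewrite /wt !addnS (addnC k).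
Qed.

Lemma cost_opp b f s t g :
  cost b (fun x => f (- x)) s t (fun i => - g i) = cost b f s t g.
Proof. by apply: eq_bigr => i _; rewrite /wt opprK. Qed.

Lemma cost_translate b f s t g x0 :
  cost b (fun x => f (x0 + x)) s t g = cost b f s t (fun i => x0 + g i).
Proof. by []. Qed.

Lemma lazy_walkN n g : lazy_walk n g -> lazy_walk n (fun i => - g i).
Proof. by move=> gl i /gl; lia. Qed.

Lemma lazy_walk_sub n m g : (m <= n)%N -> lazy_walk n g -> lazy_walk m g.
Proof. by move=> mn gl i im; apply: gl; exact: leq_trans im mn. Qed.

Lemma lazy_walk_dist n g i j : lazy_walk n g -> (i <= j <= n)%N ->
  `|g j - g i| <= (j - i)%:Z.
Proof.
move=> gl /andP[ij jn]; rewrite -(subnKC ij) in jn *.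
elim: (j - i)%N jn => [|k IH] jn; first by rewrite addn0; lia.
rewrite addnS in jn *; have := gl _ jn; have := IH (ltnW jn); lia.
Qed.

Lemma lazy_walk_ivt n g i j (z : int) : lazy_walk n g -> (i <= j <= n)%N ->
  g i <= z <= g j -> exists2 k, (i <= k <= j)%N & g k = z.
Proof.
move=> gl /andP[ij jn] /andP[iz]; rewrite -(subnKC ij) in jn *.
elim: (j - i)%N jn => [|k IH] jn zj.
  by exists i; [lia|rewrite addn0 in zj; lia].
rewrite addnS in jn zj *; have := gl _ jn.
have [zk _|zk gk] := leP z (g (i + k)%N).
  by have [l lk lz] := IH (ltnW jn) zk; exists l => //; lia.
by exists (i + k).+1; [lia|lia].
Qed.

(** Lazy walks from 0 are coded by their increments plus one, an element of a finite type, so that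
    minima over walks are finite minima. *)
Definition walk_of n (h : {ffun 'I_n -> 'I_3}) (i : nat) : int :=
  \sum_(j < n | (j < i)%N) ((h j : nat)%:Z - 1).

Lemma walk_of0 n (h : {ffun 'I_n -> 'I_3}) : walk_of h 0 = 0.
Proof. by rewrite /walk_of big_pred0. Qed.

Lemma walk_ofS n (h : {ffun 'I_n -> 'I_3}) (i : 'I_n) :
  walk_of h i.+1 = walk_of h i + ((h i : nat)%:Z - 1).
Proof.
rewrite /walk_of (bigD1 i)//= addrC; congr (_ + _); apply: eq_bigl => j.
by rewrite ltnS ltn_neqAle andbC.
Qed.

Lemma walk_of_lazy n (h : {ffun 'I_n -> 'I_3}) : lazy_walk n (walk_of h).
Proof.
move=> i ilt; have := walk_ofS h (Ordinal ilt) => /= ->.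
by have := ltn_ord (h (Ordinal ilt)); lia.
Qed.

Definition incr n g : {ffun 'I_n -> 'I_3} :=
  [ffun i : 'I_n => inord (absz (g i.+1 - g i + 1)%R)].

Lemma incrK n g : lazy_walk n g -> g 0%N = 0 ->
  forall i, (i <= n)%N -> walk_of (incr n g) i = g i.
Proof.
move=> gl g0; elim=> [|i IH] ilt; first by rewrite walk_of0.
have := walk_ofS (incr n g) (Ordinal ilt) => /= ->; rewrite IH ?(ltnW ilt)//.
have := gl _ ilt => ?; rewrite ffunE /= inordK; lia.
Qed.

(** Staying in [[1, N]] after time 0 makes the cost a function of the field on [1..N] and of the
    signs at [1..s] only. Passages over disjoint boxes are therefore independent. *)
Definition confined (N s : nat) g : bool :=
  (g s == N%:Z) && [forall i : 'I_s, (0 < g i.+1 <= N%:Z)].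

Lemma confinedP (N s : nat) g :
  reflect (g s = N%:Z /\ forall i, (0 < i <= s)%N -> 0 < g i <= N%:Z) (confined N s g).
Proof.
apply: (iffP andP) => [[/eqP gs /forallP gi]|[gs gi]]; split => //.
- by case=> // i /andP[_ ilt]; exact: gi (Ordinal ilt).
- exact/eqP.
- by apply/forallP => i; apply: gi; rewrite /=.
Qed.

(** The default [2 * c * s] dominates the cost of every walk in a field bounded by [c], so it does
    not alter the minimum as soon as a confined walk exists. *)
Definition passage b f (N s : nat) : R :=
  \big[Num.min/2 * c * s%:R]_(h : {ffun 'I_s -> 'I_3} | confined N s (walk_of h))
     cost b f 0 s (walk_of h).

Lemma passage_le_cost b f N s g : lazy_walk s g -> g 0%N = 0 -> confined N s g ->
  passage b f N s <= cost b f 0 s g.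
Proof.
move=> gl g0 gc; have E := incrK gl g0.
have -> : cost b f 0 s g = cost b f 0 s (walk_of (incr s g)).
  by apply: eq_cost => i /andP[_ ils]; rewrite E.
apply: bigmin_le_cond; move/confinedP: gc => [gs gi]; apply/confinedP.
by split=> [|i /[dup] /gi ? /andP[_ ?]]; rewrite E.
Qed.

Lemma passage_ge0 b f N s : (forall x, `|f x| <= c) -> 0 <= passage b f N s.
Proof.
move=> fc; apply/bigmin_geP; split=> [|h _]; last exact: cost_ge0.
by rewrite mulr_ge0// mulr_ge0//; exact: le_trans (normr_ge0 (f 0)) (fc 0).
Qed.

Lemma passage_le b f N s : passage b f N s <= 2 * c * s%:R.
Proof. exact: bigmin_le_id. Qed.

(** Exactly the pairs for which a confined walk exists: for [N = 0] the interval [[1, N]] is empty,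
    which leaves no room for a step. *)
Definition feasible (N s : nat) := ((N <= s) && ((0 < N) || (s == 0)))%N.

Lemma passage_attained b f N s : (forall x, `|f x| <= c) -> feasible N s ->
  exists g, [/\ lazy_walk s g, g 0%N = 0, confined N s g & passage b f N s = cost b f 0 s g].
Proof.
move=> fc /andP[Ns N0].
pose g0 := fun i : nat => (minn i N)%:Z.
have g0l : lazy_walk s g0 by move=> i _; rewrite /g0; lia.
have g00 : g0 0%N = 0 by rewrite /g0 min0n.
have g0c : confined N s g0.
  apply/confinedP; rewrite /g0; split; first by lia.
  by case/orP: N0 => [N0|/eqP->] i; lia.
have H : confined N s (walk_of (incr s g0)).
  move/confinedP: g0c => [A B]; apply/confinedP; split; first by rewrite incrK.
  by move=> i /[dup] /B ? /andP[_ ?]; rewrite incrK.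
pose h := [arg min_(h < incr s g0 | confined N s (walk_of h)) cost b f 0 s (walk_of h)]%O.
exists (walk_of h); rewrite /h; case: arg_minP => // h' h'c h'min.
split=> //; [exact: walk_of_lazy|exact: walk_of0|].
apply/eqP; rewrite eq_le; apply/andP; split; first exact: bigmin_le_cond.
apply/bigmin_geP; split => //.
by have := cost_le b (walk_of h') fc (leq0n s); rewrite subn0.
Qed.

(** Two optimal passages are glued at [N1]; the second one, translated, lives in [[N1 + 1, N1 + N2]]
    and uses the signs after [s1], so the two costs involve disjoint parts of the environment. *)
Lemma passage_subadd b f N1 s1 N2 s2 : (forall x, `|f x| <= c) ->
  feasible N1 s1 -> feasible N2 s2 ->
  passage b f (N1 + N2) (s1 + s2) <=
  passage b f N1 s1 +
  passage (fun i => b (s1 + i)%N) (fun x => f (N1%:Z + x)) N2 s2.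
Proof.
move=> fc F1 F2.
have [g1 [l1 z1 /confinedP[e1 c1] ->]] := passage_attained b fc F1.
have fc2 : forall x, `|f (N1%:Z + x)| <= c by [].
have [g2 [l2 z2 /confinedP[e2 c2] ->]] := passage_attained (fun i => b (s1 + i)%N) fc2 F2.
pose g i := if (i <= s1)%N then g1 i else N1%:Z + g2 (i - s1)%N.
have gl : lazy_walk (s1 + s2) g.
  move=> i; rewrite /g => ilt; case: (ltngtP i s1) => [i1|i1|i1].
  - exact: l1.
  - by have := l2 (i - s1)%N; rewrite -subSn ?(ltnW i1)//; lia.
  - by have := l2 0%N; rewrite i1 subSnn e1 z2; lia.
apply: le_trans (passage_le_cost b f gl _ _) _.
- by rewrite /g.
- apply/confinedP; split.
    rewrite /g; case: leqP => s12; last by rewrite addKn e2; lia.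
    have s20 : s2 = 0%N by lia.
    by move: F2; rewrite /feasible s20 leqn0 => /andP[/eqP->]; rewrite !addn0 e1.
  move=> i /andP[i0 is12]; rewrite /g; case: leqP => is1.
    by have := c1 i; lia.
  by have := c2 (i - s1)%N; lia.
rewrite (@cost_cat _ _ 0 s1)// ?leq_addr//; apply: lerD.
  by rewrite le_eqVlt; apply/orP; left; apply/eqP/eq_cost => i /andP[_ ?]; rewrite /g ifT.
rewrite -{1}(addn0 s1) cost_shift cost_translate le_eqVlt; apply/orP; left.
apply/eqP/eq_cost => i /andP[i0 _]; have E : (s1 + i <= s1)%N = false by lia.
by rewrite /wt /g E addKn.
Qed.

End Walks.

(** * Deterministic bounds for a walk *)

(** Double counting over the pairs with one index in [p] and one outside: the sum of [W i + W j]
    over them weights the two partial sums by [a'] and [a]. Replacing both weights by the larger one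
    and dividing by it leaves the smaller count in front of [dl]. *)
Lemma sum_pairs_ge (R : realFieldType) (r : seq nat) (p : pred nat) (W : nat -> R) (dl : R) :
  (forall i, i \in r -> 0 <= W i) ->
  (forall i j, i \in r -> j \in r -> p i -> ~~ p j -> dl <= W i + W j) ->
  dl * (minn (count p r) (size r - count p r))%:R <= \sum_(i <- r) W i.
Proof.
move=> W0 Wd; rewrite -(count_predC p r) addKn.
rewrite (bigID p)/=; set SP := \sum_(_ <- _ | p _) _; set SQ := \sum_(_ <- _ | ~~ _) _.
have SP0 : 0 <= SP.
  by rewrite /SP big_seq_cond; apply: sumr_ge0 => i /andP[/W0].
have SQ0 : 0 <= SQ.
  by rewrite /SQ big_seq_cond; apply: sumr_ge0 => i /andP[/W0].
set a := count p r; set a' := count _ r.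
have E : dl * (a%:R * a'%:R) <= a'%:R * SP + a%:R * SQ.
  have -> : a'%:R * SP + a%:R * SQ =
      \sum_(i <- r | p i) \sum_(j <- r | ~~ p j) (W i + W j).
    under [RHS]eq_bigr => i _.
      rewrite big_split/= big_const_seq iter_addr_0 -mulr_natl -/SQ; over.
    by rewrite big_split/= -mulr_sumr [in RHS]big_const_seq iter_addr_0 [a%:R * _]mulr_natl.
  have -> : dl * (a%:R * a'%:R) = \sum_(i <- r | p i) \sum_(j <- r | ~~ p j) dl.
    rewrite big_const_seq iter_addr_0 big_const_seq iter_addr_0 -/a -/a'.
    by rewrite -[in RHS]mulrnA -[in RHS]mulr_natr natrM [a'%:R * _]mulrC.
  rewrite [leLHS]big_seq_cond [leRHS]big_seq_cond; apply: ler_sum => i /andP[ir pi].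
  rewrite [leLHS]big_seq_cond [leRHS]big_seq_cond; apply: ler_sum => j /andP[jr pj].
  exact: Wd.
case: (leqP a a') => aa'.
- case: (posnP a') => [a'0|a'0].
    by rewrite (_ : a = 0%N) ?mulr0 ?addr_ge0//; lia.
  have a'0R : (0 : R) < a'%:R by rewrite ltr0n.
  rewrite -(ler_pM2l a'0R); apply: le_trans (le_trans _ E) _; first by rewrite mulrCA (mulrC a'%:R).
  by rewrite mulrDr lerD2l ler_wpM2r// ler_nat.
- have a0R : (0 : R) < a%:R by rewrite ltr0n; lia.
  rewrite -(ler_pM2l a0R); apply: le_trans (le_trans _ E) _; first by rewrite mulrCA.
  by rewrite mulrDr lerD2r ler_wpM2r// ler_nat ltnW.
Qed.

Section LowerBound.
Context (R : realType) (c : R).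
Implicit Types (b : nat -> bool) (f : int -> R) (g : nat -> int).

Lemma lazy_walk_ivt_sym n g i j (z : int) : lazy_walk n g -> (i <= n)%N -> (j <= n)%N ->
  g i <= z <= g j -> exists2 k, (minn i j <= k <= maxn i j)%N & g k = z.
Proof.
move=> gl iN jN /andP[iz zj]; case: (leqP i j) => ij.
  by apply: (lazy_walk_ivt gl); [rewrite ij|rewrite iz].
have [| |k kij gk] := @lazy_walk_ivt n (fun i => - g i) j i (- z) (lazy_walkN gl).
- by rewrite (ltnW ij).
- by rewrite !lerN2 iz zj.
- by exists k => //; lia.
Qed.

Definition no_three_extreme f (eps : R) (L : nat) := forall x : int, `|x| <= L%:Z ->
  ~~ [&& c - eps < `|f x|, c - eps < `|f (x + 1)| & c - eps < `|f (x + 2)|].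

(* In a window where every step is cheap, the sites visited form an interval of
   extreme sites, hence at most two neighbours. *)
Lemma cheap_window_cost b f g n s D (eps dl : R) L :
  lazy_walk n g -> (s + D <= n)%N -> eps <= c ->
  (forall i, (i <= n)%N -> `|g i| <= L%:Z) -> no_three_extreme f eps L ->
  (forall x, `|f x| <= c) ->
  (forall i, (i <= n)%N -> dl <= discrepancy c f (g i)) ->
  (forall i, (s <= i < s + D)%N -> wt c b f i.+1 (g i.+1) < eps) ->
  dl * (minn (count (fun i => b i.+1) (iota s D)) (D - count (fun i => b i.+1) (iota s D)))%:R
    <= cost c b f s (s + D) g.
Proof.
move=> gl sDn epsc gL no3 fc dlE cheap.
have ext i : (s < i <= s + D)%N -> c - eps < `|f (g i)|.
  case: i => // i; rewrite ltnS => /cheap; rewrite /wt.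
  have := ler_norm (f (g i.+1)); have := ler_norm (- f (g i.+1)); rewrite normrN.
  by case: (b _); lra.
(* If two positions in the window differed by 2 or more, the walk would pass through [g i + 1] and
   [g i + 2] inside the window, and cheapness would make three neighbouring sites extreme. *)
have near i j : (s < i <= s + D)%N -> (s < j <= s + D)%N -> g j <= g i + 1.
  move=> iw jw; rewrite leNgt; apply/negP => gij.
  have [|||k1 k1w gk1] := @lazy_walk_ivt_sym n g i j (g i + 1) gl; try lia.
  have [|||k2 k2w gk2] := @lazy_walk_ivt_sym n g i j (g i + 2) gl; try lia.
  have iL : `|g i| <= L%:Z by apply: gL; lia.
  move/negP: (no3 (g i) iL); apply; rewrite -gk1 -gk2 !ext//=; lia.
have pairs i j : i \in iota s D -> j \in iota s D -> b i.+1 -> ~~ b j.+1 ->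
    dl <= wt c b f i.+1 (g i.+1) + wt c b f j.+1 (g j.+1).
  rewrite !mem_iota => iw jw bi bj.
  have := cheap _ iw; have := cheap _ jw; rewrite /wt bi (negbTE bj) => cj ci.
  have ij := near i.+1 j.+1; have ji := near j.+1 i.+1.
  (* Opposite signs on one site cost exactly [2 * c] together, which two steps cheaper than
     [eps <= c] cannot reach. *)
  have : g i.+1 != g j.+1 by apply/eqP => E; rewrite -E in cj; lra.
  have [gij _|gij _|_] := ltgtP (g i.+1) (g j.+1); last by [].
  - have E : g j.+1 = g i.+1 + 1 by lia.
    have := dlE i.+1; rewrite /discrepancy -E => /(_ _)/le_trans; apply; first by lia.
    by have := ler_norm (f (g j.+1) - f (g i.+1)); lra.
  - have E : g i.+1 = g j.+1 + 1 by lia.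
    have := dlE j.+1; rewrite /discrepancy -E => /(_ _)/le_trans; apply; first by lia.
    by have := ler_norm (- (f (g i.+1) - f (g j.+1))); rewrite normrN; lra.
have := @sum_pairs_ge R (iota s D) (fun i => b i.+1) _ _ _ pairs.
rewrite size_iota /cost /index_iota addKn; apply.
by move=> i _; exact: wt_ge0.
Qed.

(** The number of disjoint pairs of opposite signs that can be formed in window [q]; each such pair
    costs at least one discrepancy. *)
Definition window_min b (D q : nat) : nat :=
  let k := count (fun i => b i.+1) (iota (q * D) D) in minn k (D - k).

Lemma window_min_le b D q : (window_min b D q <= D)%N.
Proof. by rewrite /window_min /=; lia. Qed.

Lemma cost_windows b f g D q Q : (q <= Q)%N ->
  cost c b f (q * D) (Q * D) g = \sum_(q <= i < Q) cost c b f (i * D) (i * D + D) g.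
Proof.
move=> qQ; rewrite -(subnKC qQ); elim: (Q - q)%N => [|k IH].
  by rewrite addn0 /cost !big_geq.
by rewrite addnS big_nat_recr ?leq_addr//= -IH mulSnr (@cost_cat _ _ _ _ (q * D)%N ((q + k) * D)%N)//
  ?leq_addr// leq_mul2r leq_addr orbT.
Qed.

(** After time [t] every window either pays [dl] per pair of opposite signs or contains a step
    costing at least [eps]. The latter number at most [cost / eps], and each loses at most [D]
    pairs. Windows starting before [t] are given up, which loses at most [t + D] pairs. *)
Lemma walk_cost_ge b f g n D Q t (eps dl : R) L :
  lazy_walk n g -> (0 < D)%N -> (Q * D <= n)%N -> (t <= n)%N -> 0 < eps <= c ->
  (forall i, (i <= n)%N -> `|g i| <= L%:Z) -> no_three_extreme f eps L ->
  (forall x, `|f x| <= c) -> 0 <= dl ->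
  (forall i, (i <= n)%N -> dl <= discrepancy c f (g i)) ->
  cost c b f 0 t g + dl * (\sum_(q < Q) (window_min b D q)%:R
     - D%:R * (cost c b f 0 n g / eps) - (t + D)%:R) <= cost c b f 0 n g.
Proof.
move=> gl D0 QDn tn /andP[eps0 epsc] gL no3 fc dl0 dlE.
pose bad q := has (fun i => eps <= wt c b f i.+1 (g i.+1)) (iota (q * D) D).
have wcost q : (q < Q)%N -> dl * ((window_min b D q)%:R - D%:R * (bad q)%:R) <=
    cost c b f (q * D) (q * D + D) g.
  move=> qQ; have [bq|bq] := boolP (bad q).
    apply: le_trans (cost_ge0 _ _ _ _ fc); rewrite mulr1 mulr_ge0_le0// subr_le0 ler_nat.
    exact: window_min_le.
  rewrite mulr0 subr0; apply: (@cheap_window_cost _ _ _ n _ _ eps _ L) => //.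
    by apply: leq_trans QDn; rewrite -mulSnr leq_mul2r qQ orbT.
  move=> i iw; rewrite ltNge; apply: contra bq => ei.
  by apply/hasP; exists i => //; rewrite mem_iota.
have badcost q : eps * (bad q)%:R <= cost c b f (q * D) (q * D + D) g.
  have [/hasP[i]|_] := boolP (bad q); last by rewrite mulr0 cost_ge0.
  rewrite mem_iota => iw ei; rewrite mulr1; apply: le_trans ei _.
  rewrite /cost (@big_cat_nat _ _ _ i) /=; [|lia|lia].
  rewrite (@big_cat_nat _ _ _ i.+1 i) /=; [|lia|lia]; rewrite big_nat1.
  have := cost_ge0 b (q * D) i g fc; have := cost_ge0 b i.+1 (q * D + D) g fc.
  by rewrite /cost; lra.
have QC : cost c b f 0 (Q * D) g <= cost c b f 0 n g.
  by rewrite (@cost_cat _ _ _ _ 0 (Q * D) n)// lerDl cost_ge0.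
have nbad : \sum_(q < Q) (bad q)%:R <= cost c b f 0 n g / eps.
  rewrite ler_pdivlMr// mulrC; apply: le_trans QC.
  rewrite -[X in cost _ _ _ X](mul0n D) cost_windows// mulr_sumr big_mkord.
  by apply: ler_sum.
(* [q0] is the first window whose start is certainly not before [t]; rounding up costs at most one
   window length. *)
have [q0 tq q0t] : exists2 q0, (t <= q0 * D)%N & (q0 * D <= t + D)%N.
  exists (t %/ D).+1; first by rewrite ltnW// ltn_ceil.
  by rewrite mulSnr leq_add2r leq_trunc_div.
rewrite [leRHS](@cost_cat _ _ _ _ 0 t n)// lerD2l.
have mS : \sum_(q < Q) (window_min b D q)%:R - (t + D)%:R <=
          \sum_(q0 <= q < Q) (window_min b D q)%:R :> R.
  rewrite lerBlDr -(big_mkord xpredT (fun q => (window_min b D q)%:R)).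
  have B : \sum_(0 <= q < minn q0 Q) (window_min b D q)%:R <= (t + D)%:R :> R.
    apply: (@le_trans _ _ (\sum_(0 <= q < minn q0 Q) D%:R)).
      by apply: ler_sum => q _; rewrite ler_nat window_min_le.
    rewrite sumr_const_nat subn0 -mulrnA ler_nat; apply: leq_trans q0t.
    by rewrite mulnC leq_mul2r geq_minl orbT.
  case: (leqP q0 Q) B => q0Q B.
    by rewrite (@big_cat_nat _ _ _ q0 0 Q)//=; lra.
  by rewrite [X in X + _]big_geq ?(ltnW q0Q)// add0r.
have bS : \sum_(q0 <= q < Q) (bad q)%:R <= cost c b f 0 n g / eps.
  apply: le_trans nbad; rewrite -(big_mkord xpredT (fun q => (bad q)%:R)).
  case: (leqP q0 Q) => q0Q; last by rewrite [leLHS]big_geq ?(ltnW q0Q)//; apply: sumr_ge0.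
  by rewrite (@big_cat_nat _ _ _ q0 0 Q)//= lerDr; apply: sumr_ge0.
apply: (@le_trans _ _ (dl * (\sum_(q0 <= q < Q) (window_min b D q)%:R -
   D%:R * \sum_(q0 <= q < Q) (bad q)%:R))).
  rewrite ler_wpM2l//.
  have : D%:R * \sum_(q0 <= q < Q) (bad q)%:R <= D%:R * (cost c b f 0 n g / eps).
    by rewrite ler_wpM2l.
  by lra.
case: (leqP q0 Q) => q0Q; last first.
  by rewrite big_geq ?(ltnW q0Q)// big_geq ?(ltnW q0Q)// mulr0 subr0 mulr0 cost_ge0.
apply: (@le_trans _ _ (cost c b f (q0 * D) (Q * D) g)); last first.
  have q0QD : (q0 * D <= Q * D)%N by rewrite leq_mul2r q0Q orbT.
  rewrite (@cost_cat _ _ _ _ t (q0 * D) n)//; last exact: leq_trans QDn.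
  rewrite (@cost_cat _ _ _ _ (q0 * D) (Q * D) n)//.
  have := cost_ge0 b t (q0 * D) g fc; have := cost_ge0 b (Q * D) n g fc; lra.
rewrite cost_windows// mulr_sumr -sumrB mulr_sumr.
by apply: ler_sum_nat => q /andP[_]; exact: wcost.
Qed.

(** A lazy walk reaching [L] must visit each site of [1..L], and a visit to a site with
    [|f x| <= c - s0] costs at least [s0] whatever the sign. The induction on time charges a site
    when it becomes the new maximum. *)
Lemma range_cost b f g n (s0 : R) : (forall x, `|f x| <= c) -> 0 <= s0 ->
  lazy_walk n g -> g 0%N = 0 -> forall i (L : nat), (i <= n)%N -> L%:Z <= g i ->
  s0 * (\sum_(1 <= x < L.+1) (`|f x%:Z| <= c - s0)%R)%:R <= cost c b f 0 i g.
Proof.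
move=> fc s00 gl g0; elim=> [|i IH] L ilt Lg.
  by rewrite (_ : L = 0%N) ?big_geq// ?mulr0 /cost ?big_geq//; lia.
rewrite (@cost_cat _ _ _ _ 0 i i.+1)//.
have c1 : cost c b f i i.+1 g = wt c b f i.+1 (g i.+1) by rewrite /cost big_nat1.
have [Li|iL] := leP L%:Z (g i).
  by apply: le_trans (IH _ (ltnW ilt) Li) _; rewrite lerDl cost_ge0.
have := gl _ ilt => gd; case: L => [|L] in Lg iL *; first by rewrite big_geq// mulr0 addr_ge0// cost_ge0.
rewrite big_nat_recr//= natrD mulrDr lerD//; first by apply: IH => //; [exact: ltnW|lia].
rewrite c1; have -> : g i.+1 = L.+1%:Z by lia.
have [fL|_] := leP `|f L.+1%:Z| (c - s0); last by rewrite mulr0 wt_ge0.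
by move: fL; rewrite mulr1 /wt ler_norml => /andP[? ?]; case: (b _); lra.
Qed.

End LowerBound.

(** * Mesh passages extracted from a walk *)

Section PassageBounds.
Context (R : realType) (c : R).
Implicit Types (b : nat -> bool) (f : int -> R) (g : nat -> int).

(* From the last visit to 0 before hitting L, the walk is confined to [1, L]; it is
   extended by waiting at 1 and at the end so that everything fits in the mesh w. *)
Lemma passage_of_walk b f g n L w : (forall x, `|f x| <= c) ->
  lazy_walk n g -> g 0%N = 0 -> (0 < L)%N -> L%:Z <= g n -> (0 < w)%N ->
  exists a s e : nat, [/\ (L <= a * w < L + w)%N, (s * w <= n)%N,
    (e * w <= n + 3 * w)%N, (0 < a <= e)%N &
    passage c (fun i => b (s * w + i)%N) f (a * w) (e * w) <= cost c b f 0 n g + 6 * c * w%:R].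
Proof.
move=> fc gl g0 L0 Lgn w0.
have c0 : 0 <= c by apply: le_trans (fc 0).
have [t0 [t0n gt0 t0min]] : exists t0, [/\ (t0 <= n)%N, L%:Z <= g t0 &
    forall k, L%:Z <= g k -> (t0 <= k)%N].
  have ex : exists k, L%:Z <= g k by exists n.
  by exists (ex_minn ex); case: ex_minnP => k Lk kmin; split=> //; exact: kmin.
have t0pos : (0 < t0)%N by case: (t0) gt0 => //; rewrite g0; lia.
have gt0E : g t0 = L%:Z.
  have := gl t0.-1; have := t0min t0.-1; rewrite prednK//.
  by have [|] := leP L%:Z (g t0.-1); lia.
have [s0 [s0t gs0 s0max]] : exists s0, [/\ (s0 < t0)%N, g s0 <= 0 &
    forall k, (k <= t0)%N -> g k <= 0 -> (k <= s0)%N].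
  have ex : exists k, (g k <= 0) && (k <= t0)%N by exists 0%N; rewrite g0.
  have bd : forall k, (g k <= 0) && (k <= t0)%N -> (k <= t0)%N by move=> k /andP[].
  exists (ex_maxn ex bd); case: ex_maxnP => k /andP[gk kt] kmax; split => //.
    by rewrite ltn_neqAle kt andbT; apply/eqP => E; move: gk; rewrite E; lia.
  by move=> j jt gj; apply: kmax; rewrite gj.
have gpos i : (s0 < i <= t0)%N -> 0 < g i <= L%:Z.
  move=> /andP[si it]; apply/andP; split.
    by rewrite ltNge; apply/negP => /(s0max _ it); lia.
  have [->|/eqP nt] := eqVneq i t0; first by rewrite gt0E.
  by rewrite leNgt; apply/negP => /ltW /t0min; lia.
have gs1 : g s0.+1 = 1.
  by have := gpos s0.+1; have := gl s0; lia.
(* Start time is rounded down and [L] up to the mesh. The end time gets two extra meshes: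
   [T * w >= t0 + w] leaves enough time to climb from [L] to [a * w], a distance smaller than
   [w]. *)
set s := (s0 %/ w)%N; set a := (L.-1 %/ w).+1; set T := (t0 %/ w).+2.
have sw : (s * w <= s0 < s * w + w)%N by rewrite leq_trunc_div /= -mulSnr ltn_ceil.
have aw : (L <= a * w < L + w)%N.
  have := leq_trunc_div L.-1 w; have := ltn_ceil L.-1 w0; rewrite /a mulSnr; lia.
have Tw : (t0 + w <= T * w <= t0 + 2 * w)%N.
  have := leq_trunc_div t0 w; have := ltn_ceil t0 w0; rewrite /T !mulSnr; lia.
have sT : (s <= T)%N by rewrite -(leq_pmul2r w0); lia.
clearbody s a T; exists a, s, (T - s)%N; rewrite mulnBl.
(* Up to [w] waiting steps at 1 precede the copied piece and up to [2 * w] steps follow it. At a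
   price of at most [2 * c] each they produce the error [6 * c * w]. *)
pose h i : int := if (i == 0)%N then 0 else if (s * w + i <= s0)%N then 1
  else if (s * w + i <= t0)%N then g (s * w + i)%N
  else (minn (L + (s * w + i - t0)) (a * w))%:Z.
have h0 : h 0%N = 0 by [].
have h_s i : (0 < i)%N -> (s * w + i <= s0)%N -> h i = 1.
  by move=> i0 is0; rewrite /h is0 ifF//; lia.
have h_g i : (0 < i)%N -> (s0 < s * w + i <= t0)%N -> h i = g (s * w + i)%N.
  move=> i0 /andP[is0 it]; rewrite /h it ifF; last by lia.
  by rewrite leqNgt is0.
have h_t i : (t0 <= s * w + i)%N -> (0 < i)%N -> h i = (minn (L + (s * w + i - t0)) (a * w))%:Z.
  rewrite leq_eqVlt => /predU1P[E|it] i0.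
    have -> : h i = g (s * w + i)%N by apply: h_g => //; lia.
    by rewrite -E gt0E; lia.
  have n1 : (s * w + i <= s0)%N = false by lia.
  have n2 : (s * w + i <= t0)%N = false by lia.
  by rewrite /h n1 n2 ifF//; lia.
clearbody h; have hl : forall i, `|h i.+1 - h i| <= 1.
  case=> [|i].
    have [s1|s1] := leqP (s * w + 1) s0; first by rewrite h0 h_s//; lia.
    rewrite h0 h_g//; last by lia.
    by rewrite (_ : (s * w + 1)%N = s0.+1) ?gs1//; lia.
  have [A|A] := leqP (s * w + i.+2) s0; first by rewrite !h_s//; lia.
  have [A1|A1] := leqP (s * w + i.+1) s0.
    rewrite (@h_s i.+1)// h_g//; last by lia.
    by rewrite (_ : (s * w + i.+2)%N = s0.+1) ?gs1//; lia.
  have [A2|A2] := leqP (s * w + i.+2) t0.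
    rewrite !h_g//; [|lia|lia].
    by have := gl (s * w + i.+1)%N; rewrite !addnS; lia.
  rewrite !h_t//; lia.
have hc : confined (a * w) (T * w - s * w) h.
  apply/confinedP; split; first by rewrite h_t; lia.
  move=> i /andP[i0 _].
  have [A|A] := leqP (s * w + i) s0; first by rewrite h_s//; lia.
  have [B|B] := leqP (s * w + i) t0.
    by have := gpos (s * w + i)%N; rewrite h_g//; lia.
  by rewrite h_t; lia.
have hlw : lazy_walk (T * w - s * w) h by move=> i _; exact: hl.
have aT : (a <= T - s)%N.
  rewrite -(leq_pmul2r w0) mulnBl.
  have := @lazy_walk_dist _ _ 0 (T * w - s * w) hlw.
  have /confinedP[-> _] := hc; rewrite h0; lia.
split=> //; [lia|lia|lia|].
apply: le_trans (passage_le_cost c _ f hlw h0 hc) _.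
have ss : (0 <= s0 - s * w)%N by [].
have st : (s0 - s * w <= t0 - s * w)%N by lia.
have tT : (t0 - s * w <= T * w - s * w)%N by lia.
rewrite (cost_cat _ _ _ _ ss (leq_trans st tT)) (cost_cat _ _ _ _ st tT).
have C1 := @cost_le _ c (fun i => b (s * w + i)%N) f _ _ h fc ss.
have C2 := @cost_le _ c (fun i => b (s * w + i)%N) f _ _ h fc tT.
have C3 : cost c (fun i => b (s * w + i)%N) f (s0 - s * w) (t0 - s * w) h <= cost c b f 0 n g.
  rewrite (@eq_cost _ _ _ (fun i => b (s * w + i)%N) _ f _ _ _ (fun i => g (s * w + i)%N)); last first.
    by move=> i ?; rewrite h_g//; lia.
  rewrite -cost_shift !subnKC; [|lia|lia].
  rewrite [leRHS](@cost_cat _ _ _ _ 0 s0 n)//; last by lia.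
  rewrite (@cost_cat _ _ _ _ s0 t0 n)//; last by lia.
  have := cost_ge0 b 0 s0 g fc; have := cost_ge0 b t0 n g fc; lra.
have W1 : (s0 - s * w - 0)%:R <= w%:R :> R by rewrite ler_nat; lia.
have W2 : (T * w - s * w - (t0 - s * w))%:R <= 2 * w%:R :> R by rewrite -natrM ler_nat; lia.
have := ler_wpM2l c0 W1; have := ler_wpM2l c0 W2; lra.
Qed.

End PassageBounds.

(** * An explicit walk that settles on an edge *)

Section WalkToEdge.
Context (R : realType) (c : R).
Implicit Types (b : nat -> bool) (f : int -> R) (g : nat -> int).

Lemma walk_to_edge b f n N s (l : nat) : (forall x, `|f x| <= c) ->
  feasible N s -> (N <= l)%N -> (s + (l - N) <= n)%N ->
  let k := count (fun i => b i.+1) (iota 0 n) in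
  exists g, [/\ lazy_walk n g, g 0%N = 0 &
    cost c b f 0 n g <= passage c b f N s + 2 * c * (l - N)%:R +
      discrepancy c f l%:Z * (maxn k (n - k))%:R].
Proof.
move=> fc Ns Nl tn k.
have [g1 [l1 z1 /confinedP[e1 _] ->]] := passage_attained b fc Ns.
set t := (s + (l - N))%N in tn.
(* With this test a positive sign is spent on the endpoint with the smaller field value and a
   negative sign on the endpoint with the larger one. *)
pose e := f l%:Z <= f (l%:Z + 1).
pose g i : int := if (i <= s)%N then g1 i else if (i <= t)%N then (N + (i - s))%:Z
  else if b i == e then l%:Z else l%:Z + 1.
have gs i : (i <= s)%N -> g i = g1 i by move=> is_; rewrite /g is_.
have gm i : (s <= i <= t)%N -> g i = (N + (i - s))%:Z.
  move=> /andP[]; rewrite leq_eqVlt => /predU1P[<-|si] it.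
    by rewrite gs// e1 subnn addn0.
  by rewrite /g leqNgt si it.
have gt i : (t < i)%N -> g i = if b i == e then l%:Z else l%:Z + 1.
  move=> ti; rewrite /g; have -> : (i <= s)%N = false by rewrite /t in ti; lia.
  by rewrite leqNgt ti.
exists g; split.
- move=> i _; have [A|A] := ltnP i s; first by rewrite !gs ?(ltnW A)//; exact: l1.
  have [B|B] := ltnP i t; first by rewrite !gm; lia.
  rewrite (gt i.+1)//; have [C|C] := eqVneq i t.
    by rewrite C gm; [rewrite /t; case: ifP => _; lia|rewrite /t; lia].
  rewrite gt; last by lia.
  by case: ifP => _; case: ifP => _; lia.
- by rewrite gs.
have st : (s <= t)%N by rewrite leq_addr.
rewrite (cost_cat c b f g (leq0n s) (leq_trans st tn)) (cost_cat c b f g st tn) -addrA.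
apply: lerD.
  by rewrite le_eqVlt; apply/orP; left; apply/eqP/eq_cost => i /andP[_ ?]; rewrite gs.
apply: lerD; first by apply: le_trans (cost_le _ _ fc st) _; rewrite /t addKn.
(* [A] and [A'] are the prices of a positive and of a negative sign on the edge. Both are
   nonnegative and they add up to the discrepancy, so the total is at most the discrepancy times the
   more frequent sign. *)
pose A := c + Num.min (f l%:Z) (f (l%:Z + 1)).
pose A' := c - Num.max (f l%:Z) (f (l%:Z + 1)).
have [/andP[f1 f1'] /andP[f2 f2']] : (- c <= f l%:Z <= c) /\ (- c <= f (l%:Z + 1) <= c).
  by rewrite -!ler_norml.
have A0 : 0 <= A by rewrite /A; case: (leP (f l%:Z)) => _; lra.
have A0' : 0 <= A' by rewrite /A'; case: (leP (f l%:Z)) => _; lra.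
have AA : A + A' = discrepancy c f l%:Z.
  rewrite /A /A' /discrepancy; case: (leP (f l%:Z)) => ff.
    by rewrite ger0_norm ?subr_ge0//; lra.
  by rewrite ltr0_norm ?subr_lt0//; lra.
have wtE i : (t < i)%N -> wt c b f i (g i) = if b i then A else A'.
  move=> ti; rewrite /wt gt// /A /A' /e.
  by case: (b i); case: (leP (f l%:Z)) => _.
have -> : cost c b f t n g = \sum_(t <= i < n) (if b i.+1 then A else A').
  by apply: eq_big_nat => i /andP[ti _]; rewrite wtE.
apply: (@le_trans _ _ (\sum_(0 <= i < n) (if b i.+1 then A else A'))).
  rewrite (@big_cat_nat _ _ _ t 0 n)//= lerDr; apply: sumr_ge0 => i _; by case: ifP.
have -> : \sum_(0 <= i < n) (if b i.+1 then A else A') = A *+ k + A' *+ (n - k).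
  rewrite /k /index_iota subn0; set r := iota 0 n.
  rewrite (_ : (n - _)%N = (size r - count (fun i => b i.+1) r)%N); last by rewrite size_iota.
  elim: r => [|i r IH] /=; first by rewrite big_nil subn0 !mulr0n addr0.
  rewrite big_cons {}IH; have := count_size (fun i => b i.+1) r.
  by case: (b _) => ?; rewrite ?add1n ?add0n ?subSS ?subSn// mulrSr; ring.
rewrite -AA mulrDl; apply: lerD; rewrite -[leLHS]mulr_natr ler_wpM2l// ler_nat ?leq_maxl ?leq_maxr//.
Qed.

End WalkToEdge.

(** * Independence of cylinder events *)

(** A pi-system of product events. Measurability for the sigma-algebra that it generates, written
    [depends_on R S], expresses that a quantity is a function of the coordinates in [S]. *)
Definition cyl (R : realType) (I : eqType) (S : seq I) : set (set (I -> R)) :=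
  [set C | exists A : I -> set R, (forall i, measurable (A i)) /\
     C = [set v | forall i, i \in S -> A i (v i)]].

Notation depends_on R S := (g_sigma_algebraType (@cyl R _ S)).

Section Cylinders.
Context (R : realType) (I : eqType).

Lemma cylI (S : seq I) : setI_closed (@cyl R I S).
Proof.
move=> _ _ [A [mA ->]] [A' [mA' ->]]; exists (fun i => A i `&` A' i); split.
  by move=> i; exact: measurableI.
apply/seteqP; split=> [v [h h'] i iS|v h]; first by split; [exact: h|exact: h'].
by split=> i /h[].
Qed.

Lemma cylT (S : seq I) : @cyl R I S setT.
Proof. by exists (fun=> setT); split=> //; apply/seteqP; split. Qed.

Lemma measurable_coord (S : seq I) i : i \in S ->
  measurable_fun setT ((fun v : I -> R => v i) : depends_on R S -> R).
Proof.
move=> iS _ Y mY; rewrite setTI; apply: sub_sigma_algebra.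
exists (fun j => if j == i then Y else setT); split.
  by move=> j; case: ifP.
apply/seteqP; split=> [v /= Yv j jS|v /(_ i iS)]; last by rewrite eqxx.
by case: ifP => // /eqP ->.
Qed.

Context d (T : measurableType d) (P : probability T R).
Implicit Types X : I -> T -> R.

Lemma measurable_env X (S : seq I) : (forall i, measurable_fun setT (X i)) ->
  measurable_fun setT ((fun w i => X i w) : T -> depends_on R S).
Proof.
move=> mX; apply: (@measurability _ _ T (depends_on R S) setT _ (@cyl R I S)) => //.
move=> _ [_ [A [mA ->]] <-]; rewrite setTI.
have -> : (fun w i => X i w) @^-1` [set v | forall i, i \in S -> A i (v i)] =
    \bigcap_(i in [set` S]) (X i @^-1` A i) by apply/seteqP; split.
apply: fin_bigcap_measurable; first exact: finite_seq.
by move=> i _; rewrite -[X in measurable X]setTI; exact: mX.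
Qed.

Lemma env_preimage X (S : seq I) (A : I -> set R) :
  (fun w i => X i w) @^-1` [set v | forall i, i \in S -> A i (v i)] =
  \bigcap_(i in [set` S]) (X i @^-1` A i).
Proof. by apply/seteqP; split. Qed.

Lemma probability_fine (A : set T) : measurable A -> (fine (P A))%:E = P A.
Proof. by move=> mA; rewrite fineK// fin_num_measure. Qed.

Lemma measurable_preimage X i (A : set R) : (forall i, measurable_fun setT (X i)) ->
  measurable A -> measurable (X i @^-1` A).
Proof. by move=> mX mA; rewrite -[X in measurable X]setTI; exact: mX. Qed.

(** Both pushforward laws agree on cylinders, where independence reduces them to products of
    marginals; uniqueness of measures on a pi-system does the rest. It supplies invariance of laws
    under translation and reflection. *)
Lemma independent_cyl_law X X' (S : seq I) : uniq S ->
  mutually_independent P X -> mutually_independent P X' ->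
  (forall i, measurable_fun setT (X i)) -> (forall i, measurable_fun setT (X' i)) ->
  (forall i A, measurable A -> P (X i @^-1` A) = P (X' i @^-1` A)) ->
  forall E : set (depends_on R S), measurable E ->
  P ((fun w i => X i w) @^-1` E) = P ((fun w i => X' i w) @^-1` E).
Proof.
move=> uS iX iX' mX mX' XX' E mE.
pose f : {mfun T >-> depends_on R S} := HB.pack ((fun w i => X i w) : T -> depends_on R S)
  (isMeasurableFun.Build _ _ _ _ _ (measurable_env mX)).
pose f' : {mfun T >-> depends_on R S} := HB.pack ((fun w i => X' i w) : T -> depends_on R S)
  (isMeasurableFun.Build _ _ _ _ _ (measurable_env mX')).
apply: (@measure_unique _ R (depends_on R S) (@cyl R I S) (fun=> setT) erefl _ _ _ (distribution P f) (distribution P f')) => //.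
- exact: cylI.
- by move=> _; exact: cylT.
- by rewrite bigcup_const//; exists 0%N.
- move=> _ [A [mA ->]]; rewrite /distribution /pushforward/=.
  rewrite [X in P X = _]env_preimage [X in _ = P X]env_preimage.
  have mb X0 : (forall i, measurable_fun setT (X0 i)) ->
      measurable (\bigcap_(i in [set` S]) (X0 i @^-1` A i)).
    move=> mX0; apply: fin_bigcap_measurable; first exact: finite_seq.
    by move=> i _; exact: measurable_preimage.
  rewrite -probability_fine; last exact: mb.
  rewrite -[RHS]probability_fine; last exact: mb.
  by rewrite iX// iX'//; congr EFin; apply: eq_bigr => i _; rewrite XX'.
- by move=> _; rewrite /= probability_setT ltry.
Qed.

(** Independence of two disjoint blocks, extended from cylinders one factor at a time. With one
    event fixed, restricting [P] to it and scaling the law by its probability give two finite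
    measures that agree on a pi-system. *)
Lemma independent_cyl_prod X (S1 S2 : seq I) : uniq (S1 ++ S2) ->
  mutually_independent P X -> (forall i, measurable_fun setT (X i)) ->
  forall (E1 : set (depends_on R S1)) (E2 : set (depends_on R S2)),
  measurable E1 -> measurable E2 ->
  let Z := fun w i => X i w in
  P (Z @^-1` E1 `&` Z @^-1` E2) = (P (Z @^-1` E1) * P (Z @^-1` E2))%E.
Proof.
move=> uS iX mX E1 E2 mE1 mE2 Z.
have [uS1 uS2] : uniq S1 /\ uniq S2 by move: uS; rewrite cat_uniq => /and3P[].
pose f1 : {mfun T >-> depends_on R S1} := HB.pack (Z : T -> depends_on R S1)
  (isMeasurableFun.Build _ _ _ _ _ (measurable_env mX)).
pose f2 : {mfun T >-> depends_on R S2} := HB.pack (Z : T -> depends_on R S2)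
  (isMeasurableFun.Build _ _ _ _ _ (measurable_env mX)).
have mZ S (E : set (depends_on R S)) : measurable E -> measurable (Z @^-1` E).
  by move=> mE; rewrite -[X in measurable X]setTI; apply: (measurable_env mX).
have mC S C : @cyl R I S C -> measurable (Z @^-1` C).
  by move=> CS; apply: (mZ S); exact: sub_sigma_algebra.
have step0 C1 C2 : @cyl R I S1 C1 -> @cyl R I S2 C2 ->
    P (Z @^-1` C1 `&` Z @^-1` C2) = (P (Z @^-1` C1) * P (Z @^-1` C2))%E.
  move=> CS1 CS2; have m1 := mC _ _ CS1; have m2 := mC _ _ CS2.
  rewrite -(probability_fine m1) -(probability_fine m2).
  rewrite -(probability_fine (measurableI _ _ m1 m2)) {m1 m2}.
  move: CS1 CS2 => [A [mA ->]] [A' [mA' ->]]; rewrite -EFinM; congr EFin.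
  rewrite [X in X `&` _]env_preimage [X in _ `&` X]env_preimage.
  rewrite [X in _ = fine (P X) * _]env_preimage [X in _ = _ * fine (P X)]env_preimage.
  pose A12 i := if i \in S1 then A i else A' i.
  have d12 i : i \in S2 -> i \notin S1.
    move=> i2; apply/negP => i1; move: uS; rewrite cat_uniq => /and3P[_ /hasPn/(_ _ i2)].
    by rewrite /= i1.
  have -> : \bigcap_(i in [set` S1]) (X i @^-1` A i) `&` \bigcap_(i in [set` S2]) (X i @^-1` A' i)
     = \bigcap_(i in [set` (S1 ++ S2)]) (X i @^-1` A12 i).
    apply/seteqP; split=> [w [h1 h2] i /=|w h].
      rewrite mem_cat => /orP[i1|i2]; rewrite /A12; first by rewrite i1; exact: h1.
      by rewrite (negbTE (d12 _ i2)); exact: h2.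
    split=> i /= iS; have := h i; rewrite /A12 /= mem_cat iS ?orbT => /(_ erefl) //.
    by rewrite (negbTE (d12 _ iS)).
  have mA12 i : measurable (A12 i) by rewrite /A12; case: ifP.
  rewrite iX// iX// iX// big_cat/=; congr (_ * _); rewrite !big_seq; apply: eq_bigr => i iS.
    by rewrite /A12 iS.
  by rewrite /A12 (negbTE (d12 _ iS)).
have step1 C2 : @cyl R I S2 C2 ->
    P (Z @^-1` E1 `&` Z @^-1` C2) = (P (Z @^-1` E1) * P (Z @^-1` C2))%E.
  move=> CS2; have mC2 := mC _ _ CS2.
  have r0 : 0 <= fine (P (Z @^-1` C2)) by rewrite fine_ge0.
  pose m1 := pushforward (mrestr P mC2) f1.
  pose m2 := mscale (NngNum r0) (distribution P f1).
  have := @measure_unique _ R (depends_on R S1) (@cyl R I S1) (fun=> setT) erefl _ _ _ m1 m2.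
  move=> /(_ (@cylI _)) H.
  have /H : forall i : nat, @cyl R I S1 setT by move=> _; exact: cylT.
  move=> {}H; have /H : \bigcup_(k : nat) (setT : set (depends_on R S1)) = setT.
    by rewrite bigcup_const//; exists 0%N.
  have m2E A : m2 A = (P (Z @^-1` C2) * P (Z @^-1` A))%E.
    by rewrite -(probability_fine mC2).
  move=> {}H; rewrite muleC -m2E; apply: (H (measurable_env mX) _ _ E1 mE1).
  - by move=> C1 CS1; apply: etrans (esym (m2E C1)); rewrite muleC; exact: step0.
  - move=> _; apply: (@le_lt_trans _ _ 1%E); last exact: ltry.
  exact: (probability_le1 P (measurableI _ _ measurableT mC2)).
have mE1' := mZ _ _ mE1.
have r0 : 0 <= fine (P (Z @^-1` E1)) by rewrite fine_ge0.
pose m1 := pushforward (mrestr P mE1') f2.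
pose m2 := mscale (NngNum r0) (distribution P f2).
have := @measure_unique _ R (depends_on R S2) (@cyl R I S2) (fun=> setT) erefl _ _ _ m1 m2.
move=> /(_ (@cylI _)) H.
have /H : forall i : nat, @cyl R I S2 setT by move=> _; exact: cylT.
move=> {}H; have /H : \bigcup_(k : nat) (setT : set (depends_on R S2)) = setT.
  by rewrite bigcup_const//; exists 0%N.
have m2E A : m2 A = (P (Z @^-1` E1) * P (Z @^-1` A))%E.
  by rewrite -(probability_fine mE1').
move=> {}H; rewrite setIC -m2E; apply: (H (measurable_env mX) _ _ E2 mE2).
- by move=> C2 CS2; apply: etrans (esym (m2E C2)); rewrite -step1// setIC.
- move=> _; apply: (@le_lt_trans _ _ 1%E); last exact: ltry.
  exact: (probability_le1 P (measurableI _ _ measurableT mE1')).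
Qed.

End Cylinders.

(** * Expectations of bounded variables and moment bounds *)

Section BoundedExpectation.
Context d (T : measurableType d) (R : realType) (P : probability T R).
Implicit Types (f g : T -> R) (A : set T).

Definition bmeas f := measurable_fun setT f /\ exists C, forall w, `|f w| <= C.

Definition Ex f : R := fine (\int[P]_w (f w)%:E).

Definition pr A : R := fine (P A).

Lemma bmeas_integrable f : bmeas f -> P.-integrable setT (EFin \o f).
Proof.
move=> [mf [C fC]]; apply: measurable_bounded_integrable => //.
  exact: le_lt_trans (probability_le1 P measurableT) (ltry 1).
by exists C; split; rewrite ?num_real // => x Cx w _; exact: le_trans (fC w) (ltW Cx).
Qed.

Lemma bmeas_cst (r : R) : bmeas (fun=> r).
Proof. by split; [exact: measurable_cst|exists `|r|]. Qed.

Lemma bmeasD f g : bmeas f -> bmeas g -> bmeas (fun w => f w + g w).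
Proof.
move=> [mf [C fC]] [mg [D gD]]; split; first exact: measurable_funD.
by exists (C + D) => w; apply: le_trans (ler_normD _ _) (lerD _ _).
Qed.

Lemma bmeasM f g : bmeas f -> bmeas g -> bmeas (fun w => f w * g w).
Proof.
move=> [mf [C fC]] [mg [D gD]]; split; first exact: measurable_funM.
by exists (C * D) => w; rewrite normrM ler_pM.
Qed.

Lemma bmeasZ r f : bmeas f -> bmeas (fun w => r * f w).
Proof. exact: (bmeasM (bmeas_cst r)). Qed.

Lemma bmeas_sum (I : Type) (r : seq I) (F : I -> T -> R) :
  (forall i, bmeas (F i)) -> bmeas (fun w => \sum_(i <- r) F i w).
Proof.
move=> mF; elim: r => [|i r IH].
  by under eq_fun do rewrite big_nil; exact: bmeas_cst.
by under eq_fun do rewrite big_cons; exact: bmeasD.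
Qed.

Lemma bmeas_indic A : measurable A -> bmeas (\1_A : T -> R).
Proof.
move=> mA; split; first exact: measurable_indic.
by exists 1 => w; rewrite indicE normr_nat; case: (_ \in _).
Qed.

Lemma Ex_cst r : Ex (fun=> r) = r.
Proof. by rewrite /Ex integral_cst//= probability_setT mule1. Qed.

Lemma ExD f g : bmeas f -> bmeas g -> Ex (fun w => f w + g w) = Ex f + Ex g.
Proof. by move=> /bmeas_integrable ? /bmeas_integrable ?; exact: RintegralD. Qed.

Lemma ExZ r f : bmeas f -> Ex (fun w => r * f w) = r * Ex f.
Proof. by move=> /bmeas_integrable ?; exact: RintegralZl. Qed.

Lemma Ex_sum (I : Type) (r : seq I) (F : I -> T -> R) :
  (forall i, bmeas (F i)) -> Ex (fun w => \sum_(i <- r) F i w) = \sum_(i <- r) Ex (F i).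
Proof.
move=> mF; elim: r => [|i r IH].
  by rewrite big_nil -[RHS](Ex_cst 0); congr Ex; apply/funext => w; rewrite big_nil.
rewrite big_cons -IH -ExD//; last exact: bmeas_sum.
by congr Ex; apply/funext => w; rewrite big_cons.
Qed.

Lemma Ex_le f g : bmeas f -> bmeas g -> (forall w, f w <= g w) -> Ex f <= Ex g.
Proof.
by move=> /bmeas_integrable ? /bmeas_integrable ? fg; apply: le_Rintegral => // w _.
Qed.

Lemma Ex_indic A : measurable A -> Ex \1_A = pr A.
Proof. by move=> mA; rewrite /Ex integral_indic// setIT. Qed.

Lemma pr_ge0 A : 0 <= pr A. Proof. exact: fine_ge0. Qed.

Lemma pr_le1 A : measurable A -> pr A <= 1.
Proof.
move=> mA; rewrite -[1]/(fine 1%E) fine_le ?fin_num_measure//.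
exact: probability_le1.
Qed.

Lemma pr_le A A' : measurable A -> measurable A' -> A `<=` A' -> pr A <= pr A'.
Proof.
move=> mA mA' AA'; rewrite fine_le ?fin_num_measure//.
by apply: le_measure => //; rewrite inE.
Qed.

Lemma prU A A' : measurable A -> measurable A' -> pr (A `|` A') <= pr A + pr A'.
Proof.
move=> mA mA'; rewrite -fineD ?fin_num_measure// fine_le ?fin_num_measure//.
- exact: measurableU.
- by rewrite fin_numD !fin_num_measure.
- exact: measureU2.
Qed.

Lemma prC A : measurable A -> pr (~` A) = 1 - pr A.
Proof.
move=> mA; rewrite /pr probability_setC// fineB ?fin_num_measure//.
Qed.

Lemma pr_union_sum (I : choiceType) (r : seq I) (A : I -> set T) : (forall i, measurable (A i)) ->
  pr (\bigcup_(i in [set` r]) A i) <= \sum_(i <- r) pr (A i).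
Proof.
move=> mA; rewrite bigcup_seq; elim: r => [|i r IH].
  by rewrite !big_nil /pr measure0.
rewrite !big_cons; apply: le_trans (prU _ _) _ => //; last by rewrite lerD2l.
exact: bigsetU_measurable.
Qed.

Lemma measurable_ge f (a : R) : measurable_fun setT f -> measurable [set w | a <= f w].
Proof.
move=> mf; have -> : [set w | a <= f w] = setT `&` f @^-1` `[a, +oo[.
  by rewrite setTI; apply/seteqP; split=> w /=; rewrite in_itv/= andbT.
exact: mf.
Qed.

Lemma markov_pr f a : bmeas f -> (forall w, 0 <= f w) ->
  a * pr [set w | a <= f w] <= Ex f.
Proof.
move=> bf f0; have mA : measurable [set w | a <= f w].
  by apply: measurable_ge; case: bf.
rewrite -Ex_indic// -ExZ; last exact: bmeas_indic.
apply: Ex_le => //; first exact/bmeasZ/bmeas_indic.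
move=> w; rewrite indicE; have [/set_mem/= aw|_] := boolP (_ \in _).
  by rewrite mulr1.
by rewrite mulr0.
Qed.

(** After centring, the off-diagonal terms of the squared sum vanish, and each diagonal term is at
    most [C ^+ 2] because [Y i] and [m] both lie in [[0, C]]. *)
Lemma second_moment_uncorrelated k (Y : nat -> T -> R) (C m : R) :
  (forall i, measurable_fun setT (Y i)) ->
  (forall i w, 0 <= Y i w <= C) -> (forall i, Ex (Y i) = m) ->
  (forall i j, (i < k)%N -> (j < k)%N -> i != j -> Ex (fun w => Y i w * Y j w) = m ^+ 2) ->
  bmeas (fun w => \sum_(i < k) Y i w - k%:R * m) /\
  Ex (fun w => (\sum_(i < k) Y i w - k%:R * m) ^+ 2) <= k%:R * C ^+ 2.
Proof.
move=> mY YC Em EYY.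
have bY i : bmeas (Y i).
  split=> //; exists C => w; have /andP[? ?] := YC i w; by rewrite ger0_norm.
pose V i w := Y i w - m.
have bV i : bmeas (V i) by apply: bmeasD => //; exact: bmeas_cst.
have mC : 0 <= m <= C.
  rewrite -(Em 0%N); apply/andP; split.
    rewrite -[leLHS]Ex_cst; apply: Ex_le => //; first exact: bmeas_cst.
    by move=> w; case/andP: (YC 0%N w).
  rewrite -[leRHS]Ex_cst; apply: Ex_le => //; first exact: bmeas_cst.
  by move=> w; case/andP: (YC 0%N w).
have EV i j : (i < k)%N -> (j < k)%N -> Ex (fun w => V i w * V j w) <= C ^+ 2 * (i == j)%:R.
  move=> ik jk; have [<-|ij] := eqVneq i j.
    rewrite mulr1 -[leRHS]Ex_cst; apply: Ex_le => [||w]; [exact: bmeasM|exact: bmeas_cst|].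
    have /andP[? ?] := YC i w; case/andP: mC => ? ?.
    rewrite -expr2 -[leLHS]real_normK ?num_real// lerXn2r ?nnegrE//; first by lra.
    by rewrite ler_norml /V; lra.
  rewrite mulr0 (_ : (fun w => _) = (fun w => Y i w * Y j w + ((- m) * Y i w + ((- m) * Y j w + m ^+ 2)))); last first.
    by apply/funext => w; rewrite /V; ring.
  have bm (f g : T -> R) := @bmeasD f g.
  rewrite !ExD; [|exact: bmeasZ|exact: bmeas_cst|exact: bmeasZ|by apply: bmeasD; [exact: bmeasZ|exact: bmeas_cst]
     |exact: bmeasM|by apply: bmeasD; [exact: bmeasZ|apply: bmeasD; [exact: bmeasZ|exact: bmeas_cst]]].
  rewrite (ExZ (- m) (bY i)) (ExZ (- m) (bY j)) (EYY i j)// !Em Ex_cst; lra.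
pose S w := \sum_(i < k) V i w.
have SE w : S w = \sum_(i < k) Y i w - k%:R * m.
  by rewrite /S sumrB sumr_const card_ord mulr_natl.
have bS : bmeas S by apply: bmeas_sum => i; exact: bV.
have ES : Ex (fun w => S w * S w) <= k%:R * C ^+ 2.
  rewrite (_ : (fun w => S w * S w) = (fun w => \sum_(i < k) \sum_(j < k) V i w * V j w)); last first.
    by apply/funext => w; rewrite /S mulr_suml; apply: eq_bigr => i _; rewrite mulr_sumr.
  rewrite Ex_sum; last by move=> i; apply: bmeas_sum => j; exact: bmeasM.
  rewrite (_ : k%:R * C ^+ 2 = \sum_(i < k) C ^+ 2); last by rewrite sumr_const card_ord mulr_natl.
  apply: ler_sum => i _; rewrite Ex_sum; last by move=> j; exact: bmeasM.
  apply: (@le_trans _ _ (\sum_(j < k) C ^+ 2 * ((i : nat) == j)%:R)).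
    by apply: ler_sum => j _; exact: EV.
  rewrite (bigD1 i)//= eqxx mulr1 big1 ?addr0// => j ji.
  by rewrite (inj_eq val_inj) eq_sym (negbTE ji) mulr0.
have SE' : (fun w => \sum_(i < k) Y i w - k%:R * m) = S by apply/funext => w; rewrite SE.
rewrite SE'; split=> //; rewrite (_ : (fun w => _) = (fun w => S w * S w))//.
by apply/funext => w; rewrite -SE expr2.
Qed.

Lemma chebyshev_uncorrelated k (Y : nat -> T -> R) (C m a : R) :
  (forall i, measurable_fun setT (Y i)) ->
  (forall i w, 0 <= Y i w <= C) -> (forall i, Ex (Y i) = m) ->
  (forall i j, (i < k)%N -> (j < k)%N -> i != j -> Ex (fun w => Y i w * Y j w) = m ^+ 2) -> 0 < a ->
  pr [set w | a <= `|\sum_(i < k) Y i w - k%:R * m|] <= k%:R * C ^+ 2 / a ^+ 2.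
Proof.
move=> mY YC Em EYY a0; have [bS ES] := second_moment_uncorrelated mY YC Em EYY.
rewrite ler_pdivlMr ?exprn_gt0// mulrC; apply: le_trans _ ES.
set S := fun w => _ in bS.
have SS0 w : 0 <= S w ^+ 2 by rewrite sqr_ge0.
apply: le_trans (markov_pr (a ^+ 2) (bmeasM bS bS) SS0).
rewrite ler_wpM2l ?sqr_ge0// le_eqVlt; apply/orP; left; apply/eqP; congr pr.
apply/seteqP; split=> w /=; rewrite -/(S w) -expr2 -[X in _ ^+ 2 <= X]real_normK ?num_real//.
  by move=> h; rewrite ler_sqr// nnegrE// ltW.
by rewrite ler_sqr// nnegrE// ltW.
Qed.

End BoundedExpectation.

(** * Expectations under equality of laws and independence *)

Section IndependentExpectation.
Context (R : realType) (I : eqType) d (T : measurableType d) (P : probability T R).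
Implicit Types X : I -> T -> R.
Local Notation Ex := (Ex P).

Lemma Ex_same_law X X' (S : seq I) (phi : (I -> R) -> R) : uniq S ->
  mutually_independent P X -> mutually_independent P X' ->
  (forall i, measurable_fun setT (X i)) -> (forall i, measurable_fun setT (X' i)) ->
  (forall i A, measurable A -> P (X i @^-1` A) = P (X' i @^-1` A)) ->
  measurable_fun setT (phi : depends_on R S -> R) -> (forall v, 0 <= phi v) ->
  Ex (fun w => phi (fun i => X i w)) = Ex (fun w => phi (fun i => X' i w)).
Proof.
move=> uS iX iX' mX mX' XX' mphi phi0.
pose f : {mfun T >-> depends_on R S} := HB.pack ((fun w i => X i w) : T -> depends_on R S)
  (isMeasurableFun.Build _ _ _ _ _ (measurable_env mX)).
pose f' : {mfun T >-> depends_on R S} := HB.pack ((fun w i => X' i w) : T -> depends_on R S)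
  (isMeasurableFun.Build _ _ _ _ _ (measurable_env mX')).
have mphiE : measurable_fun setT ((fun v => (phi v)%:E) : depends_on R S -> \bar R).
  exact/measurable_EFinP.
have phiE0 : forall v : depends_on R S, (0 <= (phi v)%:E)%E by move=> v; rewrite lee_fin.
rewrite /Ex.
have -> : (\int[P]_w (phi (fun i => X i w))%:E =
  \int[distribution P f]_v ((fun v => (phi v)%:E) : depends_on R S -> \bar R) v)%E.
  by rewrite ge0_integral_distribution.
have -> : (\int[P]_w (phi (fun i => X' i w))%:E =
  \int[distribution P f']_v ((fun v => (phi v)%:E) : depends_on R S -> \bar R) v)%E.
  by rewrite ge0_integral_distribution.
congr fine; apply: eq_measure_integral => A mA _.
exact: (independent_cyl_law uS iX iX' mX mX' XX' mA).
Qed.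

(** The joint law of the two restrictions of the environment is the product of their laws, by
    uniqueness on rectangles; Tonelli then factors the integral. *)
Lemma Ex_independent X (S1 S2 : seq I) (phi1 phi2 : (I -> R) -> R) C : uniq (S1 ++ S2) ->
  mutually_independent P X -> (forall i, measurable_fun setT (X i)) ->
  measurable_fun setT (phi1 : depends_on R S1 -> R) ->
  measurable_fun setT (phi2 : depends_on R S2 -> R) ->
  (forall v, 0 <= phi1 v <= C) -> (forall v, 0 <= phi2 v <= C) ->
  let Z := fun w i => X i w in
  Ex (fun w => phi1 (Z w) * phi2 (Z w)) = Ex (fun w => phi1 (Z w)) * Ex (fun w => phi2 (Z w)).
Proof.
move=> uS iX mX m1 m2 b1 b2 Z.
pose f1 : {mfun T >-> depends_on R S1} := HB.pack (Z : T -> depends_on R S1)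
  (isMeasurableFun.Build _ _ _ _ _ (measurable_env mX)).
pose f2 : {mfun T >-> depends_on R S2} := HB.pack (Z : T -> depends_on R S2)
  (isMeasurableFun.Build _ _ _ _ _ (measurable_env mX)).
have mZZ : measurable_fun setT (fun w => (Z w : depends_on R S1, Z w : depends_on R S2)).
  by apply: measurable_fun_pair; exact: measurable_env.
pose f12 : {mfun T >-> (depends_on R S1 * depends_on R S2)%type} :=
  HB.pack (fun w => (Z w : depends_on R S1, Z w : depends_on R S2))
  (isMeasurableFun.Build _ _ _ _ _ mZZ).
have E1 : (\int[P]_w (phi1 (Z w))%:E)%E =
  (\int[distribution P f1]_v ((fun v => (phi1 v)%:E) : depends_on R S1 -> \bar R) v)%E.
  rewrite ge0_integral_distribution//; first exact/measurable_EFinP.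
  by move=> v; rewrite lee_fin; case/andP: (b1 v).
have E2 : (\int[P]_w (phi2 (Z w))%:E)%E =
  (\int[distribution P f2]_v ((fun v => (phi2 v)%:E) : depends_on R S2 -> \bar R) v)%E.
  rewrite ge0_integral_distribution//; first exact/measurable_EFinP.
  by move=> v; rewrite lee_fin; case/andP: (b2 v).
pose h (v : depends_on R S1 * depends_on R S2) := (phi1 v.1 * phi2 v.2)%:E.
have mh : measurable_fun setT h.
  apply/measurable_EFinP/measurable_funM; apply: measurableT_comp => //.
have h0 v : (0 <= h v)%E.
  by rewrite lee_fin mulr_ge0//; [case/andP: (b1 v.1)|case/andP: (b2 v.2)].
have E12 : (\int[P]_w (phi1 (Z w) * phi2 (Z w))%:E)%E = (\int[distribution P f12]_v h v)%E.
  by rewrite ge0_integral_distribution.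
have eqm : forall A, measurable A -> (distribution P f1 \x distribution P f2)%E A = distribution P f12 A.
  apply: product_measure_unique => A B mA mB.
  exact: (independent_cyl_prod uS iX mX mA mB).
have bphi S (phi : (I -> R) -> R) : measurable_fun setT (phi : depends_on R S -> R) ->
    (forall v, 0 <= phi v <= C) -> bmeas (fun w => phi (Z w)).
  move=> mphi bphi; split; last first.
    by exists C => w; case/andP: (bphi (Z w)) => ? ?; rewrite ger0_norm.
  exact: (measurableT_comp mphi (measurable_env mX)).
have fin2 : (\int[P]_w (phi2 (Z w))%:E)%E \is a fin_num.
  by apply: integrable_fin_num => //; exact/bmeas_integrable/(bphi S2).
have fin1 : (\int[P]_w (phi1 (Z w))%:E)%E \is a fin_num.
  by apply: integrable_fin_num => //; exact/bmeas_integrable/(bphi S1).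
have P20 : (0 <= \int[P]_w (phi2 (Z w))%:E)%E.
  by apply: integral_ge0 => w _; rewrite lee_fin; case/andP: (b2 (Z w)).
rewrite /Ex -fineM// E12; congr fine.
rewrite -(@eq_measure_integral _ _ _ _ _ _ h (fun A mA _ => eqm A mA)).
rewrite fubini_tonelli1//=.
rewrite /fubini_F /h /=.
under eq_integral => x _.
  under eq_integral => y _ do rewrite EFinM.
  rewrite ge0_integralZl_EFin//; [|by move=> y _; rewrite lee_fin; case/andP: (b2 y)
    |exact/measurable_EFinP|by case/andP: (b1 x)].
  rewrite -E2; over.
rewrite ge0_integralZr//; [by rewrite E1|exact/measurable_EFinP|].
by move=> x _; rewrite lee_fin; case/andP: (b1 x).
Qed.

End IndependentExpectation.

(** * Power asymptotics of laws near the edge of the support *)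

Section Asymptotics.
Context (R : realType).
Implicit Types (f : R -> R) (C p : R).

(** Equivalence of [f x] with [C * x^p] at [0+]. The point [x = 0] is included, so for nonzero [p]
    it also forces [f 0 = 0]. *)
Definition asym f C p := forall e, 0 < e -> exists2 dl, 0 < dl &
  forall x, 0 <= x < dl -> `|f x - C * x `^ p| <= e * x `^ p.

Lemma asymD f f' C C' p : asym f C p -> asym f' C' p -> asym (fun x => f x + f' x) (C + C') p.
Proof.
move=> a a' e e0; have e2 : 0 < e / 2 by rewrite divr_gt0.
have [d d0 h] := a _ e2; have [d' d'0 h'] := a' _ e2.
exists (Num.min d d'); first by rewrite lt_min d0.
move=> x /andP[x0]; rewrite lt_min => /andP[xd xd'].
have := h x; rewrite x0 xd => /(_ isT); have := h' x; rewrite x0 xd' => /(_ isT).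
rewrite (_ : f x + f' x - _ = (f x - C * x `^ p) + (f' x - C' * x `^ p)); last by ring.
have := ler_normD (f x - C * x `^ p) (f' x - C' * x `^ p); lra.
Qed.

(* The points ((i / m) ^ (1 / k)) split [0, 1] into pieces of equal x ^ k-increment,
   so that the upper and lower Darboux sums of the convolution telescope. *)
Lemma asym_convolution (HU HV S : R -> R) C k : 0 < C -> 0 < k ->
  asym HU C k -> asym HV C k ->
  {homo HU : x y / x <= y} -> (forall x, 0 <= HV x) ->
  (forall e m (x : nat -> R), 0 < e -> {homo x : i j / (i <= j)%N >-> i <= j} ->
     x 0%N = 0 -> x m = e ->
     \sum_(i < m) (HU (x i.+1) - HU (x i)) * HV (e - x i.+1) <= S e <=
     \sum_(i < m) (HU (x i.+1) - HU (x i)) * HV (e - x i)) ->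
  S 0 = 0 ->
  exists2 K, 0 < K & asym S K (2 * k).
Proof.
move=> C0 k0 aU aV HUm HV0 bd S0.
have oneX z : (1 : R) `^ z = 1 by rewrite powR1.
pose y m (i : nat) : R := (i%:R / m%:R) `^ k^-1.
have y0 m : y m 0%N = 0 by rewrite /y mul0r powR0// invr_eq0 gt_eqF.
have ym m : (0 < m)%N -> y m m = 1.
  by move=> m0; rewrite /y divff ?powR1// pnatr_eq0 -lt0n.
have yge0 m i : 0 <= y m i by exact: powR_ge0.
have yk m i : y m i `^ k = i%:R / m%:R.
  by rewrite /y -powRrM mulVf ?gt_eqF// powRr1// divr_ge0.
have ymono m : {homo y m : i j / (i <= j)%N >-> i <= j}.
  move=> i j ij; rewrite /y; apply: ge0_ler_powR; rewrite ?nnegrE ?divr_ge0//.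
    by rewrite invr_ge0 ltW.
  by rewrite ler_wpM2r ?invr_ge0// ler_nat.
have yle1 m i : (i <= m)%N -> (0 < m)%N -> y m i <= 1.
  by move=> im m0; rewrite -(ym m m0); exact: ymono.
pose ph m i : R := (1 - y m i) `^ k.
have ph01 m i : 0 <= ph m i by exact: powR_ge0.
pose Um m := C ^+ 2 / m%:R * \sum_(i < m) ph m i.
pose Lm m := C ^+ 2 / m%:R * \sum_(i < m) ph m i.+1.
have ULm m : (0 < m)%N -> Um m = Lm m + C ^+ 2 / m%:R.
  move=> m0; rewrite /Um /Lm -[X in _ + X]mulr1 -mulrDr; congr (_ * _).
  have pm : ph m m = 0 by rewrite /ph ym// subrr powR0// gt_eqF.
  have p0 : ph m 0%N = 1 by rewrite /ph y0 subr0 powR1.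
  have h1 := @big_ord_recr _ 0 +%R m (fun i => ph m i).
  have h2 := @big_ord_recl _ 0 +%R m (fun i => ph m i).
  by rewrite h1 /= pm addr0 p0 addrC in h2.
have ph1 m i : (i <= m)%N -> (0 < m)%N -> ph m i <= 1.
  move=> im m0; rewrite /ph -[leRHS](oneX k); apply: ge0_ler_powR; rewrite ?nnegrE ?(ltW k0)//.
    by rewrite subr_ge0 yle1.
  by rewrite gerBl.
have key m dl : (0 < m)%N -> 0 < dl -> exists2 e0, 0 < e0 & forall e, 0 < e < e0 ->
    (Lm m - dl) * e `^ (2 * k) <= S e <= (Um m + dl) * e `^ (2 * k).
  move=> m0 dl0; have mR : (1 : R) <= m%:R by rewrite ler1n.
  have mR0 : (0 : R) < m%:R by rewrite ltr0n.
  pose im : R := m%:R^-1; have im0 : 0 < im by rewrite invr_gt0.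
  have im1 : im <= 1 by rewrite invf_le1.
  (* The second bound keeps the lower estimates [C / m - 2 * e1] of the increments nonnegative. The
     third makes the cross terms of each summand, at most [e1 * (3 * C + 2)], smaller than
     [dl / m]. *)
  pose e1 := Num.min (Num.min 1 (C * im / 2)) (dl / (m%:R * (3 * C + 2))).
  have C3 : 0 < 3 * C + 2 by lra.
  have e10 : 0 < e1.
    by rewrite !lt_min ltr01 !divr_gt0// mulr_gt0.
  have e11 : e1 <= 1 by rewrite !ge_min lexx.
  have e12 : e1 <= C * im / 2 by rewrite !ge_min lexx orbT.
  have e13 : e1 * (3 * C + 2) <= dl * im.
    have : e1 <= dl / (m%:R * (3 * C + 2)) by rewrite !ge_min lexx !orbT.
    by rewrite -ler_pdivlMr// invfM mulrA.
  have [dU dU0 hU] := aU _ e10; have [dV dV0 hV] := aV _ e10.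
  exists (Num.min dU dV); first by rewrite lt_min dU0.
  move=> e /andP[e0]; rewrite lt_min => /andP[edU edV].
  pose E := e `^ k; have E0 : 0 < E by exact: powR_gt0.
  have EE : e `^ (2 * k) = E * E.
    by rewrite mulrDl mul1r powRD// (gt_eqF e0) implybT.
  pose x i := e * y m i.
  have xm : x m = e by rewrite /x ym// mulr1.
  have [||lo hi] := andP (bd e m x e0 _ _ xm).
  - by move=> i j ij; rewrite /x ler_wpM2l ?ymono// ltW.
  - by rewrite /x y0 mulr0.
  have HUx i : (i <= m)%N -> `|HU (x i) - C * (E * (i%:R * im))| <= e1 * E.
    move=> imn; have := hU (x i); rewrite /x mulr_ge0 ?(ltW e0)//=.
    rewrite (le_lt_trans _ edU) => [/(_ isT)|]; last by rewrite ler_piMr ?(ltW e0)// yle1.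
    rewrite powRM ?(ltW e0)// yk -/E -/im => /le_trans; apply.
    rewrite ler_wpM2l ?(ltW e10)// ler_piMr ?(ltW E0)//.
    by rewrite ler_pdivrMr// mul1r ler_nat.
  have HVx i : (i <= m)%N -> `|HV (e - x i) - C * (E * ph m i)| <= e1 * E.
    move=> imn; have exE : e - x i = e * (1 - y m i) by rewrite /x; ring.
    have y1 : 0 <= 1 - y m i by rewrite subr_ge0 yle1.
    have := hV (e - x i); rewrite exE mulr_ge0 ?(ltW e0)//=.
    rewrite (le_lt_trans _ edV) => [/(_ isT)|]; last by rewrite ler_piMr ?(ltW e0)// gerBl.
    rewrite powRM ?(ltW e0)// -/(ph m i) -/E => /le_trans; apply.
    by rewrite ler_wpM2l ?(ltW e10)// ler_piMr ?(ltW E0)// ph1.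
  have a0 i : 0 <= HU (x i.+1) - HU (x i).
    by rewrite subr_ge0 HUm// /x ler_wpM2l ?(ltW e0)// ymono.
  have aE i : (i < m)%N -> E * (C * im - 2 * e1) <= HU (x i.+1) - HU (x i) <= E * (C * im + 2 * e1).
    move=> ilt; have := HUx _ ilt; have := HUx _ (ltnW ilt).
    rewrite !ler_norml -natr1 => /andP[p1 p2] /andP[p3 p4]; apply/andP; split; lra.
  have bE i : (i <= m)%N -> E * (C * ph m i - e1) <= HV (e - x i) <= E * (C * ph m i + e1).
    by move=> /HVx; rewrite ler_norml => /andP[p1 p2]; apply/andP; split; lra.
  have sumc (c : R) (g : nat -> R) : \sum_(i < m) E * E * (C ^+ 2 * g i * im + c) =
      (C ^+ 2 / m%:R * \sum_(i < m) g i + m%:R * c) * (E * E).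
    rewrite -mulr_sumr big_split/= sumr_const card_ord -mulr_suml -mulr_sumr -/im mulr_natl; ring.
  have mim : m%:R * (dl * im) = dl by rewrite mulrCA /im mulfV ?mulr1// gt_eqF.
  rewrite EE; apply/andP; split.
    apply: le_trans lo; rewrite -[X in _ - X]mim -mulrN.
    rewrite -(sumc (- (dl * im)) (fun i => ph m i.+1)); apply: ler_sum => i _.
    have /andP[a1 _] := aE i (ltn_ord i); have /andP[b1 _] := bE i.+1 (ltn_ord i).
    have A0 : 0 <= C * im - 2 * e1 by lra.
    have := ph01 m i.+1; have := ph1 m i.+1 (ltn_ord i) m0; move: a1 b1.
    set p := ph m i.+1 => a1 b1 p1 p0.
    apply: (@le_trans _ _ (E * (C * im - 2 * e1) * (E * (C * p - e1)))).
      have -> : E * (C * im - 2 * e1) * (E * (C * p - e1)) = E * E * (C ^+ 2 * p * im +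
        (- (e1 * (C * im + 2 * (C * p) - 2 * e1)))) by ring.
      rewrite ler_wpM2l ?mulr_ge0 ?(ltW E0)// lerD2l lerN2; apply: le_trans e13.
      rewrite ler_wpM2l ?(ltW e10)//.
      have : C * im <= C by rewrite ler_piMr// ltW.
      have : C * p <= C by rewrite ler_piMr// ltW.
      lra.
    (* Near the end of the partition the lower estimate of the second factor may be negative; the
       product is then below 0, hence below the true nonnegative summand. *)
    have [s0|s0] := leP 0 (C * p - e1).
      by apply: ler_pM => //; rewrite mulr_ge0 ?(ltW E0).
    apply: (@le_trans _ _ 0); last by rewrite mulr_ge0.
    by rewrite mulr_ge0_le0 ?mulr_ge0 ?(ltW E0)// mulr_ge0_le0 ?(ltW E0)// ltW.
  apply: le_trans hi _; rewrite -[X in _ + X]mim.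
  rewrite -(sumc (dl * im) (fun i => ph m i)); apply: ler_sum => i _.
  have /andP[_ a1] := aE i (ltn_ord i); have /andP[_ b1] := bE i (ltnW (ltn_ord i)).
  have := ph01 m i; have := ph1 m i (ltnW (ltn_ord i)) m0; move: a1 b1.
  set p := ph m i => a1 b1 p1 p0.
  apply: (@le_trans _ _ (E * (C * im + 2 * e1) * (E * (C * p + e1)))); first exact: ler_pM.
  have -> : E * (C * im + 2 * e1) * (E * (C * p + e1)) = E * E * (C ^+ 2 * p * im +
    (e1 * (C * im + 2 * (C * p) + 2 * e1))) by ring.
  rewrite ler_wpM2l ?mulr_ge0 ?(ltW E0)// lerD2l; apply: le_trans e13.
  rewrite ler_wpM2l ?(ltW e10)//.
  have : C * im <= C by rewrite ler_piMr// ltW.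
  have : C * p <= C by rewrite ler_piMr// ltW.
  lra.
have LU m m' : (0 < m)%N -> (0 < m')%N -> Lm m <= Um m'.
  move=> m0 m'0; apply/ler_addgt0Pr => dl dl0.
  have d2 : 0 < dl / 2 by rewrite divr_gt0.
  have [e0 e00 h] := key m _ m0 d2; have [e0' e00' h'] := key m' _ m'0 d2.
  pose e := Num.min e0 e0' / 2.
  have mn : 0 < Num.min e0 e0' by rewrite lt_min e00.
  have e_gt0 : 0 < e by rewrite divr_gt0.
  have elt : e < Num.min e0 e0' by rewrite /e ltr_pdivrMr// ltr_pMr// ltr1n.
  have /h/andP[l1 _] : 0 < e < e0 by rewrite e_gt0 (lt_le_trans elt)// ge_min lexx.
  have /h'/andP[_ l2] : 0 < e < e0' by rewrite e_gt0 (lt_le_trans elt)// ge_min lexx orbT.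
  have := le_trans l1 l2; rewrite ler_pM2r ?powR_gt0//; lra.
pose K := sup [set Lm m | m in [set m | (0 < m)%N]].
have hs : has_sup [set Lm m | m in [set m | (0 < m)%N]].
  split; first by exists (Lm 1%N), 1%N.
  by exists (Um 1%N) => _ [m m0 <-]; exact: LU.
have LK m : (0 < m)%N -> Lm m <= K by move=> m0; apply: ub_le_sup; [case: hs|exists m].
have KU m : (0 < m)%N -> K <= Um m.
  by move=> m0; apply: ge_sup; [case: hs|move=> _ [m' m'0 <-]; exact: LU].
exists K.
  apply: lt_le_trans (LK 2%N isT); rewrite /Lm mulr_gt0 ?divr_gt0 ?exprn_gt0//.
  rewrite big_ord_recl/= ltr_pwDl ?sumr_ge0// /ph powR_gt0// subr_gt0.
  rewrite /y -[ltRHS](oneX k^-1) gt0_ltr_powR ?invr_gt0 ?nnegrE ?divr_ge0//.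
  by rewrite ltr_pdivrMr// mul1r ltr_nat.
move=> e e0.
have [m m0 Cm] : exists2 m, (0 < m)%N & C ^+ 2 / m%:R <= e / 2.
  have C2e : 0 <= 2 * C ^+ 2 / e by rewrite divr_ge0 ?mulr_ge0 ?sqr_ge0// ltW.
  have := archi_boundP C2e; set m := Num.bound _ => mC.
  have mR0 : 0 < m%:R :> R by apply: le_lt_trans mC.
  exists m; first by rewrite -(ltr_nat R).
  by move: mC; rewrite ltr_pdivrMr// => ?; rewrite ler_pdivrMr//; lra.
have e2 : 0 < e / 2 by rewrite divr_gt0.
have [e0' e0'0 h] := key m _ m0 e2.
exists e0' => // x /andP[]; rewrite le_eqVlt => /predU1P[<- _|x0 xe].
  by rewrite S0 powR0 ?mulr0 ?subrr ?normr0// gt_eqF// mulr_gt0.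
have xk : 0 < x `^ (2 * k) by exact: powR_gt0.
have /andP[h1 h2] : (Lm m - e / 2) * x `^ (2 * k) <= S x <= (Um m + e / 2) * x `^ (2 * k).
  by apply: h; rewrite x0.
have := LK m m0; have := KU m m0; rewrite ULm// => KL LK'.
have b1 : (K - e) * x `^ (2 * k) <= (Lm m - e / 2) * x `^ (2 * k).
  by rewrite ler_pM2r//; lra.
have b2 : (Um m + e / 2) * x `^ (2 * k) <= (K + e) * x `^ (2 * k).
  by rewrite ler_pM2r// ULm//; lra.
by rewrite ler_norml; apply/andP; split; lra.
Qed.

End Asymptotics.

(** * Tails of a law whose density has a power behaviour at the edge *)

Section DensityTail.
Context (R : realType).
Local Notation mu := (@lebesgue_measure R).

Lemma integral_power (c k w a b : R) : 0 < k -> a < b -> b < c ->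
  (\int[mu]_(x in `[a, b]) (w * (c - x) `^ (k - 1))%:E =
   (w / k * ((c - a) `^ k - (c - b) `^ k))%:E)%E.
Proof.
move=> k0 ab bc.
pose G (x : R) := - (w / k) * (c - x) `^ k.
have dG x : x < c -> is_derive x 1 G (w * (c - x) `^ (k - 1)).
  move=> xc; have cx : 0 < c - x by rewrite subr_gt0.
  have d1 : is_derive x 1 (fun y : R => c - y) (- 1).
    by apply: is_derive_eq; rewrite add0r mul1r.
  have d2 := is_derive1_powR k cx.
  have d3 := @is_derive1_comp _ (fun y : R => y `^ k) (fun y => c - y) x _ _ d2 d1.
  have d4 := is_deriveZ (- (w / k)) d3.
  apply: is_derive_eq d4 _.
  rewrite /GRing.scale /=; field; exact: lt0r_neq0.
have cpow x : x < c -> {for x, continuous (fun y : R => w * (c - y) `^ (k - 1))}.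
  move=> xc; have cx : 0 < c - x by rewrite subr_gt0.
  have d1 : is_derive x 1 (fun y : R => c - y) (- 1).
    by apply: is_derive_eq; rewrite add0r mul1r.
  have d2 := is_derive1_powR (k - 1) cx.
  have [d3 _] := is_deriveZ w (@is_derive1_comp _ (fun y : R => y `^ (k - 1)) (fun y => c - y) x _ _ d2 d1).
  by move/derivable1_diffP/differentiable_continuous: d3.
have cG x : x < c -> {for x, continuous G}.
  by move=> /dG[+ _] => /derivable1_diffP/differentiable_continuous.
rewrite (@continuous_FTC2 _ _ G)//.
- by rewrite -EFinB /G; congr EFin; ring.
- apply: continuous_in_subspaceT => x /[!inE]/= /[!in_itv]/= /andP[_ xb].
  exact/cpow/(le_lt_trans xb).
- split.
  + move=> x; rewrite in_itv/= => /andP[_ xb].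
    by have [] := dG x (lt_trans xb bc).
  + by apply: cvg_at_right_filter; apply: cG; apply: lt_trans bc.
  + by apply: cvg_at_left_filter; apply: cG.
- move=> x; rewrite in_itv/= => /andP[_ xb].
  by rewrite derive1E; have [_] := dG x (lt_trans xb bc).
Qed.

Context d (T : measurableType d) (P : probability T R) (c q k : R) (rho : R -> R) (X : T -> R).
Context (c0 : 0 < c) (q0 : 0 < q) (k0 : 0 < k) (mrho : measurable_fun setT rho)
  (rho_even : forall x, rho (- x) = rho x)
  (rho_cont : forall x, - c < x < c -> {for x, continuous rho})
  (rho_pos : forall x, - c < x < c -> 0 < rho x)
  (rho_out : forall x, ~ (- c < x < c) -> rho x = 0)
  (rho_lim : (fun x => rho x / (c - x) `^ (k - 1)) @ c^'- --> q)
  (mX : measurable_fun setT X)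
  (X_law : forall A, measurable A -> P (X @^-1` A) = (\int[mu]_(y in A) (rho y)%:E)%E).

Lemma measurable_law A : measurable A -> measurable (X @^-1` A).
Proof. by move=> mA; rewrite -[X in measurable X]setTI; exact: mX. Qed.

Lemma rho_ge0 x : 0 <= rho x.
Proof.
have [xc|xc] := boolP (- c < x < c); first exact/ltW/rho_pos.
by rewrite rho_out//; exact/negP.
Qed.

(** The density is compared with multiples of [(c - x)^(k - 1)] and these are integrated exactly.
    The interval stops before [c], since for [k < 1] the density is unbounded there and the
    fundamental theorem of calculus does not apply up to the endpoint. *)
Lemma law_interval_near e : 0 < e -> exists2 dl, 0 < dl & forall a b, c - dl < a -> a < b -> b < c ->
  (q - e) / k * ((c - a) `^ k - (c - b) `^ k) <= pr P (X @^-1` `[a, b]) <=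
  (q + e) / k * ((c - a) `^ k - (c - b) `^ k).
Proof.
move=> e0; move/cvgrPdist_le : rho_lim => /(_ e e0) [dl /= dl0 H].
pose dl' := Num.min dl c; exists dl'; first by rewrite lt_min dl0.
move=> a b ca ab bc.
have near x : a <= x <= b -> (q - e) * (c - x) `^ (k - 1) <= rho x <= (q + e) * (c - x) `^ (k - 1).
  move=> /andP[ax xb]; have xc : x < c by exact: le_lt_trans bc.
  have cx : 0 < c - x by rewrite subr_gt0.
  have := H x; rewrite /ball_ /= => /(_ _ xc).
  have -> : `|c - x| < dl.
    rewrite gtr0_norm//; have : dl' <= dl by rewrite ge_min lexx.
    lra.
  move=> /(_ isT); rewrite ler_norml => /andP[h1 h2].
  have p0 : 0 < (c - x) `^ (k - 1) by exact: powR_gt0.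
  by apply/andP; split; [rewrite -ler_pdivlMr//; lra|rewrite -ler_pdivrMr//; lra].
have mpow w : measurable_fun `[a, b] (fun x : R => (w * (c - x) `^ (k - 1))%:E).
  apply/measurable_EFinP/measurable_funTS/measurable_funM; first exact: measurable_cst.
  by apply: (measurableT_comp (measurable_powR _)); exact: measurable_funB.
have mr : measurable_fun `[a, b] (fun x : R => (rho x)%:E).
  exact/measurable_EFinP/measurable_funTS.
have mXab : measurable (X @^-1` `[a, b]) by exact: measurable_law.
have prE : (pr P (X @^-1` `[a, b]))%:E = (\int[mu]_(y in `[a, b]) (rho y)%:E)%E.
  by rewrite probability_fine// X_law.
have D0 : 0 <= (c - a) `^ k - (c - b) `^ k.
  rewrite subr_ge0 ge0_ler_powR ?nnegrE ?(ltW k0)//; lra.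
apply/andP; split.
  have [qe|qe] := leP e q; last first.
    by apply: le_trans (pr_ge0 _ _); rewrite mulr_le0_ge0// ler_pdivrMr// mul0r subr_le0 ltW.
  rewrite -lee_fin prE -integral_power//; apply: ge0_le_integral => //.
  - by move=> x _; rewrite lee_fin mulr_ge0 ?powR_ge0// subr_ge0.
  - exact: mpow.
  - by move=> x /=; rewrite in_itv/= => xab; rewrite lee_fin; case/andP: (near x xab).
rewrite -lee_fin prE -integral_power//; apply: ge0_le_integral => //.
- by move=> x _; rewrite lee_fin rho_ge0.
- exact: mpow.
- by move=> x /=; rewrite in_itv/= => xab; rewrite lee_fin; case/andP: (near x xab).
Qed.

Lemma law_point x : P (X @^-1` [set x]) = 0%E.
Proof. by rewrite X_law// integral_set1. Qed.

Lemma law_reflect a b : - c < a -> a < b -> b < c ->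
  P (X @^-1` `[- b, - a]) = P (X @^-1` `[a, b]).
Proof.
move=> ca ab bc; rewrite !X_law//.
rewrite integration_by_substitution_oppr ?(ltW ab)//; first by apply: eq_integral => x _; rewrite /= rho_even.
apply: continuous_in_subspaceT => x /[!inE]/= /[!in_itv]/= /andP[h1 h2].
by apply: rho_cont; apply/andP; split; lra.
Qed.

Lemma law_outside : P (X @^-1` (~` `]- c, c[)) = 0%E.
Proof.
rewrite X_law; last exact: measurableC.
rewrite (eq_integral (fun=> 0%E)) ?integral0// => x /[!inE]/= /[!in_itv]/= h.
by rewrite rho_out.
Qed.

Lemma law_eq_null A B N : measurable A -> measurable B -> measurable N ->
  P (X @^-1` N) = 0%E -> A `<=` B `|` N -> B `<=` A `|` N ->
  pr P (X @^-1` A) = pr P (X @^-1` B).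
Proof.
move=> mA mB mN N0 AB BA.
have le A' B' : measurable A' -> measurable B' -> A' `<=` B' `|` N ->
    pr P (X @^-1` A') <= pr P (X @^-1` B').
  move=> mA' mB' AB'.
  have m1 := measurable_law mA'; have m2 := measurable_law mB'; have m3 := measurable_law mN.
  apply: le_trans (pr_le P m1 (measurableU _ _ m2 m3) _) _; first by move=> w /AB'.
  by apply: le_trans (prU _ m2 m3) _; rewrite {2}/pr N0 addr0.
by apply/eqP; rewrite eq_le !le.
Qed.

(** Cut points increasing to [c]; the offset 2 keeps all of them strictly above [c - s]. *)
Definition tail_cut s n : R := c - s / n.+2%:R.

Lemma tail_cut_itv s n : 0 < s -> c - s < tail_cut s n < c.
Proof.
move=> s0; rewrite /tail_cut ltrD2l ltrN2 gtrBl divr_gt0// andbT.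
by rewrite ltr_pdivrMr// ltr_pMr// ltr1n.
Qed.

Lemma tail_cut_cvg s : 0 < s < c ->
  ((fun n => pr P (X @^-1` `[c - s, tail_cut s n])) @ \oo --> pr P (X @^-1` `[c - s, c[)) /\
  ((fun n => pr P (X @^-1` `[- tail_cut s n, - (c - s)])) @ \oo -->
     pr P (X @^-1` `]- c, - (c - s)])).
Proof.
move=> /andP[s0 sc].
have bc n := @tail_cut_itv s n s0.
have b_le m n : (m <= n)%N -> tail_cut s m <= tail_cut s n.
  by move=> mn; rewrite lerD2l lerN2 ler_wpM2l ?(ltW s0)// ler_pV2 ?inE ?unitfE ?ltr0n ?pnatr_eq0// ler_nat ltnS.
have ex x : x < c -> exists n, x <= tail_cut s n.
  move=> xc; have cx : 0 < c - x by rewrite subr_gt0.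
  have sx : 0 <= s / (c - x) by rewrite divr_ge0 ?(ltW s0) ?(ltW cx).
  have := archi_boundP sx; set m := Num.bound _ => mC.
  exists m; rewrite lerBrDr -lerBrDl ler_pdivrMr//.
  move: mC; rewrite ltr_pdivrMr// => /ltW/le_trans; apply.
  by rewrite mulrC ler_wpM2l ?(ltW cx)// ler_nat; lia.
have cv (A : nat -> set R) B : (forall n, measurable (A n)) -> measurable B ->
    nondecreasing_seq A -> \bigcup_n A n = B ->
    (fun n => pr P (X @^-1` A n)) @ \oo --> pr P (X @^-1` B).
  move=> mA mB ndA UA; have mXB := measurable_law mB.
  apply: fine_cvg; rewrite fineK ?fin_num_measure//.
  have -> : X @^-1` B = \bigcup_n (X @^-1` A n) by rewrite -UA preimage_bigcup.
  apply: (@nondecreasing_cvg_mu _ _ _ P (fun n => X @^-1` A n)).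
  - by move=> n; exact: measurable_law.
  - by rewrite -preimage_bigcup UA.
  - by move=> m n /ndA/subsetPset mn; apply/subsetPset => w; exact: mn.
split; apply: cv => //.
- move=> m n mn; apply/subsetPset => w; rewrite /= !in_itv/= => /andP[-> h]/=.
  exact: le_trans (b_le _ _ mn).
- apply/seteqP; split=> x /=; rewrite in_itv/=.
    by move=> [n _]; rewrite /= in_itv/= => /andP[-> h] /=; case/andP: (bc n) => _; exact: le_lt_trans.
  by move=> /andP[h1 /ex[n h2]]; exists n => //; rewrite /= in_itv/= h1.
- move=> m n mn; apply/subsetPset => w; rewrite /= !in_itv/= => /andP[h ->]; rewrite andbT.
  by apply: le_trans h; rewrite lerN2 b_le.
- apply/seteqP; split=> x /=; rewrite in_itv/=.
    move=> [n _]; rewrite /= in_itv/= => /andP[h ->]; rewrite andbT.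
    by apply: lt_le_trans h; rewrite ltrN2; case/andP: (bc n).
  rewrite ltrNl => /andP[/ex[n h2] h1]; exists n => //; rewrite /= in_itv/= h1 andbT.
  by rewrite lerNl.
Qed.

Lemma law_tails_near s e : 0 < s < c -> 0 < e ->
  exists b, [/\ c - s < b < c, (c - b) `^ k <= e,
    `|pr P (X @^-1` `]c - s, +oo[) - pr P (X @^-1` `[c - s, b])| <= e &
    `|pr P (X @^-1` `]-oo, - (c - s)[) - pr P (X @^-1` `[c - s, b])| <= e].
Proof.
move=> sc e0; have /andP[s0 sc'] := sc; have [cv1 cv2] := tail_cut_cvg sc.
have mout : measurable (~` `]- c, c[ : set R) by exact: measurableC.
have mnull y : measurable ([set y] `|` ~` `]- c, c[ : set R) by apply: measurableU.
have null y : P (X @^-1` ([set y] `|` ~` `]- c, c[)) = 0%E.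
  have m1 : measurable (X @^-1` [set y]) by exact: measurable_law.
  have m2 : measurable (X @^-1` (~` `]- c, c[)) by exact: measurable_law.
  apply/eqP; rewrite eq_le measure_ge0 andbT preimage_setU.
  have := @measureU2 _ _ _ P _ _ m1 m2; rewrite [X in (_ <= X + _)%E -> _]law_point.
  by rewrite [X in (_ <= _ + X)%E -> _]law_outside add0e.
have E1 : pr P (X @^-1` `]c - s, +oo[) = pr P (X @^-1` `[c - s, c[).
  apply: (@law_eq_null _ _ ([set c - s] `|` ~` `]- c, c[)) => //.
    move=> x /=; rewrite !in_itv/= andbT => sx; have [xc|xc] := ltP x c.
      by left; rewrite (ltW sx).
    by right; right => /andP[].
  move=> x /=; rewrite !in_itv/= andbT => /andP[]; rewrite le_eqVlt => /predU1P[<-|-> _]; last by left.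
  by right; left.
have E2 : pr P (X @^-1` `]-oo, - (c - s)[) = pr P (X @^-1` `]- c, - (c - s)]).
  apply: (@law_eq_null _ _ ([set - (c - s)] `|` ~` `]- c, c[)) => //.
    move=> x /=; rewrite !in_itv/= => sx; have [xc|xc] := ltP (- c) x.
      by left; rewrite (ltW sx).
    by right; right => /andP[].
  move=> x /=; rewrite !in_itv/= => /andP[_]; rewrite le_eqVlt => /predU1P[->|->]; last by left.
  by right; left.
rewrite E1 E2.
move/cvgrPdist_le: cv1 => /(_ e e0) [n1 _ h1].
move/cvgrPdist_le: cv2 => /(_ e e0) [n2 _ h2].
have se : 0 <= s / (e `^ k^-1) by rewrite divr_ge0 ?powR_ge0 ?(ltW s0).
have := archi_boundP se; set m := Num.bound _ => mC.
pose n := maxn m (maxn n1 n2).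
exists (tail_cut s n); split.
- exact: tail_cut_itv.
- rewrite /tail_cut opprB addrC subrK.
  have -> : e = (e `^ k^-1) `^ k by rewrite -powRrM mulVf ?gt_eqF// powRr1// ltW.
  apply: ge0_ler_powR; rewrite ?nnegrE ?powR_ge0 ?(ltW k0) ?divr_ge0 ?(ltW s0)//.
  rewrite ler_pdivrMr//; move: mC; rewrite ltr_pdivrMr ?powR_gt0// => /ltW/le_trans; apply.
  by rewrite mulrC ler_wpM2l ?powR_ge0// ler_nat; lia.
- by apply: h1; rewrite /= /n !leq_max leqnn orbT.
- have /andP[t1 t2] := @tail_cut_itv s n s0.
  have -> : pr P (X @^-1` `[c - s, tail_cut s n]) = pr P (X @^-1` `[- tail_cut s n, - (c - s)]).
    by rewrite /pr law_reflect//; lra.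
  by apply: h2; rewrite /= /n !leq_max leqnn !orbT.
Qed.

(** Both tails are within any [eta] of the probability of the same interval [[c - s, b]], the left
    one through the symmetry of the density. The estimate [main] is therefore stated for an
    arbitrary number [p] with this property and used twice. *)
Lemma tails_asym : asym (fun s => pr P (X @^-1` `]c - s, +oo[)) (q / k) k /\
  asym (fun s => pr P (X @^-1` `]-oo, - (c - s)[)) (q / k) k.
Proof.
have main e : 0 < e -> exists2 dl, 0 < dl & forall s, 0 < s < dl ->
  forall p, (forall eta, 0 < eta -> exists b, [/\ c - s < b < c, (c - b) `^ k <= eta &
     `|p - pr P (X @^-1` `[c - s, b])| <= eta]) -> `|p - q / k * s `^ k| <= e * s `^ k.
  move=> e0; pose e1 := Num.min q (e * k / 2).
  have e10 : 0 < e1 by rewrite lt_min q0 divr_gt0// mulr_gt0.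
  have e1q : e1 <= q by rewrite ge_min lexx.
  have e1e : e1 / k <= e / 2 by rewrite ler_pdivrMr// mulrAC ge_min lexx orbT.
  have [dl dl0 H] := law_interval_near e10.
  exists dl => // s /andP[s0 sdl] p Hp.
  have sk0 : 0 < s `^ k by exact: powR_gt0.
  have qk : 0 < q / k by rewrite divr_gt0.
  pose eta := e / 2 * s `^ k / (1 + q / k).
  have eta0 : 0 < eta by rewrite /eta divr_gt0 ?mulr_gt0 ?addr_gt0 ?divr_gt0.
  have etaE : eta + q / k * eta = e / 2 * s `^ k.
    rewrite -{1}(mul1r eta) -mulrDl mulrC divfK// gt_eqF// addr_gt0//.
  clearbody eta; have [b [/andP[b1 b2] b3 b4]] := Hp _ eta0.
  have /andP[l1 l2] : (q - e1) / k * ((c - (c - s)) `^ k - (c - b) `^ k) <=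
      pr P (X @^-1` `[c - s, b]) <= (q + e1) / k * ((c - (c - s)) `^ k - (c - b) `^ k).
    by apply: H => //; lra.
  have cs : c - (c - s) = s by ring.
  move: l1 l2; rewrite cs; set r := (c - b) `^ k in b3 * => l1 l2.
  have r0 : 0 <= r by exact: powR_ge0.
  have u1 : (q + e1) / k * (s `^ k - r) <= (q / k + e / 2) * s `^ k.
    apply: (@le_trans _ _ ((q + e1) / k * s `^ k)).
      by rewrite ler_wpM2l ?gerBl// divr_ge0 ?addr_ge0 ?(ltW q0) ?(ltW e10) ?(ltW k0).
    by rewrite ler_pM2r// mulrDl lerD2l.
  have u2 : (q / k - e / 2) * s `^ k - q / k * eta <= (q - e1) / k * (s `^ k - r).
    have a1 : (q / k - e / 2) * s `^ k <= (q - e1) / k * s `^ k.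
      by rewrite ler_pM2r// mulrBl lerB.
    have a2 : (q - e1) / k * r <= q / k * eta.
      apply: ler_pM => //; first by rewrite divr_ge0 ?subr_ge0 ?(ltW k0).
      by rewrite ler_pM2r ?invr_gt0// gerBl ltW.
    by rewrite mulrBr; lra.
  move: b4; rewrite !ler_norml => /andP[b5 b6].
  have qe0 : 0 <= q / k * eta by rewrite mulr_ge0 ?ltW.
  apply/andP; split; lra.
have z0 e (p : R) : p = 0 -> `|p - q / k * 0 `^ k| <= e * 0 `^ k.
  by move=> ->; rewrite powR0 ?gt_eqF// !mulr0 subrr normr0.
have P0 A : measurable A -> A `<=` ~` `]- c, c[ -> pr P (X @^-1` A) = 0.
  move=> mA AO; apply/le_anti/andP; split; last exact: pr_ge0.
  have -> : 0 = pr P (X @^-1` (~` `]- c, c[)) by rewrite /pr law_outside.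
  apply: pr_le; [exact: measurable_law|by apply: measurable_law; exact: measurableC|].
  by move=> w; exact: AO.
split=> e e0; have [dl dl0 H] := main e e0; exists (Num.min dl c); rewrite ?lt_min ?dl0//;
  move=> s /andP[]; rewrite le_eqVlt => /predU1P[<- _|s0].
- apply: z0; rewrite subr0; apply: P0 => // x /=; rewrite !in_itv/= andbT => cx /andP[_].
  by rewrite ltNge (ltW cx).
- rewrite lt_min => /andP[sdl sc]; apply: H; first by rewrite s0.
  move=> eta eta0; have [||b [b1 b2 b3 b4]] := @law_tails_near s eta => //; first by rewrite s0.
  by exists b.
- apply: z0; rewrite subr0; apply: P0 => // x /=; rewrite !in_itv/= => cx /andP[].
  by rewrite ltNge (ltW cx).
- rewrite lt_min => /andP[sdl sc]; apply: H; first by rewrite s0.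
  move=> eta eta0; have [||b [b1 b2 b3 b4]] := @law_tails_near s eta => //; first by rewrite s0.
  by exists b.
Qed.

End DensityTail.

(** * Tail at 0 of a sum of two independent variables, and of the discrepancy *)

Section ConvolutionTail.
Context (R : realType) d (T : measurableType d) (P : probability T R).
Local Notation pr := (pr P).

Lemma pr_disjointU A B : measurable A -> measurable B -> [disjoint A & B]%classic ->
  pr (A `|` B) = pr A + pr B.
Proof.
move=> mA mB /disj_set2P AB; rewrite /pr measureU// fineD// fin_num_measure//.
Qed.

Lemma pr_lt_measurable (U : T -> R) a : measurable_fun setT U -> measurable [set w | U w < a].
Proof.
move=> mU; have -> : [set w | U w < a] = setT `&` U @^-1` `]-oo, a[.
  by rewrite setTI; apply/seteqP; split=> w /=; rewrite in_itv.
exact: mU.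
Qed.

(** Slicing [U + V < e] according to the cell of the partition that contains [U] and replacing [U]
    by the ends of the cell gives the two sums required by the convolution lemma. Negative values
    have probability 0 and are discarded. *)
Lemma sum_asym (U V : T -> R) C k : 0 < C -> 0 < k ->
  measurable_fun setT U -> measurable_fun setT V ->
  (forall A B, measurable A -> measurable B ->
     pr (U @^-1` A `&` V @^-1` B) = pr (U @^-1` A) * pr (V @^-1` B)) ->
  pr [set w | U w < 0] = 0 -> pr [set w | V w < 0] = 0 ->
  asym (fun s => pr [set w | U w < s]) C k ->
  asym (fun s => pr [set w | V w < s]) C k ->
  exists2 K, 0 < K & asym (fun e => pr [set w | U w + V w < e]) K (2 * k).
Proof.
move=> C0 k0 mU mV indep U0 V0 aU aV.
have ltU a : [set w | U w < a] = U @^-1` `]-oo, a[ by apply/seteqP; split=> w /=; rewrite in_itv.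
have ltV a : [set w | V w < a] = V @^-1` `]-oo, a[ by apply/seteqP; split=> w /=; rewrite in_itv.
have mlt := pr_lt_measurable.
have mUV : measurable_fun setT (fun w => U w + V w) by exact: measurable_funD.
have piece a b t : a <= b ->
    pr ([set w | a <= U w < b] `&` [set w | V w < t]) =
    (pr [set w | U w < b] - pr [set w | U w < a]) * pr [set w | V w < t].
  move=> ab.
  have mab : measurable [set w | a <= U w < b].
    rewrite [X in measurable X](_ : _ = setT `&` U @^-1` `[a, b[).
      exact: mU.
    by rewrite setTI; apply/seteqP; split=> w /=; rewrite in_itv.
  have -> : pr [set w | U w < b] = pr [set w | U w < a] + pr [set w | a <= U w < b].
    rewrite -pr_disjointU//.
      congr pr; apply/seteqP; split=> w /=.
        by move=> wb; have [aw|wa] := leP a (U w); [right|left].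
      by case=> [wa|/andP[]//]; exact: lt_le_trans ab.
      exact: mlt.
    by apply/disj_set2P/seteqP; split=> w // -[/= wa /andP[]]; rewrite leNgt wa.
  rewrite [X in (X - _) * _]addrC addrK [in RHS]ltV [X in X `&` _](_ : _ = U @^-1` `[a, b[).
    by rewrite ltV indep//; congr (pr _ * _); apply/seteqP; split=> w /=; rewrite in_itv.
  by apply/seteqP; split=> w /=; rewrite in_itv.
have sub0 A B : measurable A -> measurable B -> A `<=` B -> pr B = 0 -> pr A = 0.
  by move=> mA mB AB B0; apply/le_anti; rewrite pr_ge0 -B0 pr_le.
have nullD A N : measurable A -> measurable N -> pr N = 0 -> pr (A `|` N) <= pr A.
  by move=> mA mN N0; apply: le_trans (prU P mA mN) _; rewrite N0 addr0.
apply: (@asym_convolution R (fun s => pr [set w | U w < s]) (fun s => pr [set w | V w < s]) _ C k) => //.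
- move=> x y xy; apply: pr_le; [exact: mlt|exact: mlt|] => w /= wx; exact: lt_le_trans xy.
- by move=> x; exact: pr_ge0.
- move=> e m x e0 xm x0 xe.
  pose S := [set w | U w + V w < e].
  have mS : measurable S by exact: mlt.
  have mSx y : measurable (S `&` [set w | U w < y]) by apply: measurableI => //; exact: mlt.
  have step j : \sum_(i < j) (pr [set w | U w < x i.+1] - pr [set w | U w < x i]) * pr [set w | V w < e - x i.+1]
      <= pr (S `&` [set w | U w < x j]) <=
     \sum_(i < j) (pr [set w | U w < x i.+1] - pr [set w | U w < x i]) * pr [set w | V w < e - x i].
    elim: j => [|j /andP[IH1 IH2]].
      rewrite !big_ord0 x0 (sub0 _ [set w | U w < 0])// ?lexx//; exact: mlt.
    have xj : x j <= x j.+1 by exact: xm.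
    have mp t : measurable ([set w | x j <= U w < x j.+1] `&` [set w | V w < t]).
      apply: measurableI; last exact: mlt.
      rewrite [X in measurable X](_ : _ = setT `&` U @^-1` `[x j, x j.+1[).
        exact: mU.
      by rewrite setTI; apply/seteqP; split=> w /=; rewrite in_itv.
    rewrite !big_ord_recr/= -!piece//; apply/andP; split.
      apply: le_trans (lerD IH1 (lexx _)) _; rewrite -pr_disjointU//.
        apply: pr_le => //; first exact: measurableU.
        move=> w [[/= Sw wx]|[/= /andP[xw wx] Vw]].
          by split=> //=; exact: lt_le_trans xj.
        by split=> //=; rewrite /S /=; lra.
      by apply/disj_set2P/seteqP; split=> w // -[[/= _ wx] [/andP[]]]; rewrite leNgt wx.
    apply: le_trans (lerD IH2 (lexx _)); apply: le_trans (prU _ _ _) => //.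
    apply: pr_le => //; first exact: measurableU.
    move=> w [Sw /= wx]; have [xw|xw] := leP (x j) (U w); last by left.
    by right; split=> /=; [rewrite ?xw ?wx|move: Sw; rewrite /S /=; lra].
  have /andP[l1 l2] := step m; apply/andP; split.
    by apply: le_trans l1 _; apply: pr_le => // w [].
  apply: le_trans l2; rewrite xe.
  apply: le_trans (nullD _ _ (mSx e) (mlt _ _ mV) V0).
  apply: pr_le => //; first by apply: measurableU => //; exact: mlt.
  move=> w Sw; have [we|ew] := ltP (U w) e; first by left.
  by right; move: Sw; rewrite /S /=; lra.
- apply: (sub0 _ ([set w | U w < 0] `|` [set w | V w < 0])).
  + exact: mlt.
  + by apply: measurableU; exact: mlt.
  + move=> w /= UV; have [wU|wU] := ltP (U w) 0; [by left|right => /=; lra].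
  + apply/le_anti; rewrite pr_ge0 andbT; apply: le_trans (nullD _ _ _ _ V0) _; [exact: mlt|exact: mlt|].
    by rewrite U0.
Qed.

(** The discrepancy is the smaller of [(c - X) + (c + Y)] and [(c + X) + (c - Y)], each a sum of
    independent distances to the edge of the support. The two sums total [4 * c], so for levels
    below [c] the two events are disjoint and their probabilities add. *)
Lemma disc_asym (X Y : T -> R) c C k : 0 < c -> 0 < C -> 0 < k ->
  measurable_fun setT X -> measurable_fun setT Y ->
  (forall A B, measurable A -> measurable B ->
     pr (X @^-1` A `&` Y @^-1` B) = pr (X @^-1` A) * pr (Y @^-1` B)) ->
  (forall Z, Z = X \/ Z = Y ->
    asym (fun s => pr (Z @^-1` `]c - s, +oo[)) C k /\
    asym (fun s => pr (Z @^-1` `]-oo, - (c - s)[)) C k) ->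
  exists2 K, 0 < K & asym (fun e => pr [set w | 2 * c - `|Y w - X w| < e]) K (2 * k).
Proof.
move=> c0 C0 k0 mX mY indep tails.
have mlt := pr_lt_measurable.
have [aX1 aX2] := tails X (or_introl erefl); have [aY1 aY2] := tails Y (or_intror erefl).
have E1 (Z : T -> R) s : [set w | c - Z w < s] = Z @^-1` `]c - s, +oo[.
  by apply/seteqP; split=> w /=; rewrite in_itv/= andbT; lra.
have E2 (Z : T -> R) s : [set w | c + Z w < s] = Z @^-1` `]-oo, - (c - s)[.
  by apply/seteqP; split=> w /=; rewrite in_itv/=; lra.
have zero (H : R -> R) : asym H C k -> H 0 = 0.
  move=> /(_ 1 ltr01)[dl dl0 /(_ 0)]; rewrite lexx dl0 => /(_ isT).
  by rewrite powR0 ?gt_eqF// !mulr0 subr0 normr_le0 => /eqP.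
have ind1 : forall A B : set R, measurable A -> measurable B ->
     pr ((fun w => c - X w) @^-1` A `&` (fun w => c + Y w) @^-1` B) =
     pr ((fun w => c - X w) @^-1` A) * pr ((fun w => c + Y w) @^-1` B).
  move=> A B mA mB; apply: (indep ((fun x => c - x) @^-1` A) ((fun x => c + x) @^-1` B)).
    by rewrite -[X in measurable X]setTI; exact: (@measurable_funB _ _ _ setT (cst c) id).
  by rewrite -[X in measurable X]setTI; exact: (@measurable_funD _ _ _ setT (cst c) id).
have ind2 : forall A B : set R, measurable A -> measurable B ->
     pr ((fun w => c + X w) @^-1` A `&` (fun w => c - Y w) @^-1` B) =
     pr ((fun w => c + X w) @^-1` A) * pr ((fun w => c - Y w) @^-1` B).
  move=> A B mA mB; apply: (indep ((fun x => c + x) @^-1` A) ((fun x => c - x) @^-1` B)).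
    by rewrite -[X in measurable X]setTI; exact: (@measurable_funD _ _ _ setT (cst c) id).
  by rewrite -[X in measurable X]setTI; exact: (@measurable_funB _ _ _ setT (cst c) id).
have mp (Z : T -> R) : measurable_fun setT Z -> measurable_fun setT (fun w => c + Z w).
  by move=> mZ; exact: measurable_funD.
have mm (Z : T -> R) : measurable_fun setT Z -> measurable_fun setT (fun w => c - Z w).
  by move=> mZ; exact: measurable_funB.
have eqf (H H' : R -> R) : H =1 H' -> asym H C k -> asym H' C k by move=> /funext ->.
have [||||K1 K10 aK1] := @sum_asym (fun w => c - X w) (fun w => c + Y w) C k C0 k0 (mm _ mX) (mp _ mY) ind1.
- by rewrite E1; exact: (zero (fun s => pr (X @^-1` `]c - s, +oo[))).
- by rewrite E2; exact: (zero (fun s => pr (Y @^-1` `]-oo, - (c - s)[))).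
- by apply: eqf aX1 => s; rewrite E1.
- by apply: eqf aY2 => s; rewrite E2.
have [||||K2 K20 aK2] := @sum_asym (fun w => c + X w) (fun w => c - Y w) C k C0 k0 (mp _ mX) (mm _ mY) ind2.
- by rewrite E2; exact: (zero (fun s => pr (X @^-1` `]-oo, - (c - s)[))).
- by rewrite E1; exact: (zero (fun s => pr (Y @^-1` `]c - s, +oo[))).
- by apply: eqf aX2 => s; rewrite E2.
- by apply: eqf aY1 => s; rewrite E1.
exists (K1 + K2); first exact: addr_gt0.
move=> e e0; have [dl dl0 H] := asymD aK1 aK2 e0.
exists (Num.min dl c); first by rewrite lt_min dl0.
move=> x /andP[x0]; rewrite lt_min => /andP[xd xc].
have := H x; rewrite x0 xd => /(_ isT); rewrite -pr_disjointU.
- rewrite [X in pr X](_ : _ = [set w | 2 * c - `|Y w - X w| < x])//.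
  apply/seteqP; split=> w /=.
    have := ler_norm (Y w - X w); have := ler_norm (- (Y w - X w)); rewrite normrN => ? ? [|]; lra.
  have [h|h] := ger0P (Y w - X w); first by right; lra.
  by left; lra.
- by apply: mlt; apply: measurable_funD; [exact: mm|exact: mp].
- by apply: mlt; apply: measurable_funD; [exact: mp|exact: mm].
- by apply/disj_set2P/seteqP; split=> w // -[/= h1 h2]; lra.
Qed.

End ConvolutionTail.

(** * Poisson approximation *)

Definition none_before (T : Type) (A : nat -> set T) l :=
  \bigcap_(j in [set j | (j < l)%N]) ~` A j.

Section PowerSums.
Context (R : realType).
Implicit Types a b x p : R.

Lemma powR_increment a b p : 0 < p -> 0 <= b <= a ->
  (p + 1) * b `^ p * (a - b) <= a `^ (p + 1) - b `^ (p + 1) <= (p + 1) * a `^ p * (a - b).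
Proof.
move=> p0 /andP[]; rewrite le_eqVlt => /predU1P[<- a0|b0].
  have p1 : p + 1 != 0 by rewrite gt_eqF// addr_gt0.
  have p00 : p != 0 by rewrite gt_eqF.
  rewrite (powR0 p00) (powR0 p1) !subr0 mulr0 mul0r powR_ge0/= -mulrA.
  have -> : a `^ (p + 1) = a `^ p * a by rewrite powRD ?(negbTE p1)// powRr1.
  by rewrite ler_peMl ?mulr_ge0 ?powR_ge0// lerDr ltW.
rewrite le_eqVlt => /predU1P[->|ba]; first by rewrite !subrr !mulr0 lexx.
have d x : 0 < x -> is_derive x 1 (fun y : R => y `^ (p + 1)) ((p + 1) * x `^ p).
  by move=> x0; have := is_derive1_powR (p + 1) x0; rewrite addrK.
have [c cab ->] : exists2 c, c \in `]b, a[ & a `^ (p + 1) - b `^ (p + 1) = (p + 1) * c `^ p * (a - b).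
  apply: (@MVT _ (fun y : R => y `^ (p + 1)) (fun x => (p + 1) * x `^ p)) => //.
    by move=> x; rewrite in_itv/= => /andP[bx _]; apply: d; exact: lt_trans bx.
  apply: continuous_in_subspaceT => x /[!inE]/= /[!in_itv]/= /andP[bx _].
  have [+ _] := d x (lt_le_trans b0 bx).
  by move=> /derivable1_diffP/differentiable_continuous.
move: cab; rewrite in_itv/= => /andP[bc ca].
have ab0 : 0 <= a - b by rewrite subr_ge0 ltW.
have p10 : 0 <= p + 1 by rewrite addr_ge0// ltW.
by apply/andP; split; rewrite ler_wpM2r// ler_wpM2l// ge0_ler_powR ?nnegrE ?(ltW p0)//; lra.
Qed.

(** Comparison of the sum with the integral of [y^p]: the differences of [(max 0 (x - l))^(p + 1)]
    telescope to [x^(p + 1)] and are bracketed by the mean value theorem. The excess on the right is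
    the term [l = 0]. *)
Lemma sum_power_bounds x p L : 0 < p -> 0 <= x -> x <= L%:R ->
  x `^ (p + 1) <= (p + 1) * \sum_(l < L) (Num.max 0 (x - l%:R)) `^ p
    <= x `^ (p + 1) + (p + 1) * x `^ p.
Proof.
move=> p0 x0 xL; pose y l : R := Num.max 0 (x - l%:R).
have p10 : 0 < p + 1 by rewrite addr_gt0.
have y0 l : 0 <= y l by rewrite le_max lexx.
have yS l : y l.+1 <= y l <= y l.+1 + 1.
  rewrite /y -natr1; case: (leP 0 (x - l%:R)) => ?; case: (leP 0 (x - (l%:R + 1))) => ?; lra.
have inc l := @powR_increment (y l) (y l.+1) p p0.
have tele : \sum_(l < L) (y l `^ (p + 1) - y l.+1 `^ (p + 1)) = x `^ (p + 1).
  rewrite -(big_mkord xpredT (fun l => y l `^ (p + 1) - y l.+1 `^ (p + 1))).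
  rewrite (@telescope_sumr_eq _ 0 L (fun l => - y l `^ (p + 1)))//; last by move=> l _; ring.
  have -> : y 0%N = x by rewrite /y subr0; apply/max_idPr.
  have -> : y L = 0 by rewrite /y; apply/max_idPl; rewrite subr_le0.
  by rewrite powR0 ?gt_eqF// oppr0 sub0r opprK.
apply/andP; split.
  rewrite -tele mulr_sumr; apply: ler_sum => l _.
  have /andP[h1 h2] := yS l; have := inc l; rewrite y0 h1 => /(_ isT)/andP[_ /le_trans]; apply.
  by rewrite ler_piMr ?mulr_ge0 ?powR_ge0 ?(ltW p10)//; lra.
case: L xL tele => [|L] xL tele.
  by rewrite big_ord0 mulr0 addr_ge0 ?mulr_ge0 ?powR_ge0// ltW.
rewrite big_ord_recl /= subr0 mulrDr addrC; apply: lerD; last first.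
  by rewrite (max_idPr x0).
rewrite -tele big_ord_recr/= mulr_sumr.
have last0 : 0 <= y L `^ (p + 1) - y L.+1 `^ (p + 1).
  by rewrite subr_ge0 ge0_ler_powR ?nnegrE ?(ltW p10)//; case/andP: (yS L).
apply: (@le_trans _ _ (\sum_(l < L) (y l `^ (p + 1) - y l.+1 `^ (p + 1)))); last by rewrite lerDl.
apply: ler_sum => l _.
have /andP[h1 h2] := yS l; have := inc l; rewrite y0 h1 => /(_ isT)/andP[h3 _].
apply: le_trans h3; rewrite /bump/= add1n -/(y l.+1).
(* The truncated values drop by exactly 1 as long as the next one is positive; once it is 0 the
   corresponding summand vanishes. *)
have [z|z] := eqVneq (y l.+1) 0; first by rewrite z powR0 ?gt_eqF// !mulr0 mul0r.
have -> : y l - y l.+1 = 1; last by rewrite mulr1.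
move: z; rewrite /y; case: (leP 0 (x - l.+1%:R)) => [h|]; last by rewrite eqxx.
by move=> _; move: h; rewrite -natr1; case: (leP 0 (x - l%:R)) => ?; lra.
Qed.

Lemma expRN_approx x : 0 <= x <= 1 -> `|(1 - x) - expR (- x)| <= x ^+ 2.
Proof.
move=> /andP[x0 x1].
have h1 : 1 - x <= expR (- x) by have := expR_ge1Dx (- x).
have h2 : expR (- x) <= 1 - x + x ^+ 2.
  rewrite expRN -[leLHS]mul1r ler_pdivrMr ?expR_gt0//.
  apply: (@le_trans _ _ ((1 - x + x ^+ 2) * (1 + x))).
    have -> : (1 - x + x ^+ 2) * (1 + x) = 1 + x ^+ 3 by ring.
    by rewrite lerDl exprn_ge0.
  by rewrite ler_wpM2l ?expR_ge1Dx//; nra.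
by rewrite ler_norml; apply/andP; split; nra.
Qed.

Context d (T : measurableType d) (P : probability T R).
Local Notation pr := (pr P).

Lemma none_beforeS (A : nat -> set T) l : none_before A l.+1 = none_before A l `&` ~` A l.
Proof.
apply/seteqP; split=> [w h|w [h h'] j /=].
  by split=> [j /= jl|]; [apply: h => /=; exact: ltnW|apply: h => /=].
by rewrite ltnS leq_eqVlt => /predU1P[->//|jl]; exact: h.
Qed.

Lemma none_before_measurable (A : nat -> set T) l : (forall j, measurable (A j)) -> measurable (none_before A l).
Proof.
move=> mA; elim: l => [|l IH]; last by rewrite none_beforeS; apply: measurableI => //; exact: measurableC.
rewrite (_ : none_before A 0 = setT) //.
by apply/seteqP; split=> // w _ j.
Qed.

(* The probability of none_before A l satisfies a recursion that differs from
   x_{l+1} = (1 - pr (A l)) x_l by the summands on the right. *)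
Lemma one_dependent_exp (A : nat -> set T) (L : nat) : (forall j, measurable (A j)) ->
  (forall l, (l.+1 < L)%N ->
     pr (none_before A l `&` A l.+1) = pr (none_before A l) * pr (A l.+1)) ->
  `|pr (none_before A L) - expR (- \sum_(l < L) pr (A l))| <=
    \sum_(l < L) (pr (A l) ^+ 2 + pr (A l) * pr (A l.-1) + pr (A l.-1 `&` A l) *+ (0 < l)%N).
Proof.
move=> mA ind.
have mN l := @none_before_measurable A l mA.
have split_pr B C : measurable B -> measurable C -> pr B = pr (B `&` C) + pr (B `&` ~` C).
  move=> mB mC; rewrite -pr_disjointU; [|exact: measurableI|by apply: measurableI => //; exact: measurableC|].
    by rewrite -setIUr setUv setIT.
  by apply/disj_set2P/seteqP; split=> w // [[_ ?] [_]].
have mI (B C : set T) : measurable B -> measurable C -> measurable (B `&` C) by exact: measurableI.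
have p01 B : measurable B -> 0 <= pr B <= 1 by move=> mB; rewrite pr_ge0 pr_le1.
suff H l : (l <= L)%N -> `|pr (none_before A l) - expR (- \sum_(j < l) pr (A j))| <=
    \sum_(j < l) (pr (A j) ^+ 2 + pr (A j) * pr (A j.-1) + pr (A j.-1 `&` A j) *+ (0 < j)%N).
  exact: H.
elim: l => [_|l IH lL].
  rewrite !big_ord0 oppr0 expR0 (_ : none_before A 0 = setT); last by apply/seteqP; split=> // w _ j.
  by rewrite /pr probability_setT subrr normr0.
have {IH} := IH (ltnW lL).
rewrite !big_ord_recr/=; set S := \sum_(i < l) _; set E := \sum_(i < l) (_ + _).
set p := pr (A l) => IH.
have /andP[pp0 pp1] : 0 <= p <= 1 by exact: p01.
have ea := @expRN_approx p; rewrite pp0 pp1 in ea; move: ea => /(_ isT) ea.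
(* The event [none_before A l] excludes the neighbour of [A l] and so is not independent of it.
   Dropping that neighbour gives an independent event, at the price of the two correction terms: the
   product with the neighbour's probability and the joint occurrence. *)
have rec : `|pr (none_before A l.+1) - (1 - p) * pr (none_before A l)| <=
     p * pr (A l.-1) + pr (A l.-1 `&` A l) *+ (0 < l)%N.
  have -> : pr (none_before A l.+1) = pr (none_before A l) - pr (none_before A l `&` A l).
    by rewrite none_beforeS (split_pr (none_before A l) (A l))// addrC addKr.
  case: l lL @S @E @p IH pp0 pp1 ea => [|l] lL S E p IH pp0 pp1 ea.
    have -> : none_before A 0 = setT by apply/seteqP; split=> // w _ j.
    have -> : pr setT = 1 by rewrite /pr probability_setT.
    by rewrite setTI /= -/p mulr1 subrr normr0 mulr0n addr0 mulr_ge0.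
  rewrite /= mulr1n.
  have e1 : pr (none_before A l) = pr (none_before A l.+1) + pr (none_before A l `&` A l).
    by rewrite none_beforeS (split_pr (none_before A l) (A l))// addrC.
  have e2 : p * pr (none_before A l) = pr (none_before A l.+1 `&` A l.+1) +
       pr (none_before A l `&` A l `&` A l.+1).
    rewrite mulrC -ind// (split_pr (none_before A l `&` A l.+1) (A l)); [|exact: mI|exact: mA].
    by rewrite none_beforeS addrC; congr (pr _ + pr _); rewrite setIAC.
  have e3 : pr (none_before A l `&` A l `&` A l.+1) <= pr (A l `&` A l.+1).
    by apply: pr_le; [by apply: (mI) => //; exact: mI|exact: mI|move=> w [[]]].
  have e4 : pr (none_before A l `&` A l) <= pr (A l).
    by apply: pr_le; [exact: mI|exact: mA|move=> w []].
  have e5 : p * pr (none_before A l `&` A l) <= p * pr (A l) by rewrite ler_wpM2l.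
  have e6 : 0 <= p * pr (none_before A l `&` A l) by rewrite mulr_ge0// pr_ge0.
  have e7 := pr_ge0 P (none_before A l `&` A l `&` A l.+1).
  have e8 : p * pr (none_before A l) = p * pr (none_before A l.+1) + p * pr (none_before A l `&` A l).
    by rewrite {1}e1 mulrDr.
  have e9 : 0 <= p * pr (A l) by rewrite mulr_ge0// pr_ge0.
  have e10 := pr_ge0 P (A l `&` A l.+1).
  rewrite ler_norml; apply/andP; split; lra.
have ex : expR (- (S + p)) = expR (- S) * expR (- p) by rewrite opprD expRD.
have S0 : 0 <= S by apply: sumr_ge0 => j _; exact: pr_ge0.
have eS : 0 <= expR (- S) <= 1 by rewrite expR_ge0 -expR0 ler_expR oppr_le0.
rewrite ex (_ : pr (none_before A l.+1) - _ =
   (pr (none_before A l.+1) - (1 - p) * pr (none_before A l)) +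
   ((1 - p) * (pr (none_before A l) - expR (- S)) + expR (- S) * ((1 - p) - expR (- p)))); last by ring.
have e1 : `|(1 - p) * (pr (none_before A l) - expR (- S))| <= E.
  rewrite normrM; apply: le_trans IH; rewrite ler_piMl//.
  by rewrite ger0_norm; lra.
have e2 : `|expR (- S) * ((1 - p) - expR (- p))| <= p ^+ 2.
  rewrite normrM; apply: le_trans ea; rewrite ler_piMl//.
  by case/andP: eS => ? ?; rewrite ger0_norm.
have := ler_normD (pr (none_before A l.+1) - (1 - p) * pr (none_before A l))
  ((1 - p) * (pr (none_before A l) - expR (- S)) + expR (- S) * ((1 - p) - expR (- p))).
have := ler_normD ((1 - p) * (pr (none_before A l) - expR (- S))) (expR (- S) * ((1 - p) - expR (- p))).
by move=> h1 h2; apply: (le_trans h2); lra.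
Qed.

End PowerSums.

(** * Passages in a random environment *)

Section Reindexing.
Context (R : realType) d (T : measurableType d) (P : probability T R) (I : eqType).

(** The family of sets is transported along [h] by looking up positions in the list. The empty list
    is set apart because [nth] requires a default element. *)
Lemma mutually_independent_reindex (J : eqType) (X : I -> T -> R) (h : J -> I) : injective h ->
  mutually_independent P X -> mutually_independent P (fun j => X (h j)).
Proof.
move=> injh iX [|j0 S] uS A mA.
  have := iX [::] isT (fun=> setT) (fun=> measurableT); rewrite !big_nil => <-.
  by congr (fine (P _)); apply/seteqP; split=> w _ i.
pose A' i := A (nth j0 (j0 :: S) (index i (map h (j0 :: S)))).
have A'h j : j \in j0 :: S -> A' (h j) = A j.
  by move=> jS; rewrite /A' index_map// nth_index.
have uS' : uniq (map h (j0 :: S)) by rewrite map_inj_uniq.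
have := iX _ uS' A' (fun i => mA _); rewrite big_map.
have -> : \bigcap_(i in [set` map h (j0 :: S)]) (X i @^-1` A' i) =
          \bigcap_(i in [set` (j0 :: S)]) (X (h i) @^-1` A i).
  apply/seteqP; split=> [w H j jS|w H i iS].
    by have := H (h j) (map_f h jS); rewrite /preimage/= A'h.
  have /mapP[j jS ->] : i \in map h (j0 :: S) := iS.
  by rewrite /preimage/= A'h//; exact: H.
move=> ->; rewrite !big_seq; apply: eq_bigr => j jS; by rewrite A'h.
Qed.

End Reindexing.

Section Environment.
Context (R : realType) (c : R).
Local Notation E := (int + int -> R)%type.
Implicit Types (v : E).

Definition bit v (i : nat) : bool := v (inr i%:Z) == 1.

(** Clipping makes the bound by [c] hold for every configuration, so that [pass] is nonnegative and
    bounded without exceptional sets. *)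
Definition field v (x : int) : R := Num.max (- c) (Num.min c (v (inl x))).

Definition pass v (N s : nat) : R := passage c (bit v) (field v) N s.

Definition shift_index (x0 : int) (s : nat) (j : int + int) : int + int :=
  match j with inl x => inl (x0 + x) | inr i => inr (s%:Z + i) end.

Definition flip_index (j : int + int) : int + int :=
  match j with inl x => inl (- x) | inr i => inr i end.

(** The coordinates read by a passage started at [x0] at time [s0]; the starting site and time are
    left out, which makes consecutive boxes disjoint. *)
Definition box (x0 : int) (s0 N s : nat) : seq (int + int) :=
  [seq inl (x0 + i%:Z) | i <- iota 1 N] ++ [seq inr (s0 + i)%N%:Z | i <- iota 1 s].

Lemma shift_index_inj x0 s : injective (shift_index x0 s).
Proof. by case=> [x|i] [y|j] //= [] /addrI ->. Qed.

Lemma flip_index_inj : injective flip_index.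
Proof. by case=> [x|i] [y|j] //= [] // /oppr_inj ->. Qed.

Lemma uniq_box2 x0 s0 x1 s1 N s : (x0 + N%:Z <= x1) -> (s0 + s <= s1)%N ->
  uniq (box x0 s0 N s ++ box x1 s1 N s).
Proof.
move=> xx ss; have ub x t : uniq (box x t N s).
  rewrite cat_uniq; apply/and3P; split.
  - by rewrite map_inj_uniq ?iota_uniq// => i j []; lia.
  - by apply/hasPn => _ /mapP[i _ ->]; apply/mapP => -[].
  - by rewrite map_inj_uniq ?iota_uniq// => i j []; lia.
rewrite cat_uniq !ub andbT /=; apply/hasPn => j; rewrite /box !mem_cat => /orP[]/mapP[i];
  rewrite mem_iota => iN ->; apply/negP => /orP[]/mapP[l]; rewrite mem_iota => lN [] //; lia.
Qed.

Lemma field_le v x : 0 <= c -> `|field v x| <= c.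
Proof.
move=> c0; rewrite /field ler_norml le_max lexx/= ge_max; apply/andP; split; first lra.
by rewrite ge_min lexx.
Qed.

Lemma measurable_bigmin d (T : measurableType d) (I : Type) (r : seq I) (Q : pred I)
    (f : I -> T -> R) (a : R) : (forall i, Q i -> measurable_fun setT (f i)) ->
  measurable_fun setT (fun w => \big[Num.min/a]_(i <- r | Q i) f i w).
Proof.
move=> mf; elim: r => [|i r IH].
  by under eq_fun do rewrite big_nil; exact: measurable_cst.
have [Qi|/negbTE Qi] := boolP (Q i); under eq_fun do rewrite big_cons Qi; last by [].
by apply: measurable_minr => //; exact: mf.
Qed.

Lemma measurable_pass x0 s0 N s :
  measurable_fun setT ((fun v => pass (fun j => v (shift_index x0 s0 j)) N s)
     : depends_on R (box x0 s0 N s) -> R).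
Proof.
set B := box x0 s0 N s.
have mcoord j : j \in B -> measurable_fun setT
   ((fun v => v j) : depends_on R B -> R) by exact: measurable_coord.
apply: measurable_bigmin => h /confinedP[hN hi].
apply: (@eq_measurable_fun _ _ _ _ _ (fun v : depends_on R B => \sum_(i < s)
   wt c (bit (fun j => v (shift_index x0 s0 j))) (field (fun j => v (shift_index x0 s0 j)))
      i.+1 (walk_of h i.+1))).
  by move=> v _; rewrite /cost big_mkord.
apply: measurable_sum => i.
have [gi gN] : 0 < walk_of h i.+1 /\ walk_of h i.+1 <= N%:Z.
  by apply/andP; apply: hi; rewrite /= ltn_ord.
have mf : measurable_fun setT
    ((fun v => field (fun j => v (shift_index x0 s0 j)) (walk_of h i.+1)) : depends_on R B -> R).
  apply: measurable_maxr; first exact: measurable_cst.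
  apply: measurable_minr; first exact: measurable_cst.
  apply: mcoord; rewrite /B mem_cat; apply/orP; left; apply/mapP.
  exists (absz (walk_of h i.+1)); first by rewrite mem_iota; lia.
  by congr (inl (_ + _)); lia.
apply: measurable_funD; first exact: measurable_cst.
apply: measurable_fun_ifT; last 2 first.
- exact: mf.
- exact: measurable_funN.
apply: measurable_fun_eqr; last exact: measurable_cst.
apply: mcoord; rewrite /B mem_cat; apply/orP; right; apply/mapP.
exists i.+1; first by rewrite mem_iota /= ltnS.
by congr inr; lia.
Qed.

Lemma pass_ge0 v N s : 0 <= c -> 0 <= pass v N s.
Proof. by move=> c0; apply: passage_ge0 => x; exact: field_le. Qed.

Lemma pass_le v N s : pass v N s <= 2 * c * s%:R.
Proof. exact: passage_le. Qed.

Lemma pass_shift_subadd v N1 s1 N2 s2 : 0 <= c -> feasible N1 s1 -> feasible N2 s2 ->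
  pass v (N1 + N2) (s1 + s2) <=
  pass v N1 s1 + pass (fun j => v (shift_index N1%:Z s1 j)) N2 s2.
Proof.
move=> c0 F1 F2; apply: (@passage_subadd _ c (bit v) (field v)) => // x; exact: field_le.
Qed.

Lemma pass_blocks v N s k N' s' : 0 <= c -> feasible N s -> feasible N' s' ->
  pass v (k * N + N') (k * s + s') <=
  \sum_(i < k) pass (fun j => v (shift_index (i * N)%N%:Z (i * s) j)) N s + 2 * c * s'%:R.
Proof.
move=> c0 F F'.
have Fk m : feasible (m * N) (m * s).
  move: F; rewrite /feasible => /andP[Ns /orP[N0|/eqP s0]]; last by rewrite s0 muln0 eqxx orbT andbT; move: Ns; rewrite s0; case: (N) => // _; rewrite muln0.
  by rewrite leq_mul2l Ns orbT /= muln_gt0 N0 andbT; case: m.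
have Pk : pass v (k * N) (k * s) <=
    \sum_(i < k) pass (fun j => v (shift_index (i * N)%N%:Z (i * s) j)) N s.
  elim: k => [|k IH].
    by rewrite big_ord0 !mul0n; apply: le_trans (pass_le _ _ _) _; rewrite mulr0.
  rewrite big_ord_recr/= !mulSnr; apply: le_trans (pass_shift_subadd _ c0 (Fk k) F) _.
  by rewrite lerD2r.
apply: le_trans (pass_shift_subadd _ c0 (Fk k) F') _.
by apply: lerD => //; exact: pass_le.
Qed.

End Environment.

(** * One-sided laws of large numbers for passages *)

Section PassageLimit.
Context (R : realType) d (T : measurableType d) (P : probability T R) (c : R).
Local Notation pr := (pr P).
Local Notation Ex := (Ex P).
Implicit Types X : int + int -> T -> R.

Definition iid_env X := [/\ mutually_independent P X,
  forall j, measurable_fun setT (X j),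
  forall x A, measurable A -> P (X (inl x) @^-1` A) = P (X (inl 0) @^-1` A) &
  forall i A, measurable A -> P (X (inr i) @^-1` A) = P (X (inr 0) @^-1` A)].

Definition passage_at X x0 s0 N s w : R :=
  pass c (fun j => X (shift_index x0 s0 j) w) N s.

Definition mean_passage X N s : R := Ex (fun w => pass c (X^~ w) N s).

Lemma shift_index00 : shift_index 0 0 = id.
Proof. by apply/funext => -[x|i]; rewrite /= add0r. Qed.

Lemma iid_env_shift X x0 s0 : iid_env X -> iid_env (fun j => X (shift_index x0 s0 j)).
Proof.
move=> [iX mX lF lB]; split => //; first exact: (mutually_independent_reindex (@shift_index_inj x0 s0)).
- by move=> x A mA /=; rewrite lF// [RHS]lF.
- by move=> x A mA /=; rewrite lB// [RHS]lB.
Qed.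

Lemma iid_env_flip X : iid_env X -> iid_env (fun j => X (flip_index j)).
Proof.
move=> [iX mX lF lB]; split => //; first exact: (mutually_independent_reindex flip_index_inj).
by move=> x A mA /=; rewrite lF// [RHS]lF.
Qed.

Section Fixed.
Context (X : int + int -> T -> R) (c0 : 0 < c) (eX : iid_env X).
Let cge0 : 0 <= c := ltW c0.

Lemma measurable_passage_at x0 s0 N s : measurable_fun setT (passage_at X x0 s0 N s).
Proof.
case: eX => _ mX _ _.
exact: (measurableT_comp (@measurable_pass R c x0 s0 N s) (measurable_env (S := box x0 s0 N s) mX)).
Qed.

Lemma passage_at_bounds x0 s0 N s w : 0 <= passage_at X x0 s0 N s w <= 2 * c * s%:R.
Proof. by rewrite pass_ge0// pass_le. Qed.

Lemma bmeas_passage_at x0 s0 N s : bmeas (passage_at X x0 s0 N s).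
Proof.
split; first exact: measurable_passage_at.
by exists (2 * c * s%:R) => w; have /andP[? ?] := passage_at_bounds x0 s0 N s w; rewrite ger0_norm.
Qed.

Lemma measurable_pass00 N s :
  measurable_fun setT ((fun v => pass c v N s) : depends_on R (box 0 0 N s) -> R).
Proof.
apply: (@eq_measurable_fun _ _ _ _ _ _ _ _ (@measurable_pass R c 0 0 N s)).
by move=> v _; rewrite shift_index00.
Qed.

Lemma uniq_box x0 s0 N s : uniq (box x0 s0 N s).
Proof.
have := @uniq_box2 x0 s0 (x0 + N%:Z) (s0 + s) N s (lexx _) (leqnn _).
by rewrite cat_uniq => /and3P[].
Qed.

Lemma pass_same_law X' N s : iid_env X' ->
  (forall j A, measurable A -> P (X' j @^-1` A) = P (X j @^-1` A)) ->
  (mean_passage X' N s = mean_passage X N s) /\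
  (forall r, pr [set w | pass c (X'^~ w) N s < r] = pr [set w | pass c (X^~ w) N s < r]).
Proof.
move=> [iX' mX' _ _] XX'; case: eX => iX mX _ _; split.
  apply: (Ex_same_law (uniq_box 0 0 N s) iX' iX mX' mX XX' (@measurable_pass00 N s)) => v.
  exact: (pass_ge0 _ _ _ cge0).
move=> r; congr fine.
have mE : measurable [set v : depends_on R (box 0 0 N s) | pass c v N s < r].
  exact: (pr_lt_measurable r (@measurable_pass00 N s)).
exact: (independent_cyl_law (uniq_box 0 0 N s) iX' iX mX' mX XX' mE).
Qed.

Lemma shift_same_law x0 s0 j A : measurable A -> P (X (shift_index x0 s0 j) @^-1` A) = P (X j @^-1` A).
Proof. by case: eX j => _ _ lF lB [x|i] mA /=; [rewrite lF// [RHS]lF|rewrite lB// [RHS]lB]. Qed.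

Lemma Ex_passage_at x0 s0 N s : Ex (passage_at X x0 s0 N s) = mean_passage X N s.
Proof.
exact: (pass_same_law N s (iid_env_shift x0 s0 eX) (shift_same_law x0 s0)).1.
Qed.

Lemma pr_passage_at x0 s0 N s r :
  pr [set w | passage_at X x0 s0 N s w < r] = pr [set w | pass c (X^~ w) N s < r].
Proof.
exact: (pass_same_law N s (iid_env_shift x0 s0 eX) (shift_same_law x0 s0)).2.
Qed.

Lemma passage_at00 N s : passage_at X 0 0 N s = fun w => pass c (X^~ w) N s.
Proof. by apply/funext => w; rewrite /passage_at shift_index00. Qed.

Lemma Ex_passage_block N s i j : i != j ->
  Ex (fun w => passage_at X (i * N)%N%:Z (i * s) N s w * passage_at X (j * N)%N%:Z (j * s) N s w) =
  mean_passage X N s ^+ 2.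
Proof.
have main k l : (k < l)%N ->
  Ex (fun w => passage_at X (k * N)%N%:Z (k * s) N s w * passage_at X (l * N)%N%:Z (l * s) N s w) =
  mean_passage X N s ^+ 2.
  move=> kl; case: (eX) => iX mX _ _.
  have ub : uniq (box (k * N)%N%:Z (k * s) N s ++ box (l * N)%N%:Z (l * s) N s).
    apply: uniq_box2; last by rewrite -mulSnr leq_mul2r kl orbT.
    by rewrite -PoszD -mulSnr lez_nat leq_mul2r kl orbT.
  rewrite (Ex_independent (C := 2 * c * s%:R) ub iX mX (@measurable_pass R c _ _ N s) (@measurable_pass R c _ _ N s)); last 2 first.
  - by move=> v; rewrite pass_ge0// pass_le.
  - by move=> v; rewrite pass_ge0// pass_le.
  by rewrite expr2; congr (_ * _); exact: Ex_passage_at.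
have [ij _|ji _|->] := ltngtP i j; [exact: main| |by []].
by rewrite -[RHS](main _ _ ji); congr (Ex _); apply/funext => w; rewrite mulrC.
Qed.

(** By subadditivity the long passage is at most a sum of [w %/ w0] passages over disjoint boxes,
    which are uncorrelated with equal means, plus one remainder block; Chebyshev controls the
    sum. *)
Lemma passage_upper_tail a b w0 dl eta : (0 < a <= b)%N -> (0 < w0)%N -> 0 < dl -> 0 < eta ->
  exists W, forall w, (W <= w)%N ->
  pr [set t | (mean_passage X (a * w0) (b * w0) / w0%:R + dl) * w%:R
                <= pass c (X^~ t) (a * w) (b * w)] <= eta.
Proof.
move=> /andP[a0 ab] w00 dl0 eta0.
set m := mean_passage X (a * w0) (b * w0); set C := 2 * c * (b * w0)%:R.
have C0 : 0 <= C by rewrite /C !mulr_ge0.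
have m0 : 0 <= m.
  by rewrite /m -(Ex_cst P 0) -(Ex_passage_at 0 0); apply: Ex_le;
    [exact: bmeas_cst|exact: bmeas_passage_at|move=> w; case/andP: (passage_at_bounds 0 0 (a * w0) (b * w0) w)].
(* Beyond the first value the remainder block, of cost at most [C], is absorbed in [dl * w / 2];
   beyond the second the Chebyshev bound [4 * C^2 * k / (dl * w)^2] is at most [eta]. *)
pose D := Num.max (2 * C / dl) (4 * C ^+ 2 / (dl ^+ 2 * eta)).
have D0 : 0 <= D.
  by rewrite le_max; apply/orP; left; apply: divr_ge0; [exact: mulr_ge0|exact: ltW].
have := archi_boundP D0; set W := Num.bound _ => DW.
exists W => w Ww; have Dw : D < w%:R by apply: lt_le_trans DW _; rewrite ler_nat.
have w_gt0 : 0 < w%:R :> R by exact: le_lt_trans Dw.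
have w0R : 0 < w0%:R :> R by rewrite ltr0n.
have h1 : 2 * C <= dl * w%:R.
  have : 2 * C / dl <= w%:R by apply: le_trans (ltW Dw); rewrite le_max lexx.
  by rewrite ler_pdivrMr// [w%:R * _]mulrC.
have h2 : 4 * C ^+ 2 <= dl ^+ 2 * eta * w%:R.
  have : 4 * C ^+ 2 / (dl ^+ 2 * eta) <= w%:R by apply: le_trans (ltW Dw); rewrite le_max lexx orbT.
  by rewrite ler_pdivrMr ?mulr_gt0 ?exprn_gt0// [w%:R * _]mulrC.
pose k := (w %/ w0)%N; pose r := (w %% w0)%N.
have wE : w = (k * w0 + r)%N by exact: divn_eq.
have rw0 : (r < w0)%N by rewrite ltn_mod.
have kw : k%:R * w0%:R <= w%:R :> R by rewrite -natrM ler_nat leq_trunc_div.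
pose Y i := passage_at X (i * (a * w0))%N%:Z (i * (b * w0)) (a * w0) (b * w0).
have := @chebyshev_uncorrelated _ _ _ P k Y C m (dl * w%:R / 2).
move=> /(_ (fun i => @measurable_passage_at _ _ _ _) (fun i => @passage_at_bounds _ _ _ _)
   (fun i => @Ex_passage_at _ _ _ _) (fun i j _ _ => @Ex_passage_block (a * w0) (b * w0) i j)).
move=> /(_ _)/le_trans H; apply: le_trans (H _ _ _); last 2 first.
- by rewrite divr_gt0// mulr_gt0.
- have -> : k%:R * C ^+ 2 / (dl * w%:R / 2) ^+ 2 = (4 * C ^+ 2) * (k%:R / (dl * w%:R) ^+ 2).
    by field; rewrite !gt_eqF.
  have kw' : k%:R <= w%:R :> R.
    by apply: le_trans kw; rewrite ler_peMr// ler1n.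
  apply: (@le_trans _ _ (dl ^+ 2 * eta * w%:R * (w%:R / (dl * w%:R) ^+ 2))).
    apply: ler_pM => //; [by rewrite mulr_ge0// sqr_ge0|by rewrite divr_ge0// sqr_ge0|].
    by rewrite ler_pM2r// invr_gt0 exprn_gt0// mulr_gt0.
  rewrite le_eqVlt; apply/orP; left; apply/eqP.
  by field; rewrite !gt_eqF.
have feas n : feasible (a * n) (b * n).
  rewrite /feasible leq_mul2r ab orbT /= !muln_eq0 muln_gt0 a0 /=.
  by case: n => //; rewrite orbT orbT.
apply: pr_le.
- by apply: measurable_ge; rewrite -passage_at00; exact: measurable_passage_at.
- apply: measurable_ge; apply: measurableT_comp => //.
  apply: measurable_funB; last exact: measurable_cst.
  by apply: measurable_sum => i; exact: measurable_passage_at.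
have wM n : (k * (n * w0) + n * r = n * w)%N by rewrite [in RHS]wE mulnDr [(n * (k * _))%N]mulnCA.
move=> t /= ht.
have := @pass_blocks _ c (X^~ t) _ _ k _ _ cge0 (feas w0) (feas r).
rewrite !wM.
have -> : \sum_(i < k) pass c (fun j => X (shift_index (i * (a * w0))%N%:Z (i * (b * w0)) j) t) (a * w0) (b * w0)
  = \sum_(i < k) Y i t by [].
move=> hb; apply: le_trans (ler_norm _).
have h3 : 2 * c * (b * r)%:R <= C.
  by rewrite ler_wpM2l ?mulr_ge0// ler_nat leq_mul2l ltnW ?orbT.
have h4 : k%:R * m <= m / w0%:R * w%:R.
  by rewrite mulrAC ler_pdivlMr// mulrAC mulrC ler_wpM2l.
have := le_trans ht hb; rewrite mulrDl => h5; lra.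
Qed.

(** Let [A] be the infimum of the normalized means. The upper tail, applied at a nearly optimal
    [w0], keeps the passage below [(A + 2 * e) * w] except on the rare event [Hi]. As the mean is at
    least [A * w], a low value of frequent occurrence could not be compensated. Taking expectations
    yields [dl * pr Lo <= (2 + C) * e], whence the choice of [e]. *)
Lemma passage_lower_tail a b (al dl eta : R) : (0 < a <= b)%N -> 0 < dl -> 0 < eta ->
  (forall w, (0 < w)%N -> al * w%:R <= mean_passage X (a * w) (b * w)) ->
  exists W, forall w, (W <= w)%N ->
  pr [set t | pass c (X^~ t) (a * w) (b * w) < (al - dl) * w%:R] <= eta.
Proof.
move=> ab dl0 eta0 hal.
have b0 : (0 < b)%N by case/andP: ab => a0; exact: leq_trans.
pose g w := mean_passage X (a * w) (b * w) / w%:R.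
pose A := inf [set g w | w in [set w | (0 < w)%N]].
have hi : has_inf [set g w | w in [set w | (0 < w)%N]].
  split; first by exists (g 1%N), 1%N.
  by exists al => _ [w w0 <-]; rewrite /g ler_pdivlMr ?ltr0n// hal.
have gA w : (0 < w)%N -> A <= g w by move=> w0; apply: ge_inf; [case: hi|exists w].
have alA : al <= A.
  by apply: lb_le_inf; [case: hi|move=> _ [w w0 <-]; rewrite /g ler_pdivlMr ?ltr0n// hal].
pose C := 2 * c * b%:R; have C0 : 0 < C by rewrite !mulr_gt0// ltr0n.
pose e := dl * eta / (2 + C).
have C2 : 0 < 2 + C by lra.
have e0 : 0 < e by rewrite divr_gt0// mulr_gt0.
have [_ [w0 w00 <-] gw0] := inf_adherent e0 hi; rewrite -/A in gw0.
have [W HW] := passage_upper_tail ab w00 e0 e0.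
exists W.+1 => w Ww; have {}HW := HW _ (ltnW Ww); rewrite -/(g w0) in HW.
have w_gt0 : (0 < w)%N by exact: leq_ltn_trans Ww.
have wR : 0 < w%:R :> R by rewrite ltr0n.
set Hi := [set t | _] in HW; set Lo := [set t | _].
have mY : measurable_fun setT (fun t => pass c (X^~ t) (a * w) (b * w)).
  by rewrite -passage_at00; exact: measurable_passage_at.
have mHi : measurable Hi by exact: measurable_ge.
have mLo : measurable Lo by exact: pr_lt_measurable.
have bound t : pass c (X^~ t) (a * w) (b * w) <=
    (A + 2 * e) * w%:R + (- (dl * w%:R) * \1_Lo t + C * w%:R * \1_Hi t).
  have Yb := @pass_le _ c (X^~ t) (a * w) (b * w).
  have CE : 2 * c * (b * w)%:R = C * w%:R by rewrite natrM mulrA.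
  have A0 : 0 <= A.
    apply: lb_le_inf; [by case: hi|move=> _ [n n0 <-]; rewrite /g divr_ge0//].
    rewrite -(Ex_passage_at 0 0) -[leLHS](Ex_cst P); apply: Ex_le;
    [exact: bmeas_cst|exact: bmeas_passage_at|move=> u; case/andP: (passage_at_bounds 0 0 (a * n) (b * n) u) => //].
  have Aw : 0 <= A * w%:R by rewrite mulr_ge0.
  have ew : 0 <= e * w%:R by rewrite mulr_ge0 ?ltW.
  have alw : al * w%:R <= A * w%:R by rewrite ler_wpM2r.
  have gw1 : A * w%:R <= g w0 * w%:R by rewrite ler_wpM2r// gA.
  have gw2 : g w0 * w%:R <= (A + e) * w%:R by rewrite ler_wpM2r// ltW.
  rewrite !indicE; have [/set_mem/= hLo|_] := boolP (t \in Lo); have [/set_mem/= hHi|/negP hHi] := boolP (t \in Hi).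
  - have dw : 0 <= dl * w%:R by rewrite mulr_ge0 ?ltW.
    have cw := mulr_ge0 (ltW C0) (ltW wR).
    by rewrite /Lo /= in hLo; rewrite /Hi /= in hHi; lra.
  - by rewrite /Lo /= in hLo; rewrite mulr0n; lra.
  - by rewrite mulr0n; lra.
  - rewrite !mulr0n !mulr0 !addr0 leNgt; apply/negP => hA; apply: hHi; apply/mem_set => /=.
    rewrite /Hi /=; apply: le_trans (ltW hA); rewrite ler_wpM2r//; lra.
have mean := hal _ w_gt0.
have bY : bmeas (fun t => pass c (X^~ t) (a * w) (b * w)).
  by rewrite -passage_at00; exact: bmeas_passage_at.
have bLo := @bmeas_indic _ _ R _ mLo; have bHi := @bmeas_indic _ _ R _ mHi.
have b1 := bmeasZ (- (dl * w%:R)) bLo; have b2 := bmeasZ (C * w%:R) bHi.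
have : mean_passage X (a * w) (b * w) <= (A + 2 * e) * w%:R + (- (dl * w%:R) * pr Lo + C * w%:R * pr Hi).
  rewrite -(Ex_indic P mLo) -(Ex_indic P mHi) -(ExZ P _ bLo) -(ExZ P _ bHi) -(ExD P b1 b2).
  rewrite -{1}(Ex_cst P ((A + 2 * e) * w%:R)) -ExD//; last exact: bmeasD.
    apply: Ex_le => //; apply: bmeasD; [exact: bmeas_cst|exact: bmeasD].
  exact: bmeas_cst.
have := gA w w_gt0; rewrite /g ler_pdivlMr// => gw h.
have h2 : A * w%:R <= (A + 2 * e) * w%:R + (- (dl * w%:R) * pr Lo + C * w%:R * pr Hi).
  exact: le_trans gw h.
have h3 : dl * pr Lo <= (2 + C) * e.
  have : 0 <= w%:R * (2 * e - dl * pr Lo + C * pr Hi) by lra.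
  rewrite pmulr_rge0// => h4; have : C * pr Hi <= C * e by rewrite ler_wpM2l// ltW.
  lra.
have eE : (2 + C) * e = dl * eta by rewrite /e mulrC divfK ?gt_eqF.
by move: h3; rewrite eE ler_pM2l.
Qed.

End Fixed.
End PassageLimit.

Lemma eventually_all (I : eqType) (r : seq I) (Q : I -> nat -> Prop) :
  (forall i, i \in r -> exists W, forall w, (W <= w)%N -> Q i w) ->
  exists W, forall w, (W <= w)%N -> forall i, i \in r -> Q i w.
Proof.
elim: r => [|i r IH] H; first by exists 0%N.
have [|W HW] := IH; first by move=> j jr; apply: H; rewrite inE jr orbT.
have [W' HW'] := H i (mem_head i r).
exists (maxn W W') => w; rewrite geq_max => /andP[Ww W'w] j; rewrite inE => /predU1P[->|jr].
  exact: HW'.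
exact: HW.
Qed.

(** * The linear cost of the cheapest crossing *)

Section Speed.
Context (R : realType) d (T : measurableType d) (P : probability T R) (c : R) (K : nat).
Local Notation pr := (pr P).
Local Notation Ex := (Ex P).
Context (X : int + int -> T -> R) (c0 : 0 < c) (eX : iid_env P X) (K0 : (0 < K)%N).

(** The cap [K] on steps per site will be matched to the Assumption on the hitting time. The set
    contains the scaled means of all pairs [(a * w, b * w)], so its infimum bounds the means at
    every mesh width. *)
Definition speeds : set R :=
  [set mean_passage P c X u.1 u.2 / u.1%:R | u in [set u : nat * nat | (0 < u.1 <= u.2)%N /\ (u.2 <= K * u.1)%N]].

(* The optimal cost per site among crossings taking between 1 and K steps per site. *)
Definition speed_cost : R := inf speeds.

Lemma mean_passage_ge0 N s : 0 <= mean_passage P c X N s.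
Proof.
rewrite -(Ex_passage_at c0 eX 0 0) -[leLHS](Ex_cst P); apply: Ex_le.
- exact: bmeas_cst.
- exact: (bmeas_passage_at c0 eX).
- by move=> w; case/andP: (passage_at_bounds X c0 0 0 N s w).
Qed.

Lemma speeds_has_inf : has_inf speeds.
Proof.
split; first by exists (mean_passage P c X 1 1 / 1%:R), (1%N, 1%N) => //=; split=> //; rewrite muln1.
by exists 0 => _ [u [_ _] <-]; rewrite divr_ge0 ?mean_passage_ge0.
Qed.

Lemma speed_cost_le N s : (0 < N <= s)%N -> (s <= K * N)%N ->
  speed_cost * N%:R <= mean_passage P c X N s.
Proof.
move=> Ns sK; have N0 : 0 < N%:R :> R by rewrite ltr0n; case/andP: Ns.
rewrite -ler_pdivlMr//; apply: ge_inf; first by case: speeds_has_inf.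
by exists (N, s).
Qed.

Lemma speed_cost_ge0 : 0 <= speed_cost.
Proof.
apply: lb_le_inf; first by case: speeds_has_inf.
by move=> _ [u [_ _] <-]; rewrite divr_ge0 ?mean_passage_ge0.
Qed.

Lemma speed_cost_adherent e : 0 < e -> exists N s, [/\ (0 < N <= s)%N, (s <= K * N)%N &
  mean_passage P c X N s <= (speed_cost + e) * N%:R].
Proof.
move=> e0; have [_ [[N s] /= [Ns sK] <-] h] := inf_adherent e0 speeds_has_inf.
exists N, s; split => //; move: h; rewrite ltr_pdivrMr => [/ltW//|].
by rewrite ltr0n; case/andP: Ns.
Qed.

(** A crossing visits every site of [1..N], and each site that is not extreme costs at least [s0];
    the expected number of such sites is [N * p]. *)
Lemma speed_cost_gt0 (s0 : R) : 0 < s0 < c ->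
  0 < pr [set w | `|X (inl 0) w| <= c - s0] -> 0 < speed_cost.
Proof.
move=> /andP[s00 s0c]; set p := pr _ => p0.
apply: (@lt_le_trans _ _ (s0 * p)); first exact: mulr_gt0.
apply: lb_le_inf; first by case: speeds_has_inf.
move=> _ [[N s] /= [/andP[N0 Ns] sK] <-]; rewrite ler_pdivlMr ?ltr0n//.
case: (eX) => iX mX lF lB.
have mA x : measurable [set w | `|X (inl x) w| <= c - s0].
  rewrite [X in measurable X](_ : _ = setT `&` X (inl x) @^-1` `[- (c - s0), c - s0]); first exact: mX.
  by rewrite setTI; apply/seteqP; split=> w /=; rewrite in_itv/= ler_norml.
have pA x : pr [set w | `|X (inl x) w| <= c - s0] = p.
  have E y : [set w | `|X (inl y) w| <= c - s0] = X (inl y) @^-1` `[- (c - s0), c - s0].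
    by apply/seteqP; split=> w /=; rewrite in_itv/= ler_norml.
  by rewrite /p !E; congr fine; exact: lF.
pose Y w := \sum_(x <- iota 1 N) \1_[set w | `|X (inl x%:Z) w| <= c - s0] w : R.
have bY : bmeas Y by apply: bmeas_sum => x; exact: bmeas_indic.
have EY : Ex Y = N%:R * p.
  rewrite Ex_sum; last by move=> x; exact: bmeas_indic.
  rewrite (eq_bigr (fun=> p)) => [|x _]; last by rewrite Ex_indic ?pA.
  by rewrite big_const_seq count_predT size_iota iter_addr_0 mulr_natl.
have bP : bmeas (fun w => pass c (X^~ w) N s).
  by rewrite -(passage_at00 c X); exact: (bmeas_passage_at c0 eX).
rewrite -mulrA (mulrC p) -EY -(ExZ P s0 bY); apply: Ex_le => //; first exact: bmeasZ.
move=> w; have cge0 := ltW c0.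
have fc : forall x, `|field c (X^~ w) x| <= c by move=> x; exact: field_le.
have fe : feasible N s by rewrite /feasible Ns N0.
have [g [gl g0 /confinedP[gs _] E]] := passage_attained (bit (X^~ w)) fc fe.
rewrite /pass E.
have sN : N%:Z <= g s by rewrite gs.
apply: le_trans (range_cost (bit (X^~ w)) fc (ltW s00) gl g0 (leqnn s) sN).
rewrite ler_wpM2l ?(ltW s00)// natr_sum /Y /index_iota subn1 /=; apply: ler_sum => x _.
rewrite indicE ler_nat; have [/set_mem/= h|//] := boolP (_ \in _).
have /andP[h1 h2] : - (c - s0) <= X (inl x%:Z) w <= c - s0 by rewrite -ler_norml.
rewrite /field /=.
have -> : Num.min c (X (inl x%:Z) w) = X (inl x%:Z) w by apply/min_idPr; lra.
have -> : Num.max (- c) (X (inl x%:Z) w) = X (inl x%:Z) w by apply/max_idPr; lra.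
by rewrite h.
Qed.

(** A union bound over the finitely many triples of length, duration and starting time with entries
    at most [J], in mesh units. The starting site is always 0, because a walk is cut at its last
    visit to 0, whereas the time of that visit is unknown. *)
Lemma passage_lower_uniform (J : nat) (dl eta : R) : 0 < dl -> 0 < eta ->
  exists W, forall w, (W <= w)%N -> exists B, [/\ measurable B, pr B <= eta &
   forall t, ~ B t -> forall a b s, (0 < a <= b)%N -> (b <= K * a)%N -> (b <= J)%N -> (s <= J)%N ->
     (speed_cost * a%:R - dl) * w%:R <= passage_at c X 0 (s * w) (a * w) (b * w) t].
Proof.
move=> dl0 eta0.
pose ok (u : nat * nat * nat) := ((0 < u.1.1 <= u.1.2) && (u.1.2 <= K * u.1.1))%N.
pose r := [seq u <- [seq (u, s) | u <- [seq (a, b) | a <- iota 0 J.+1, b <- iota 0 J.+1],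
   s <- iota 0 J.+1] | ok u].
pose e := eta / (size r).+1%:R.
have e0 : 0 < e by rewrite divr_gt0.
pose A u w := [set t | passage_at c X 0 (u.2 * w) (u.1.1 * w) (u.1.2 * w) t <
   (speed_cost * u.1.1%:R - dl) * w%:R].
have mA u w : measurable (A u w) by apply: pr_lt_measurable; exact: (measurable_passage_at c eX).
have [u ur|W HW] := @eventually_all _ r (fun u w => pr (A u w) <= e).
  have /andP[u1 u2] : ok u by move: ur; rewrite mem_filter => /andP[].
  have [|W HW] := passage_lower_tail c0 eX (al := speed_cost * u.1.1%:R) u1 dl0 e0.
    move=> w w0; rewrite -mulrA -natrM; apply: speed_cost_le.
      by move: u1 => /andP[? ?]; rewrite muln_gt0 w0 andbT leq_mul2r; apply/andP; split => //; apply/orP; right.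
    by rewrite mulnA leq_mul2r u2 orbT.
  by exists W => w Ww; rewrite /A pr_passage_at//; exact: HW.
exists W => w Ww; exists (\bigcup_(u in [set` r]) A u w); split.
- by apply: fin_bigcup_measurable => //; exact: finite_seq.
- apply: le_trans (pr_union_sum P r (fun u => mA u w)) _.
  apply: (@le_trans _ _ (\sum_(u <- r) e)).
    by rewrite big_seq [leRHS]big_seq; apply: ler_sum => u ur; exact: HW.
  rewrite big_const_seq count_predT iter_addr_0 -mulr_natr /e mulrAC ler_pdivrMr//.
  by rewrite ler_pM2l// ler_nat.
- move=> t Bt a b s ab bK bJ sJ; rewrite leNgt; apply/negP => h; apply: Bt.
  suff ur : (a, b, s) \in r by exists (a, b, s).
  rewrite /r mem_filter; apply/andP; split; first by rewrite /ok /= ab bK.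
  have mi n : (n <= J)%N -> n \in iota 0 J.+1 by rewrite mem_iota; lia.
  apply/allpairsP; exists ((a, b), s); split; [|exact: mi|by []].
  apply/allpairsP; exists (a, b); split; [|exact: mi|by []].
  by apply: mi; case/andP: ab => _ ?; exact: leq_trans bJ.
Qed.

(** A single nearly optimal pair [(N, s)] serves for all distances: its multiples by [r * w] with
    [r <= J] reach a mesh of sites at nearly optimal cost, and the union bound runs over [r]. *)
Lemma passage_upper_uniform (J : nat) (dl eta : R) : 0 < dl -> 0 < eta ->
  exists N s, [/\ (0 < N <= s)%N, (s <= K * N)%N & exists W, forall w, (W <= w)%N ->
   exists B, [/\ measurable B, pr B <= eta &
   forall t, ~ B t -> forall r, (0 < r <= J)%N ->
     pass c (X^~ t) (N * (r * w)) (s * (r * w)) <= (speed_cost + dl) * (N * (r * w))%N%:R]].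
Proof.
move=> dl0 eta0; have dl2 : 0 < dl / 2 by rewrite divr_gt0.
have [N [s [Ns sK hm]]] := speed_cost_adherent dl2; exists N, s; split => //.
have N0 : 0 < N%:R :> R by rewrite ltr0n; case/andP: Ns.
pose e := eta / J.+1%:R; have e0 : 0 < e by rewrite divr_gt0.
have dN : 0 < dl / 2 * N%:R by rewrite mulr_gt0.
have [W HW] := passage_upper_tail c0 eX Ns (ltn0Sn 0) dN e0.
exists W => w Ww.
pose A r := [set t | (mean_passage P c X (N * 1) (s * 1) / 1%:R + dl / 2 * N%:R) * (r * w)%N%:R
                <= pass c (X^~ t) (N * (r * w)) (s * (r * w))].
have mA r : measurable (A r).
  by apply: measurable_ge; rewrite -(passage_at00 c X); exact: (measurable_passage_at c eX).
exists (\bigcup_(r in [set` iota 1 J]) A r); split.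
- by apply: fin_bigcup_measurable => //; exact: finite_seq.
- apply: le_trans (pr_union_sum P _ mA) _.
  apply: (@le_trans _ _ (\sum_(u <- iota 1 J) e)).
    rewrite big_seq [leRHS]big_seq; apply: ler_sum => r; rewrite mem_iota => /andP[r0 _].
    by apply: HW; apply: leq_trans Ww _; rewrite leq_pmull.
  rewrite big_const_seq count_predT size_iota iter_addr_0 -mulr_natr /e mulrAC ler_pdivrMr//.
  by rewrite ler_pM2l// ler_nat.
- move=> t Bt r rJ; rewrite leNgt; apply/negP => h; apply: Bt.
  exists r; first by rewrite /= mem_iota add1n ltnS.
  rewrite /A /= !muln1 divr1; apply: le_trans (ltW h).
  rewrite [(N * _)%N%:R]natrM mulrA ler_wpM2r//; lra.
Qed.

End Speed.

(** The reflected environment has the same law, hence the same mean passages; one slope serves both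
    half-lines. *)
Lemma speed_cost_flip (R : realType) d (T : measurableType d) (P : probability T R) (c : R) (K : nat)
  (X : int + int -> T -> R) : 0 < c -> iid_env P X ->
  speed_cost P c K (fun j => X (flip_index j)) = speed_cost P c K X.
Proof.
move=> c0 eX; rewrite /speed_cost /speeds; congr inf; congr image; apply/funext => u.
congr (_ / _); apply: (pass_same_law c0 eX _ _ (iid_env_flip eX) _).1.
move=> [x|i] A mA //=; case: eX => _ _ lF _.
by rewrite lF// [RHS]lF.
Qed.

(** * Typical environments *)

Lemma indic_bool (R : realType) (T : Type) (p : T -> bool) (t : T) :
  \1_[set u | p u] t = (p t)%:R :> R.
Proof. by rewrite indicE; congr (nat_of_bool _)%:R; apply/idP/idP => [/set_mem|/mem_set]. Qed.

Section GoodEvents.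
Context (R : realType) d (T : measurableType d) (P : probability T R) (c : R).
Local Notation pr := (pr P).
Local Notation Ex := (Ex P).
Context (X : int + int -> T -> R) (c0 : 0 < c) (eX : iid_env P X).

Lemma field_norm (v : int + int -> R) x : `|field c v x| = Num.min c `|v (inl x)|.
Proof.
rewrite /field; have [v0|v0] := ger0P (v (inl x)).
  have m0 : 0 <= Num.min c (v (inl x)) by rewrite le_min v0 ltW.
  have -> : Num.max (- c) (Num.min c (v (inl x))) = Num.min c (v (inl x)).
    by apply/max_idPr; apply: le_trans m0; rewrite oppr_le0 ltW.
  by rewrite ger0_norm.
have -> : Num.min c (v (inl x)) = v (inl x) by apply/min_idPr; exact: le_trans (ltW v0) (ltW c0).
have m0 : Num.max (- c) (v (inl x)) <= 0 by rewrite ge_max (ltW v0) andbT oppr_le0 ltW.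
by rewrite ler0_norm// oppr_max opprK.
Qed.

Lemma field_norm_gt (v : int + int -> R) x s : 0 < s ->
  (c - s < `|field c v x|) = (c - s < `|v (inl x)|).
Proof. by move=> s0; rewrite field_norm lt_min gtrBl s0. Qed.

Definition extreme_prob s : R := pr [set t | c - s < `|X (inl 0) t|].

Lemma extremeE x s : [set t | c - s < `|X (inl x) t|] =
  X (inl x) @^-1` (~` [set y | `|y| <= c - s]).
Proof. by apply/seteqP; split=> t /=; rewrite ltNge => /negP. Qed.

Lemma measurable_norm_le a : measurable [set y : R | `|y| <= a].
Proof.
rewrite [X in measurable X](_ : _ = `[- a, a]%classic)//.
by apply/seteqP; split=> y /=; rewrite in_itv/= ler_norml.
Qed.

Lemma measurable_extreme x s : measurable [set t | c - s < `|X (inl x) t|].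
Proof.
case: eX => _ mX _ _; rewrite extremeE -[X in measurable X]setTI.
by apply: mX => //; apply: measurableC; exact: measurable_norm_le.
Qed.

Lemma pr_extreme x s : pr [set t | c - s < `|X (inl x) t|] = extreme_prob s.
Proof.
case: eX => _ _ lF _; rewrite /extreme_prob !extremeE; congr fine; apply: lF.
by apply: measurableC; exact: measurable_norm_le.
Qed.

Lemma extreme_triple x s :
  pr [set t | [/\ c - s < `|X (inl x) t|, c - s < `|X (inl (x + 1)) t| & c - s < `|X (inl (x + 2)) t|]]
  = extreme_prob s ^+ 3.
Proof.
case: (eX) => iX _ _ _.
pose S : seq (int + int) := [:: inl x; inl (x + 1); inl (x + 2)].
pose A : int + int -> set R := fun=> ~` [set y : R | `|y| <= c - s].
have uS : uniq S.
  by rewrite /S /= !inE !negb_or andbT; apply/andP; split; [apply/andP; split|]; apply/eqP => -[]; lia.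
have mA j : measurable (A j) by apply: measurableC; exact: measurable_norm_le.
have := iX S uS A mA; rewrite /S !big_cons big_nil mulr1 /A.
rewrite -!extremeE -![fine _]/(pr _) !pr_extreme => E.
rewrite [RHS](_ : _ = extreme_prob s * (extreme_prob s * extreme_prob s)); last by ring.
rewrite -E; congr pr; apply/seteqP; split=> [t [h1 h2 h3] j /=|t h].
  by rewrite !inE => /or3P[]/eqP->; apply/negP; rewrite -ltNge.
have g j : j \in [:: inl x; inl (x + 1); inl (x + 2)] -> c - s < `|X j t|.
  by move=> jS; rewrite ltNge; apply/negP; exact: (h j jS).
by split; apply: g; rewrite !inE eqxx ?orbT.
Qed.

Lemma no_three_extreme_event (L : nat) s : 0 < s -> exists B, [/\ measurable B,
  pr B <= (2 * L + 1)%N%:R * extreme_prob s ^+ 3 &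
  forall t, ~ B t -> no_three_extreme c (field c (X^~ t)) s L].
Proof.
move=> s0; pose r := [seq (i%:Z - L%:Z) | i <- iota 0 (2 * L + 1)].
pose A x := [set t | [/\ c - s < `|X (inl x) t|, c - s < `|X (inl (x + 1)) t| & c - s < `|X (inl (x + 2)) t|]].
have mA x : measurable (A x).
  rewrite /A (_ : [set t | _] = [set t | c - s < `|X (inl x) t|] `&`
    ([set t | c - s < `|X (inl (x + 1)) t|] `&` [set t | c - s < `|X (inl (x + 2)) t|])).
    by apply: measurableI; [|apply: measurableI]; exact: measurable_extreme.
  by apply/seteqP; split=> t /=; [case|case=> ? []].
exists (\bigcup_(x in [set` r]) A x); split.
- by apply: fin_bigcup_measurable => //; exact: finite_seq.
- apply: le_trans (pr_union_sum P r mA) _.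
  rewrite (eq_bigr (fun=> extreme_prob s ^+ 3)) => [|x _]; last exact: extreme_triple.
  by rewrite big_const_seq count_predT size_map size_iota iter_addr_0 mulr_natl.
- move=> t Bt x xL; apply/negP => /and3P[]; rewrite !field_norm_gt// => h1 h2 h3.
  apply: Bt; exists x => //=; apply/mapP; exists (absz (x + L%:Z)); last by lia.
  by rewrite mem_iota; lia.
Qed.

(** Markov's inequality for the number of extreme sites in [1..L]: with high probability at least
    half of the sites are not extreme, which makes every long range expensive. *)
Lemma range_event (L : nat) s : 0 < s -> exists B, [/\ measurable B,
  pr B <= 2 * extreme_prob s &
  forall t, ~ B t -> L%:R / 2 <=
    (\sum_(1 <= x < L.+1) (`|field c (X^~ t) x%:Z| <= c - s)%R)%:R :> R].
Proof.
move=> s0; have [->|L0] := posnP L.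
  exists set0; split => //; first by rewrite /pr measure0 mulr_ge0// pr_ge0.
  by move=> t _; rewrite mul0r.
have LR : 0 < L%:R :> R by rewrite ltr0n.
pose Y t := \sum_(x <- iota 1 L) \1_[set t | c - s < `|X (inl x%:Z) t|] t : R.
have bY : bmeas Y by apply: bmeas_sum => x; apply: bmeas_indic; exact: measurable_extreme.
have Y0 t : 0 <= Y t by apply: sumr_ge0 => x _; rewrite indicE.
have EY : Ex Y = L%:R * extreme_prob s.
  rewrite Ex_sum; last by move=> x; apply: bmeas_indic; exact: measurable_extreme.
  rewrite (eq_bigr (fun=> extreme_prob s)) => [|x _].
    by rewrite big_const_seq count_predT size_iota iter_addr_0 mulr_natl.
  by rewrite Ex_indic ?pr_extreme//; exact: measurable_extreme.
exists [set t | L%:R / 2 <= Y t]; split.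
- by apply: measurable_ge; case: bY.
- have := @markov_pr _ _ _ P Y (L%:R / 2) bY Y0; rewrite EY.
  by move=> h; rewrite -(@ler_pM2l _ L%:R)//; lra.
- move=> t /= /negP; rewrite -ltNge => Yt.
  have : Y t + (\sum_(1 <= x < L.+1) (`|field c (X^~ t) x%:Z| <= c - s)%R)%:R = L%:R :> R.
    rewrite /Y /index_iota subn1 /= natr_sum -big_split/=.
    rewrite (eq_bigr (fun=> 1)) => [|x _].
      by rewrite big_const_seq count_predT size_iota iter_addr_0.
    by rewrite leNgt field_norm_gt// indic_bool; case: (c - s < _); rewrite ?addr0 ?add0r.
  lra.
Qed.

Context (fair : pr [set t | X (inr 0) t = 1] = 2^-1).

Lemma bit_indicator i : [set t | bit (X^~ t) i] = X (inr i%:Z) @^-1` [set 1].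
Proof. by apply/seteqP; split=> t /eqP. Qed.

Lemma measurable_bit i : measurable [set t | bit (X^~ t) i].
Proof. by case: eX => _ mX _ _; rewrite bit_indicator -[X in measurable X]setTI; exact: mX. Qed.

Lemma pr_bit i : pr [set t | bit (X^~ t) i] = 2^-1.
Proof. by case: eX => _ _ _ lB; rewrite bit_indicator -fair; congr fine; exact: lB. Qed.

Lemma pr_bit2 i j : i != j -> pr ([set t | bit (X^~ t) i] `&` [set t | bit (X^~ t) j]) = 2^-1 ^+ 2.
Proof.
move=> ij; case: (eX) => iX _ _ _.
pose S : seq (int + int) := [:: inr i%:Z; inr j%:Z].
have uS : uniq S by rewrite /S /= inE andbT; apply: contra ij => /eqP[/eqP].
have := iX S uS (fun=> [set 1]) (fun=> measurable_set1 1); rewrite /S !big_cons big_nil mulr1.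
rewrite -!bit_indicator -![fine _]/(pr _) !pr_bit => E.
rewrite expr2 -E; congr pr; rewrite !bit_indicator; apply/seteqP; split=> [t [h1 h2] k /=|t h].
  by rewrite !inE => /orP[]/eqP->.
by split; apply: h; rewrite /= !inE eqxx ?orbT.
Qed.

Definition window_count (v : int + int -> R) (D q : nat) : nat :=
  count (fun i => bit v i.+1) (iota (q * D) D).

(** The window length is a perfect square [s * s], so that [s] plays the role of its square root.
    The inequality [z <= z^2 / (2 * s) + s / 2] turns the second moment into a bound on the
    first. *)
Lemma window_deviation D q (s : nat) : (0 < s)%N -> D = (s * s)%N ->
  let Z t := `|(window_count (X^~ t) D q)%:R - D%:R / 2| : R in
  bmeas Z /\ Ex Z <= s%:R.
Proof.
move=> s0 DE Z; have sR : 0 < s%:R :> R by rewrite ltr0n.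
pose Y i t := \1_[set t | bit (X^~ t) (q * D + i).+1] t : R.
have cE t : (window_count (X^~ t) D q)%:R = \sum_(i < D) Y i t.
  rewrite /window_count -(add0n D) -{1}(addn0 (q * D)%N) iotaDl count_map -sum1_count natr_sum.
  rewrite add0n big_mkcond/= -(big_mkord xpredT (fun i => Y i t)) /index_iota subn0.
  by apply: eq_bigr => i _; rewrite /Y indic_bool; case: (bit _ _).
have [bS ES] : bmeas (fun w => \sum_(i < D) Y i w - D%:R * 2^-1) /\
  Ex (fun w => (\sum_(i < D) Y i w - D%:R * 2^-1) ^+ 2) <= D%:R * 1 ^+ 2.
  apply: second_moment_uncorrelated.
  - by move=> i; case: (@bmeas_indic _ _ R _ (measurable_bit (q * D + i).+1)).
  - by move=> i w; rewrite /Y indicE; case: (_ \in _); rewrite ?ler01 ?lexx.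
  - by move=> i; rewrite Ex_indic ?pr_bit//; exact: measurable_bit.
  - move=> i j iD jD ij; rewrite -(@pr_bit2 (q * D + i).+1 (q * D + j).+1); last first.
      by rewrite eqSS eqn_add2l.
    rewrite -Ex_indic; last by apply: measurableI; exact: measurable_bit.
    by congr (Ex _); apply/funext => w; rewrite indicI.
have ZE : Z = fun t => `|\sum_(i < D) Y i t - D%:R * 2^-1| by apply/funext => t; rewrite /Z cE.
have bZ : bmeas Z.
  rewrite ZE; case: bS => mS [C SC]; split; first exact: measurableT_comp.
  by exists C => w; rewrite normr_id.
split=> //.
have b2 : bmeas (fun t => (2 * s%:R)^-1 * ((\sum_(i < D) Y i t - D%:R * 2^-1) ^+ 2)).
  by apply: bmeasZ; rewrite [X in bmeas X](_ : _ = fun t => (\sum_(i < D) Y i t - D%:R * 2^-1) * (\sum_(i < D) Y i t - D%:R * 2^-1)); [exact: bmeasM|apply/funext => t; rewrite expr2].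
apply: (@le_trans _ _ (Ex (fun t => (2 * s%:R)^-1 * ((\sum_(i < D) Y i t - D%:R * 2^-1) ^+ 2) + s%:R / 2))).
  apply: Ex_le => //; first by apply: bmeasD => //; exact: bmeas_cst.
  move=> t; rewrite ZE; set y := \sum_(i < D) _ - _.
  rewrite -[y ^+ 2]real_normK ?num_real//; set z := `|y|.
  have : 0 <= (z - s%:R) ^+ 2 / (2 * s%:R) by rewrite divr_ge0 ?sqr_ge0 ?mulr_ge0.
  have -> : (z - s%:R) ^+ 2 / (2 * s%:R) = (2 * s%:R)^-1 * z ^+ 2 + s%:R / 2 - z.
    by field; rewrite gt_eqF.
  lra.
rewrite ExD//; last exact: bmeas_cst.
rewrite Ex_cst ExZ; last first.
  by rewrite [X in bmeas X](_ : _ = fun t => (\sum_(i < D) Y i t - D%:R * 2^-1) * (\sum_(i < D) Y i t - D%:R * 2^-1)); [exact: bmeasM|apply/funext => t; rewrite expr2].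
have : (2 * s%:R)^-1 * Ex (fun w => (\sum_(i < D) Y i w - D%:R * 2^-1) ^+ 2) <= (2 * s%:R)^-1 * D%:R.
  by rewrite ler_wpM2l ?invr_ge0 ?mulr_ge0//; rewrite expr1n mulr1 in ES.
have -> : (2 * s%:R)^-1 * D%:R = s%:R / 2 :> R by rewrite DE natrM; field; rewrite gt_eqF.
lra.
Qed.

(** [D] is chosen before [n]: the mean total deviation of [n %/ D] windows is at most [n / s], so a
    fixed large [s] suffices. A bounded window length matters because each expensive step spoils a
    whole window. *)
Lemma windows_event (th eta : R) : 0 < th -> 0 < eta -> exists2 D : nat, (0 < D)%N & forall n : nat,
  exists B, [/\ measurable B, pr B <= eta & forall t, ~ B t ->
    \sum_(q < (n %/ D)%N) `|(window_count (X^~ t) D q)%:R - D%:R / 2| <= th * n%:R].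
Proof.
move=> th0 eta0.
have te0 : 0 <= (th * eta)^-1 by rewrite invr_ge0 mulr_ge0 ?ltW.
have := archi_boundP te0; set s := Num.bound _ => hs.
have sR : 0 < s%:R :> R by apply: le_lt_trans hs.
have s0 : (0 < s)%N by rewrite -(ltr_nat R).
exists (s * s)%N; first by rewrite muln_gt0 s0.
set D := (s * s)%N => n; have [->|n0] := posnP n.
  exists set0; split => //; first by rewrite /pr measure0 ltW.
  by move=> t _; rewrite div0n big_ord0 mulr0.
have nR : 0 < n%:R :> R by rewrite ltr0n.
pose Z q t := `|(window_count (X^~ t) D q)%:R - D%:R / 2| : R.
pose S t := \sum_(q <- iota 0 (n %/ D)%N) Z q t.
have bZ q : bmeas (Z q) by case: (@window_deviation D q s s0 erefl).
have bS : bmeas S by exact: bmeas_sum.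
have S0 t : 0 <= S t by apply: sumr_ge0 => q _; exact: normr_ge0.
have ES : Ex S <= n%:R / s%:R.
  rewrite Ex_sum//; apply: (@le_trans _ _ (\sum_(q <- iota 0 (n %/ D)%N) s%:R)).
    by apply: ler_sum => q _; case: (@window_deviation D q s s0 erefl).
  rewrite big_const_seq count_predT size_iota iter_addr_0 ler_pdivlMr// -[s%:R *+ _]mulr_natr.
  by rewrite -!natrM ler_nat mulnAC mulnC leq_trunc_div.
exists [set t | th * n%:R <= S t]; split.
- by apply: measurable_ge; case: bS.
- have tn : 0 < th * n%:R by rewrite mulr_gt0.
  have := le_trans (@markov_pr _ _ _ P S (th * n%:R) bS S0) ES.
  rewrite -ler_pdivlMl// => /le_trans; apply.
  rewrite (_ : _ * _ = (th * s%:R)^-1); last by field; rewrite !gt_eqF.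
  have h1 : (th * eta)^-1 < s%:R := hs.
  rewrite invf_ple ?posrE ?mulr_gt0//.
  by move: h1; rewrite invfM ltr_pdivrMl// => /ltW.
- by move=> t /= /negP; rewrite -ltNge => /ltW; rewrite /S -(big_mkord xpredT (fun q => Z q t)) /index_iota subn0.
Qed.

End GoodEvents.

(** * Absence of cheap edges *)

(* Distance from 0 to the nearer endpoint of the edge (l, l + 1). *)
Definition edge_dist (l : int) : nat := match l with Posz n => n | Negz n => n end.

(** The edges with left endpoint from [-J] to [J - 1] take each distance below [J] exactly twice,
    once on either side; the factor 2 in [intensity] comes from here. *)
Lemma sum_edge_dist (V : zmodType) (g : nat -> V) (J : nat) :
  \sum_(m < 2 * J) g (edge_dist (m%:Z - J%:Z)) = (\sum_(l < J) g l) *+ 2.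
Proof.
rewrite -(big_mkord xpredT (fun m => g (edge_dist (m%:Z - J%:Z)))).
rewrite (@big_cat_nat _ _ _ J)//=; last by lia.
rewrite mulr2n; congr (_ + _).
  rewrite big_nat_rev/= -(big_mkord xpredT g) big_nat [in RHS]big_nat; apply: eq_bigr => i /andP[_ iJ].
  congr g; rewrite (_ : _ - _ = Negz i)//; lia.
rewrite -{1}(add0n J) big_addn (_ : (2 * J - J)%N = J); last by lia.
rewrite -(big_mkord xpredT g); apply: eq_bigr => i _; congr g.
by rewrite (_ : _ - _ = Posz i)//; lia.
Qed.

Section PoissonLimit.
Context (R : realType) d (T : measurableType d) (P : probability T R) (c : R).
Local Notation pr := (pr P).
Context (X : int + int -> T -> R) (eX : iid_env P X) (Xc : forall x t, `|X (inl x) t| <= c).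

Definition disc l t : R := discrepancy c (fun x => X (inl x) t) l.

Lemma disc_ge0 l t : 0 <= disc l t.
Proof.
rewrite /disc /discrepancy; have := ler_normB (X (inl (l + 1)) t) (X (inl l) t).
by have := Xc (l + 1) t; have := Xc l t; lra.
Qed.

Lemma measurable_disc_env (S : seq (int + int)) l : inl l \in S -> inl (l + 1) \in S ->
  measurable_fun setT ((fun v => 2 * c - `|v (inl (l + 1)) - v (inl l)|) : depends_on R S -> R).
Proof.
move=> l0 l1; apply: measurable_funB; first exact: measurable_cst.
apply: measurableT_comp => //; apply: measurable_funB; exact: measurable_coord.
Qed.

Lemma measurable_disc l : measurable_fun setT (disc l).
Proof.
case: eX => _ mX _ _; apply: measurable_funB; first exact: measurable_cst.
by apply: measurableT_comp => //; exact: measurable_funB.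
Qed.

Lemma pr_disc l e : pr [set t | disc l t < e] = pr [set t | disc 0 t < e].
Proof.
case: (eX) => iX mX _ _; case: (iid_env_shift l 0 eX) => iX' mX' _ _.
pose S : seq (int + int) := [:: inl 0; inl 1].
pose E : set (depends_on R S) := [set v | 2 * c - `|v (inl (0 + 1)) - v (inl 0)| < e].
have mE : measurable E.
  by apply: (pr_lt_measurable e (@measurable_disc_env S 0 _ _)); rewrite !inE.
have := independent_cyl_law (isT : uniq S) iX' iX mX' mX
  (shift_same_law eX l 0) mE.
rewrite /pr => H; transitivity (fine (P ((fun w i => X (shift_index l 0 i) w) @^-1` E))).
  by congr (fine (P _)); apply/seteqP; split=> t; rewrite /disc /discrepancy /E /preimage /= ?add0r ?addr0.
by rewrite H.
Qed.

Lemma disc_lt_extreme l t e : disc l t < e -> c - e < `|X (inl l) t| /\ c - e < `|X (inl (l + 1)) t|.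
Proof.
rewrite /disc /discrepancy => h.
have := ler_normB (X (inl (l + 1)) t) (X (inl l) t).
by have := Xc (l + 1) t; have := Xc l t; split; lra.
Qed.

(** Events of index below [l] read the sites [z 0] to [z l], and the event of index [l + 1] reads
    [z (l + 1)] and [z (l + 2)]; the two sets of coordinates are disjoint. *)
Lemma disc_far_indep (z : nat -> int) (f : nat -> R) l : (forall m, z m.+1 = z m + 1) ->
  let A m := [set t | disc (z m) t < f m] in
  pr (none_before A l `&` A l.+1) = pr (none_before A l) * pr (A l.+1).
Proof.
move=> zS A; case: (eX) => iX mX _ _.
have zE m : z m = z 0%N + m%:Z.
  by elim: m => [|m IH]; [rewrite addr0|rewrite zS IH -addrA; congr (_ + _); lia].
pose S1 : seq (int + int) := [seq inl (z i) | i <- iota 0 l.+1].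
pose S2 : seq (int + int) := [:: inl (z l.+1); inl (z l.+2)].
have zinj : injective z by move=> i j; rewrite (zE i) (zE j); lia.
have uS : uniq (S1 ++ S2).
  rewrite cat_uniq; apply/and3P; split.
  - by rewrite map_inj_uniq ?iota_uniq// => i j [] /zinj.
  - apply/hasPn => j jS2; apply/negP => jS1; have /mapP[i iI E] : j \in S1 := jS1.
    by move: jS2 iI; rewrite E !inE mem_iota => /orP[]/eqP[] /zinj; lia.
  - by rewrite /S2 /= inE andbT; apply/eqP => -[] /zinj; lia.
pose Ev m : set (int + int -> R) := [set v | 2 * c - `|v (inl (z m + 1)) - v (inl (z m))| < f m].
(* Indices from [l] on are replaced by [set0]: they do not enter [none_before], but their events
   would not be measurable for the coordinates in [S1]. *)
pose E1 : set (depends_on R S1) := none_before (fun m => if (m < l)%N then Ev m else set0) l.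
have mE1 : measurable E1.
  apply: (@none_before_measurable _ (depends_on R S1)) => m; case: ifP => // ml.
  apply: (pr_lt_measurable (f m) (@measurable_disc_env S1 (z m) _ _)).
    by apply/mapP; exists m => //; rewrite mem_iota; lia.
  by rewrite -zS; apply/mapP; exists m.+1 => //; rewrite mem_iota; lia.
have mE2 : measurable (Ev l.+1 : set (depends_on R S2)).
  by apply: (pr_lt_measurable (f l.+1) (@measurable_disc_env S2 (z l.+1) _ _)); rewrite -?zS !inE eqxx ?orbT.
have E1E : (fun w i => X i w) @^-1` E1 = none_before A l.
  by apply/seteqP; split=> t h m /= ml; have := h m ml; rewrite /= ?ml.
have H := independent_cyl_prod uS iX mX mE1 mE2.
have mN : measurable (none_before A l).
  apply: none_before_measurable => m; apply: pr_lt_measurable; exact: measurable_disc.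
have mA : measurable (A l.+1) by apply: pr_lt_measurable; exact: measurable_disc.
rewrite /pr -fineM ?fin_num_measure//; congr fine.
by rewrite -E1E; exact: H.
Qed.

End PoissonLimit.

(** * The scales of discrepancies and of costs *)

Section Scales.
Context (R : realType).
Implicit Types k : R.

(** [uscale] is the size of the discrepancies that compete and [nscale], equal to [n^zeta] for
    [k = kappa + 1], the order of both cost and distance. They balance twice: [nscale = n * uscale],
    and among [nscale] edges, each having a discrepancy below [uscale] with probability of order
    [uscale^(2k)], a bounded number qualifies. *)
Definition uscale k (n : nat) : R := n%:R `^ (- (2 * k + 1)^-1).
Definition nscale k (n : nat) : R := n%:R `^ ((2 * k) / (2 * k + 1)).

Lemma uscale_gt0 k n : (0 < n)%N -> 0 < uscale k n.
Proof. by move=> n0; rewrite powR_gt0// ltr0n. Qed.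

Lemma nscaleE k n : 0 < k -> (0 < n)%N -> nscale k n = n%:R * uscale k n.
Proof.
move=> k0 n0; have nR : n%:R != 0 :> R by rewrite pnatr_eq0 -lt0n.
rewrite /nscale /uscale -{2}(powRr1 (ler0n R n)) -powRD ?nR ?implybT//; congr (_ `^ _).
by field; rewrite gt_eqF// addr_gt0// mulr_gt0.
Qed.

Lemma uscale_powM k n : 0 < k -> (0 < n)%N -> uscale k n `^ (2 * k) * nscale k n = 1.
Proof.
move=> k0 n0; have nR : n%:R != 0 :> R by rewrite pnatr_eq0 -lt0n.
rewrite /nscale /uscale -powRrM -powRD ?nR ?implybT//.
by rewrite mulrC mulrN addrC subrr powRr0.
Qed.

Lemma powR_small (a e : R) : 0 < a -> 0 < e -> exists2 dl, 0 < dl & forall u, 0 < u <= dl -> u `^ a <= e.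
Proof.
move=> a0 e0; exists (e `^ a^-1); first exact: powR_gt0.
move=> u /andP[u0 ue]; have -> : e = (e `^ a^-1) `^ a.
  by rewrite -powRrM mulVf ?gt_eqF// powRr1// ltW.
by apply: ge0_ler_powR; rewrite ?nnegrE ?powR_ge0 ?(ltW a0) ?(ltW u0).
Qed.

Lemma uscale_small k e : 0 < k -> 0 < e -> exists n0 : nat, forall n, (n0 <= n)%N ->
  (0 < n)%N /\ uscale k n <= e.
Proof.
move=> k0 e0; have k1 : 0 < 2 * k + 1 by rewrite addr_gt0// mulr_gt0.
have E0 : 0 <= e `^ (- (2 * k + 1)) by exact: powR_ge0.
have := archi_boundP E0; set n0 := Num.bound _ => hn.
exists n0 => n n0n; have hn' : e `^ (- (2 * k + 1)) < n%:R by apply: lt_le_trans hn _; rewrite ler_nat.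
have nR : 0 < n%:R :> R by apply: le_lt_trans hn'.
split; first by rewrite -(ltr_nat R).
rewrite /uscale powRN -[leRHS]invrK lef_pV2 ?posrE ?invr_gt0 ?powR_gt0//.
have -> : e^-1 = (e `^ (- (2 * k + 1))) `^ ((2 * k + 1)^-1).
  by rewrite -powRrM mulNr mulfV ?gt_eqF// powR_inv1// ltW.
by apply: ge0_ler_powR; rewrite ?nnegrE ?invr_ge0 ?(ltW k1) ?powR_ge0// ltW.
Qed.

Lemma expRN_lipschitz (a b : R) : 0 <= a -> 0 <= b -> `|expR (- a) - expR (- b)| <= `|a - b|.
Proof.
wlog ab : a b / a <= b.
  move=> H a0 b0; have [ab|ba] := leP a b; first exact: H.
  by rewrite distrC (distrC a); apply: H => //; exact: ltW.
move=> a0 b0; rewrite ger0_norm; last by rewrite subr_ge0 ler_expR lerN2.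
rewrite ler0_norm ?subr_le0// opprB.
have -> : - b = - a + - (b - a) by ring.
rewrite expRD -[X in X - _]mulr1 -mulrBr.
have h1 : expR (- a) <= 1 by rewrite -expR0 ler_expR oppr_le0.
have h2 : 1 - (b - a) <= expR (- (b - a)) by rewrite expR_ge1Dx.
have h3 : 0 <= 1 - expR (- (b - a)) by rewrite subr_ge0 -expR0 ler_expR oppr_le0 subr_ge0.
apply: (@le_trans _ _ (1 * (1 - expR (- (b - a))))); first by rewrite ler_wpM2r.
by lra.
Qed.

Lemma scaled_bounds (p a S g y : R) : 0 < p -> g <= a * (p * S) -> a * (p * S) <= g + p * y ->
  2 * g / p <= a * (2 * S) /\ a * (2 * S) <= 2 * g / p + 2 * y.
Proof.
move=> p0 h1 h2; split; first by rewrite ler_pdivrMr//; lra.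
by rewrite -(ler_pM2l p0) mulrDr [p * (_ / _)]mulrC divfK ?gt_eqF//; lra.
Qed.

Lemma dist_half (x y z e : R) : `|x - y| <= e / 4 -> z <= y -> y <= z + e / 4 -> `|x - z| <= e / 2.
Proof. by rewrite !ler_norml => /andP[h1 h2] h3 h4; apply/andP; split; lra. Qed.

End Scales.

(** * Poisson limit for the absence of cheap edges *)

Section PoissonLimit.
Context (R : realType) d (T : measurableType d) (P : probability T R) (c : R).
Local Notation pr := (pr P).
Context (X : int + int -> T -> R) (eX : iid_env P X) (Xc : forall x t, `|X (inl x) t| <= c).
Context (c0 : 0 < c) (k Kd Ce al : R) (k0 : 0 < k) (Kd0 : 0 < Kd) (al0 : 0 < al) (Ce0 : 0 < Ce).
Context (disc_tail : asym (fun e => pr [set t | disc c X 0 t < e]) Kd (2 * k)).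
Context (extreme_tail : asym (extreme_prob P c X) Ce k).

Definition no_cheap_edge (n : nat) (s : R) : set T :=
  [set t | forall l : int, s * nscale k n <= al * (edge_dist l)%:R + n%:R / 2 * disc c X l t].

(** The limit of the sum over all edges of [Kd * level^(2k)], with level [(2 * al / n) * (x - l)] at
    distance [l] and [x = s * nscale / al]. Both sides contribute the factor 2, and the sum of
    [(x - l)^(2k)] is close to [x^(2k+1) / (2k+1)]. *)
Definition intensity (s : R) := Kd * 2 * ((2 * s) `^ (2 * k) * s / al) / (2 * k + 1).

Let z (J m : nat) : int := m%:Z - J%:Z.
(** The discrepancy below which edge [m] is cheap; beyond distance [x] the level is 0 and the event
    is empty, so finitely many edges matter. *)
Let edge_level (x : R) (n J m : nat) : R := 2 * al / n%:R * Num.max 0 (x - (edge_dist (z J m))%:R).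

Let zS J m : z J m.+1 = z J m + 1.
Proof. by rewrite /z; lia. Qed.

Lemma no_cheap_edgeE n s (J : nat) : (0 < n)%N -> s * nscale k n / al <= J%:R ->
  no_cheap_edge n s =
  none_before (fun m => [set t | disc c X (z J m) t < edge_level (s * nscale k n / al) n J m]) (2 * J).
Proof.
move=> n0 xJ; set x := s * nscale k n / al in xJ *.
have nR : 0 < n%:R :> R by rewrite ltr0n.
have xE : al * x = s * nscale k n by rewrite /x mulrC divfK// gt_eqF.
apply/seteqP; split=> [t H m /= mJ|t H l].
  apply/negP; rewrite -leNgt /edge_level.
  have [h|h] := leP (x - (edge_dist (z J m))%:R) 0; first by rewrite mulr0 disc_ge0.
  have := H (z J m); rewrite -xE => h1.
  rewrite mulrAC ler_pdivrMr//; lra.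
have d0 := disc_ge0 Xc l t.
have [h|h] := leP x (edge_dist l)%:R.
  apply: (@le_trans _ _ (al * (edge_dist l)%:R)); first by rewrite -xE ler_pM2l.
  by rewrite lerDl mulr_ge0// divr_ge0// ltW.
have lJ : (edge_dist l < J)%N by rewrite -(ltr_nat R); exact: lt_le_trans xJ.
have zl : z J (absz (l + J%:Z)%R) = l by rewrite /z; case: l {h d0} lJ => n' /=; lia.
have := H (absz (l + J%:Z)%R); rewrite /= zl => /(_ _)/negP.
have -> : (absz (l + J%:Z)%R < 2 * J)%N by case: l {h d0 zl} lJ => n' /=; lia.
move=> /(_ isT); rewrite -leNgt /edge_level zl => h1.
have h2 : 2 * al / n%:R * (x - (edge_dist l)%:R) <= disc c X l t.
  by apply: le_trans h1; rewrite ler_wpM2l ?le_max ?lexx ?orbT// divr_ge0 ?mulr_ge0// ltW.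
by move: h2; rewrite mulrAC ler_pdivrMr// -xE; lra.
Qed.

(** Three errors are kept below [eta / 4]: the one from 1-dependence, the one from the tail
    asymptotics of the discrepancy, and the one from replacing a sum of powers by its leading term.
    The last two pass through the Lipschitz bound for the exponential. *)
Lemma poisson_limit s eta : 0 < s -> 0 < eta -> exists n0 : nat, forall n, (n0 <= n)%N ->
  measurable (no_cheap_edge n s) /\ `|pr (no_cheap_edge n s) - expR (- intensity s)| <= eta.
Proof.
move=> s0 eta0.
have e34 : eta / 4 + eta / 2 <= eta by lra.
pose g0 := (2 * s) `^ (2 * k) * s / al.
pose S2 := (2 * s) `^ (2 * k).
have p1 : 0 < 2 * k + 1 by rewrite addr_gt0// mulr_gt0.
have p0 : 0 < 2 * k by rewrite mulr_gt0.
have S20 : 0 < S2 by rewrite powR_gt0// mulr_gt0.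
have g00 : 0 < g0 by rewrite divr_gt0// mulr_gt0.
pose G1 := 2 * g0 / (2 * k + 1) + 2 * S2.
have G10 : 0 < G1 by apply: addr_gt0; [apply: divr_gt0 => //|]; exact: mulr_gt0.
pose e := eta / (4 * G1); have e0 : 0 < e by rewrite divr_gt0// mulr_gt0.
have [dl1 dl10 hd] := disc_tail e0.
have [dl2 dl20 he] := extreme_tail ltr01.
(* With [v = u^k], [c1 * v^2] bounds the probability that an edge is cheap and [c2 * v] that a site
   is extreme. Every summand of the dependence error is then of order [v^3], there are at most
   [(2 * s / al + 2) * N] of them and [v^2 * N = 1], so the total is at most [G * v]. *)
pose c1 := (Kd + e) * S2; have c10 : 0 < c1 by rewrite mulr_gt0// addr_gt0.
pose c2 := (Ce + 1) * (2 * s) `^ k; have c20 : 0 < c2 by rewrite mulr_gt0 ?addr_gt0// powR_gt0// mulr_gt0.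
pose G := (2 * s / al + 2) * (2 * c1 ^+ 2 + c2 ^+ 3).
have G0 : 0 < G.
  apply: mulr_gt0; apply: addr_gt0 => //; first by rewrite divr_gt0// mulr_gt0.
    by rewrite mulr_gt0// exprn_gt0.
  exact: exprn_gt0.
pose v0 := Num.min 1 (Num.min (eta / (4 * G)) (eta / (4 * (2 * Kd * S2)))).
have v00 : 0 < v0.
  have a1 : 0 < eta / (4 * G) by rewrite divr_gt0// mulr_gt0.
  have a2 : 0 < eta / (4 * (2 * Kd * S2)) by rewrite divr_gt0//; do 3 apply: mulr_gt0 => //.
  by rewrite !lt_min ltr01 a1 a2.
have [dl3 dl30 hv] := powR_small k0 v00.
pose u0 := Num.min (Num.min 1 dl3) (Num.min (dl1 / (4 * s)) (dl2 / (4 * s))).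
have u00 : 0 < u0.
  have a1 : 0 < dl1 / (4 * s) by rewrite divr_gt0// mulr_gt0.
  have a2 : 0 < dl2 / (4 * s) by rewrite divr_gt0// mulr_gt0.
  by rewrite !lt_min ltr01 dl30 a1 a2.
have [n0 hn] := uscale_small k0 u00.
exists n0 => n /hn[n_gt0 ule].
set u := uscale k n in ule; have u_gt0 : 0 < u by exact: uscale_gt0.
have ue : u <= 1 /\ u <= dl3 /\ u <= dl1 / (4 * s) /\ u <= dl2 / (4 * s).
  by move: ule; rewrite !le_min => /andP[/andP[-> ->] /andP[-> ->]].
case: ue => u1 [u3 [ud1 ud2]].
pose v := u `^ k; have v_gt0 : 0 < v by exact: powR_gt0.
have vv : u `^ (2 * k) = v ^+ 2 by rewrite mulrDl mul1r powRD// (gt_eqF u_gt0) implybT.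
have /hv vle : 0 < u <= dl3 by rewrite u_gt0.
have v1 : v <= 1 by apply: le_trans vle _; rewrite !ge_min lexx.
have vG : G * v <= eta / 4.
  have : v <= eta / (4 * G) by apply: le_trans vle _; rewrite !ge_min lexx !orbT.
  by rewrite ler_pdivlMr; [lra|exact: mulr_gt0].
have vK : 2 * Kd * S2 * v <= eta / 4.
  have : v <= eta / (4 * (2 * Kd * S2)) by apply: le_trans vle _; rewrite !ge_min lexx !orbT.
  by rewrite ler_pdivlMr; [lra|do 3 apply: mulr_gt0 => //].
pose N := nscale k n.
have NE : N = n%:R * u by exact: nscaleE.
have vN : v ^+ 2 * N = 1 by rewrite -vv; exact: uscale_powM.
have nR : 0 < n%:R :> R by rewrite ltr0n.
have N0 : 0 < N by rewrite NE mulr_gt0.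
have N1 : 1 <= N.
  rewrite -vN ler_piMl ?(ltW N0)//; rewrite expr2 -[leRHS]mulr1; apply: ler_pM => //; exact: ltW.
pose x := s * N / al; have x0 : 0 < x by rewrite divr_gt0// mulr_gt0.
pose J := (Num.truncn x).+1.
have /andP[Jx xJ] : (Num.truncn x)%:R <= x < J%:R by apply: truncn_itv; exact: ltW.
have J2 : (2 * J)%N%:R <= (2 * s / al + 2) * N.
  rewrite natrM /J -natr1; have -> : (2 * s / al + 2) * N = 2 * x + 2 * N by rewrite /x; ring.
  lra.
rewrite (no_cheap_edgeE n_gt0 (ltW xJ)) -/N -/x.
set f := edge_level x n J; set A := fun m => _.
have mA m : measurable (A m) by apply: pr_lt_measurable; exact: (measurable_disc c eX).
split; first exact: none_before_measurable.
have fmaxE : 2 * al / n%:R * x = 2 * s * u.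
  by rewrite /x NE; field; rewrite !gt_eqF.
have f0 m : 0 <= f m by apply: mulr_ge0; [rewrite divr_ge0// mulr_ge0// ltW|rewrite le_max lexx].
have fle m : f m <= 2 * s * u.
  rewrite -fmaxE /f /edge_level ler_wpM2l ?divr_ge0 ?mulr_ge0// ?(ltW al0)//.
  by rewrite ge_max (ltW x0)/= gerBl.
have flt1 m : f m < dl1.
  apply: le_lt_trans (fle m) _; move: ud1; rewrite ler_pdivlMr ?mulr_gt0//; lra.
have pE m : `|pr (A m) - Kd * f m `^ (2 * k)| <= e * f m `^ (2 * k).
  by rewrite /A (pr_disc c eX); apply: hd; rewrite f0 flt1.
have fp m : f m `^ (2 * k) <= S2 * v ^+ 2.
  rewrite -vv -powRM ?mulr_ge0 ?(ltW u_gt0) ?(ltW s0)//.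
  by apply: ge0_ler_powR; rewrite ?nnegrE ?(ltW p0)// !mulr_ge0// ltW.
have pA m : pr (A m) <= c1 * v ^+ 2.
  have := pE m; rewrite ler_norml => /andP[_ h].
  have : (Kd + e) * f m `^ (2 * k) <= (Kd + e) * (S2 * v ^+ 2) by rewrite ler_wpM2l//; apply: ltW; exact: addr_gt0.
  by rewrite /c1; lra.
have ex_le : extreme_prob P c X (2 * s * u) <= c2 * v.
  have us : 0 <= 2 * s * u < dl2.
    rewrite !mulr_ge0 ?(ltW s0) ?(ltW u_gt0)//=.
    by move: ud2; rewrite ler_pdivlMr ?mulr_gt0//; lra.
  have := he _ us; rewrite ler_norml powRM ?mulr_ge0 ?(ltW s0) ?(ltW u_gt0)// -/v => /andP[_ h].
  by rewrite /c2; lra.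
(* Two adjacent cheap edges force three consecutive extreme sites, which gains a factor [v] over the
   probability of a single cheap edge. *)
have pAA m : pr (A m.-1 `&` A m) *+ (0 < m)%N <= (c2 * v) ^+ 3.
  case: m => [|m]; first by rewrite mulr0n exprn_ge0// mulr_ge0 ?ltW.
  rewrite /= mulr1n.
  apply: (@le_trans _ _ (extreme_prob P c X (2 * s * u) ^+ 3)); last first.
    by rewrite lerXn2r ?nnegrE ?pr_ge0// mulr_ge0 ?ltW.
  rewrite -(extreme_triple c0 eX (z J m)); apply: pr_le.
  - exact: measurableI.
  - rewrite (_ : [set t | _] = [set t | c - 2 * s * u < `|X (inl (z J m)) t|] `&`
      ([set t | c - 2 * s * u < `|X (inl (z J m + 1)) t|] `&` [set t | c - 2 * s * u < `|X (inl (z J m + 2)) t|])).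
      by apply: measurableI; [|apply: measurableI]; exact: (measurable_extreme c eX).
    by apply/seteqP; split=> t /=; [case|case=> ? []].
  - move=> t [h1 h2].
    have [a1 a2] := disc_lt_extreme Xc (lt_le_trans h1 (fle m)).
    have [b1 b2] := disc_lt_extreme Xc (lt_le_trans h2 (fle m.+1)).
    have zz : z J m.+1 + 1 = z J m + 2 by rewrite zS -addrA.
    by split; [exact: a1|exact: a2|rewrite -zz; exact: b2].
have main := @one_dependent_exp R _ T P A (2 * J) mA (fun l _ => disc_far_indep c eX f l (zS J)).
have err : \sum_(l < 2 * J) (pr (A l) ^+ 2 + pr (A l) * pr (A l.-1) + pr (A l.-1 `&` A l) *+ (0 < l)%N)
    <= eta / 4.
  apply: (@le_trans _ _ (\sum_(l < 2 * J) (2 * c1 ^+ 2 + c2 ^+ 3) * v ^+ 3)).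
    apply: ler_sum => l _; rewrite mulrDl; apply: lerD; last by rewrite -exprMn.
    have q m : 0 <= pr (A m) by exact: pr_ge0.
    have h1 : pr (A l) ^+ 2 <= (c1 * v ^+ 2) ^+ 2 by rewrite lerXn2r ?nnegrE// mulr_ge0 ?exprn_ge0// ltW.
    have h2 : pr (A l) * pr (A l.-1) <= (c1 * v ^+ 2) ^+ 2 by rewrite expr2; exact: ler_pM.
    have h3 : (c1 * v ^+ 2) ^+ 2 <= c1 ^+ 2 * v ^+ 3.
      rewrite exprMn -exprM ler_wpM2l ?exprn_ge0 ?(ltW c10)//.
      by rewrite [leLHS]exprS ler_piMl// exprn_ge0// ltW.
    by rewrite -[2 * _ * _]mulrA (mulr_natl _ 2) mulr2n; exact: lerD (le_trans h1 h3) (le_trans h2 h3).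
  rewrite sumr_const card_ord -[leLHS]mulr_natr; apply: le_trans vG.
  have cc : 0 <= 2 * c1 ^+ 2 + c2 ^+ 3 by apply: addr_ge0; [apply: mulr_ge0 => //|]; apply: exprn_ge0; exact: ltW.
  have vv3 : 0 <= v ^+ 3 by apply: exprn_ge0; exact: ltW.
  apply: (@le_trans _ _ ((2 * c1 ^+ 2 + c2 ^+ 3) * v ^+ 3 * ((2 * s / al + 2) * N))).
    by rewrite ler_wpM2l// mulr_ge0.
  have -> : (2 * c1 ^+ 2 + c2 ^+ 3) * v ^+ 3 * ((2 * s / al + 2) * N) = G * v * (v ^+ 2 * N).
    by rewrite /G; ring.
  by rewrite vN mulr1.
have [sumlo sumhi] : 2 * g0 / (2 * k + 1) <= \sum_(m < 2 * J) f m `^ (2 * k) /\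
   \sum_(m < 2 * J) f m `^ (2 * k) <= 2 * g0 / (2 * k + 1) + 2 * S2 * v ^+ 2.
  have -> : \sum_(m < 2 * J) f m `^ (2 * k) =
     (2 * al / n%:R) `^ (2 * k) * (2 * \sum_(l < J) Num.max 0 (x - l%:R) `^ (2 * k)).
    have sd := sum_edge_dist (fun l => Num.max 0 (x - l%:R) `^ (2 * k)) J.
    rewrite (_ : 2 * \sum_(l < J) Num.max 0 (x - l%:R) `^ (2 * k) =
      \sum_(m < 2 * J) Num.max 0 (x - (edge_dist (m%:Z - J%:Z))%:R) `^ (2 * k)); last by rewrite sd mulr_natl.
    rewrite mulr_sumr; apply: eq_bigr => m _; rewrite /f /edge_level powRM ?le_max ?lexx//.
    by rewrite divr_ge0 ?mulr_ge0// ltW.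
  have /andP[q1 q2] := sum_power_bounds p0 (ltW x0) (ltW xJ).
  set a := (2 * al / n%:R) `^ (2 * k); set Sg := \sum_(l < J) _ in q1 q2 *.
  have a0 : 0 <= a by exact: powR_ge0.
  have ax : a * x `^ (2 * k) = S2 * v ^+ 2.
    rewrite /a -powRM ?(ltW x0) ?divr_ge0 ?mulr_ge0 ?(ltW al0)// fmaxE powRM ?(ltW u_gt0)//; last by rewrite mulr_ge0 ?(ltW s0).
    by rewrite vv.
  have ax1 : a * x `^ (2 * k + 1) = g0.
    rewrite powRD; last by rewrite (gt_eqF p1).
    rewrite powRr1 ?(ltW x0)// mulrA ax /g0 -/S2 /x.
    rewrite (_ : S2 * v ^+ 2 * (s * N / al) = S2 * s / al * (v ^+ 2 * N)); last by ring.
    by rewrite vN mulr1.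
  have aq1 := ler_wpM2l a0 q1; have aq2 := ler_wpM2l a0 q2.
  rewrite mulrDr ax1 in aq2; rewrite ax1 in aq1.
  have ax' : a * ((2 * k + 1) * x `^ (2 * k)) = (2 * k + 1) * (S2 * v ^+ 2) by rewrite mulrCA ax.
  rewrite ax' in aq2.
  by rewrite -[2 * S2 * _]mulrA; exact: scaled_bounds p1 aq1 aq2.
set Sf := \sum_(m < 2 * J) f m `^ (2 * k) in sumlo sumhi.
have sump : `|\sum_(l < 2 * J) pr (A l) - Kd * Sf| <= e * Sf.
  rewrite !mulr_sumr -sumrB; apply: le_trans (ler_norm_sum _ _ _) _.
  by apply: ler_sum => m _; exact: pE.
have v2 : v ^+ 2 <= v by rewrite expr2 ler_piMl// ltW.
have eSf : e * Sf <= eta / 4.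
  apply: (@le_trans _ _ (e * G1)).
    rewrite ler_wpM2l ?(ltW e0)//; apply: le_trans sumhi _; rewrite lerD2l ler_piMr//.
      by rewrite mulr_ge0 ?(ltW S20).
    exact: le_trans v2 v1.
  by rewrite /e (_ : eta / (4 * G1) * G1 = eta / 4)//; field; rewrite gt_eqF.
have int_E : intensity s = Kd * (2 * g0 / (2 * k + 1)) by rewrite /intensity /g0; ring.
have S0 : 0 <= \sum_(l < 2 * J) pr (A l) by apply: sumr_ge0 => l _; exact: pr_ge0.
have I0 : 0 <= intensity s by rewrite int_E; apply: mulr_ge0; [exact: ltW|apply: divr_ge0; [apply: mulr_ge0 => //|]; exact: ltW].
have lip := expRN_lipschitz S0 I0.
have close : `|\sum_(l < 2 * J) pr (A l) - intensity s| <= eta / 2.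
  have Kv : Kd * (2 * S2 * v ^+ 2) <= eta / 4.
    apply: le_trans vK; rewrite (_ : Kd * (2 * S2 * v ^+ 2) = 2 * Kd * S2 * v ^+ 2); last by ring.
    by rewrite ler_wpM2l//; apply: mulr_ge0; [apply: mulr_ge0 => //|]; exact: ltW.
  have k1 := ler_wpM2l (ltW Kd0) sumlo; have k2 := ler_wpM2l (ltW Kd0) sumhi.
  rewrite mulrDr in k2; rewrite int_E.
  exact: dist_half (le_trans sump eSf) k1 (le_trans k2 (lerD (lexx _) Kv)).
have := ler_normD (pr (none_before A (2 * J)) - expR (- \sum_(l < 2 * J) pr (A l)))
   (expR (- \sum_(l < 2 * J) pr (A l)) - expR (- intensity s)).
rewrite addrA subrK => tri.
exact: le_trans tri (le_trans (lerD (le_trans main err) (le_trans lip close)) e34).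
Qed.

End PoissonLimit.

(** * Comparison of the minimal cost with the cheapest edge *)

Section Comparison.
Context (R : realType) (c : R).
Implicit Types (b : nat -> bool) (f : int -> R) (g : nat -> int).

Definition window_error b (D q : nat) : R :=
  `|(count (fun i => b i.+1) (iota (q * D) D))%:R - D%:R / 2|.

Lemma window_min_ge b D q : D%:R / 2 - window_error b D q <= (window_min b D q)%:R.
Proof.
rewrite /window_error /window_min; set k := count _ _.
have kD : (k <= D)%N by rewrite /k -[leqRHS](size_iota (q * D)) count_size.
have := ler_norm (k%:R - D%:R / 2 : R); have := ler_norm (- (k%:R - D%:R / 2) : R); rewrite normrN.
by rewrite /minn; case: ltnP => _ h1 h2; rewrite ?natrB//; lra.
Qed.

Lemma window_min_sum_ge b D n (th : R) : (0 < D)%N -> D%:R <= th * n%:R ->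
  \sum_(q < n %/ D) window_error b D q <= th * n%:R ->
  n%:R * (2^-1 - 2 * th) <= \sum_(q < n %/ D) (window_min b D q)%:R.
Proof.
move=> D0 Dn En.
have h1 : \sum_(q < n %/ D) (D%:R / 2 - window_error b D q) <= \sum_(q < n %/ D) (window_min b D q)%:R.
  by apply: ler_sum => q _; exact: window_min_ge.
apply: le_trans h1; rewrite sumrB sumr_const card_ord -[_ / 2 *+ _]mulr_natl.
have : n%:R <= (n %/ D)%:R * D%:R + D%:R :> R.
  by rewrite -natrM -natrD ler_nat {1}(divn_eq n D) leq_add2l ltnW// ltn_mod.
by have : 0 <= D%:R :> R by []; lra.
Qed.

Lemma count_windows b D n : (0 < D)%N ->
  `|(count (fun i => b i.+1) (iota 0 n))%:R - n%:R / 2| <= \sum_(q < n %/ D) window_error b D q + D%:R.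
Proof.
move=> D0; set p := fun i => b i.+1.
have main Q : `|(count p (iota 0 (Q * D)))%:R - (Q * D)%:R / 2| <= \sum_(q < Q) window_error b D q.
  elim: Q => [|Q IH]; first by rewrite mul0n big_ord0 /= mul0r subrr normr0.
  rewrite big_ord_recr/= mulSnr iotaD count_cat add0n !natrD.
  rewrite (_ : _ - _ = ((count p (iota 0 (Q * D)))%:R - (Q * D)%:R / 2) +
    ((count p (iota (Q * D) D))%:R - D%:R / 2)); last by field.
  by apply: le_trans (ler_normD _ _) _; rewrite lerD2r.
rewrite {1 2}(divn_eq n D) iotaD count_cat add0n !natrD.
set r := (n %% D)%N; set k := count p (iota _ r); have := main (n %/ D)%N.
have kr : (k <= r)%N by rewrite /k -[leqRHS](size_iota (n %/ D * D)) count_size.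
have rD : (r <= D)%N by rewrite ltnW// ltn_mod.
have kr' : k%:R <= r%:R :> R by rewrite ler_nat.
have rD' : r%:R <= D%:R :> R by rewrite ler_nat.
have k0 : 0 <= k%:R :> R by [].
by rewrite !ler_norml => /andP[h1 h2]; apply/andP; split; lra.
Qed.

(** Transfers the bounds for mesh passages to an arbitrary walk reaching [L] in time at most
    [M * L.+1]; rounding to the mesh costs [6 * c * w]. *)
Lemma passage_reach b f g n (L M w J : nat) (al dl : R) : (forall x, `|f x| <= c) ->
  lazy_walk n g -> g 0%N = 0 -> L%:Z <= g n -> (0 < w)%N ->
  (n <= M * L.+1)%N -> (M * L.+1 + 3 * w <= J * w)%N -> 0 <= al -> 0 <= dl ->
  (forall a e s, (0 < a <= e)%N -> (e <= (2 * M + 3) * a)%N -> (e <= J)%N -> (s <= J)%N ->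
     (al * a%:R - dl) * w%:R <= passage c (fun i => b (s * w + i)%N) f (a * w) (e * w)) ->
  al * L%:R <= cost c b f 0 n g + (6 * c + dl) * w%:R.
Proof.
move=> fc gl g0 Lg w0 nM MJ al0 dl0 H.
have c0 : 0 <= c by apply: le_trans (fc 0).
have [->|L0] := posnP L.
  by rewrite mulr0 addr_ge0 ?cost_ge0// mulr_ge0// addr_ge0// mulr_ge0.
have [a [s [e [/andP[La aL] sn en ae pc]]]] := passage_of_walk b fc gl g0 L0 Lg w0.
(* Origin of the cap [2 * M + 3]: the duration is at most [M * (L + 1) + 3 * w], with [L <= a * w]
   and [1 <= w <= a * w]. *)
have ew : (e * w <= ((2 * M + 3) * a) * w)%N.
  have h1 : (M * L.+1 <= M * (a * w + w))%N by rewrite leq_mul2l; apply/orP; right; lia.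
  have a1 : (w <= a * w)%N by rewrite leq_pmull//; case/andP: ae.
  have h2 : (M * w <= M * (a * w))%N by rewrite leq_mul2l a1 orbT.
  by rewrite mulnDr in h1; rewrite mulnDl mulnDl -!mulnA; lia.
have eK : (e <= (2 * M + 3) * a)%N by rewrite -(leq_pmul2r w0).
have eJ : (e <= J)%N by rewrite -(leq_pmul2r w0); lia.
have sJ : (s <= J)%N by rewrite -(leq_pmul2r w0); lia.
have := H a e s ae eK eJ sJ.
have : al * L%:R <= al * (a%:R * w%:R) by rewrite ler_wpM2l// -natrM ler_nat.
by move: pc; lra.
Qed.

Lemma edge_dist_le (l x : int) : (x == l) || (x == l + 1) ->
  (edge_dist l)%:Z <= if 0 <= l then x else - x.
Proof. by case: l => m /orP[]/eqP-> /=; lia. Qed.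

(** Up to [tau] the walk crosses to the edge [(l, l + 1)], which costs almost [al] per site; from
    then on each window pays for pairs of opposite signs at the price [discrepancy c f l], the least
    one on the range. The four losses of size [th * n] are the sign fluctuations, the incomplete
    last window, the windows with expensive steps and the time before [tau]. *)
Lemma edge_cost_le b f g n (l : int) (M D w J L : nat) (eps al dl th : R) :
  (forall x, `|f x| <= c) -> lazy_walk n g -> g 0%N = 0 -> is_ell c f n g l ->
  (tau_of n g l < M * `|l|)%N -> (0 < D)%N -> (0 < w)%N -> 0 < eps <= c -> 0 <= al -> 0 <= dl ->
  (forall i, (i <= n)%N -> `|g i| <= L%:Z) -> no_three_extreme c f eps L ->
  \sum_(q < n %/ D) window_error b D q <= th * n%:R -> (M * L + D)%N%:R <= th * n%:R ->
  D%:R * (cost c b f 0 n g / eps) <= th * n%:R -> (M * L.+1 + 3 * w <= J * w)%N ->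
  (forall a e s, (0 < a <= e)%N -> (e <= (2 * M + 3) * a)%N -> (e <= J)%N -> (s <= J)%N ->
     (al * a%:R - dl) * w%:R <= passage c (fun i => b (s * w + i)%N) f (a * w) (e * w)) ->
  (forall a e s, (0 < a <= e)%N -> (e <= (2 * M + 3) * a)%N -> (e <= J)%N -> (s <= J)%N ->
     (al * a%:R - dl) * w%:R <= passage c (fun i => b (s * w + i)%N) (f \o -%R) (a * w) (e * w)) ->
  al * (edge_dist l)%:R + discrepancy c f l * (n%:R * (2^-1 - 4 * th)) <=
    cost c b f 0 n g + (6 * c + dl) * w%:R.
Proof.
move=> fc gl g0 [[i0 i0n gi0] lmin] tauM D0 w0 epsc al0 dl0 gL no3 wE MLn Zeps MJ Hp Hm.
set tau := tau_of n g l in tauM.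
have hit : has (fun i => (g i == l) || (g i == l + 1)) (iota 0 n.+1).
  by apply/hasP; exists i0; rewrite ?mem_iota ?gi0 ?eqxx.
have taun : (tau <= n)%N by move: hit; rewrite has_find size_iota.
have gtau : (g tau == l) || (g tau == l + 1).
  by have := nth_find 0%N hit; rewrite -/(tau_of n g l) -/tau nth_iota// add0n.
have lL : (`|l|%N <= L)%N by have := gL _ i0n; rewrite gi0; lia.
have tauL : (tau <= M * L)%N by apply: leq_trans (ltnW tauM) _; rewrite leq_mul2l lL orbT.
have d0 : 0 <= discrepancy c f l.
  rewrite /discrepancy; have := ler_normB (f (l + 1)) (f l).
  by have := fc (l + 1); have := fc l; lra.
have QD : (n %/ D * D <= n)%N by exact: leq_trunc_div.
have low := walk_cost_ge b gl D0 QD taun epsc gL no3 fc d0 lmin.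
have DR : D%:R <= th * n%:R by apply: le_trans MLn; rewrite ler_nat leq_addl.
have tD : (tau + D)%N%:R <= th * n%:R by apply: le_trans MLn; rewrite ler_nat leq_add2r.
have wm := window_min_sum_ge D0 DR wE.
have reach : al * (edge_dist l)%:R <= cost c b f 0 tau g + (6 * c + dl) * w%:R.
  have gtl : lazy_walk tau g := lazy_walk_sub taun gl.
  have MLJ m : (m <= L)%N -> (M * m.+1 + 3 * w <= J * w)%N.
    by move=> mL; apply: leq_trans MJ; rewrite leq_add2r leq_mul2l ltnS mL orbT.
  case: l @tau tauM gtau lL {lmin low d0 hit gi0} taun tauL tD gtl => [m|m] tau tauM gtau lL taun tauL tD gtl /=.
    apply: (passage_reach fc gtl g0 (edge_dist_le gtau) w0 _ (MLJ m _) al0 dl0 Hp); last by [].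
    by apply: leq_trans (ltnW tauM) _; rewrite leq_mul2l leqnSn orbT.
  rewrite -(cost_opp c b f).
  apply: (passage_reach _ (lazy_walkN gtl) _ (edge_dist_le gtau) w0 _ (MLJ m _) al0 dl0 Hm).
  - by move=> x; exact: fc.
  - by rewrite g0 oppr0.
  - exact: ltnW tauM.
  - exact: ltnW lL.
have : discrepancy c f l * (n%:R * (2^-1 - 4 * th)) <= discrepancy c f l *
    (\sum_(q < n %/ D) (window_min b D q)%:R - D%:R * (cost c b f 0 n g / eps) - (tau + D)%N%:R).
  by rewrite ler_wpM2l//; lra.
by lra.
Qed.

(** A walk leaving [[-L, L]] would have visited at least [L / 2] sites costing [s0] each on one
    side; the negative side is the positive one for the reflected field. *)
Lemma range_bound b f g n (L : nat) (s0 S : R) : (forall x, `|f x| <= c) -> 0 <= s0 ->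
  lazy_walk n g -> g 0%N = 0 -> cost c b f 0 n g < S -> S <= s0 * (L%:R / 2) ->
  L%:R / 2 <= (\sum_(1 <= x < L.+1) (`|f x%:Z| <= c - s0)%R)%:R :> R ->
  L%:R / 2 <= (\sum_(1 <= x < L.+1) (`|(f \o -%R) x%:Z| <= c - s0)%R)%:R :> R ->
  forall i, (i <= n)%N -> `|g i| <= L%:Z.
Proof.
move=> fc s00 gl g0 costS SL Hp Hm.
have half h g' : (forall x, `|h x| <= c) -> lazy_walk n g' -> g' 0%N = 0 -> cost c b h 0 n g' < S ->
    L%:R / 2 <= (\sum_(1 <= x < L.+1) (`|h x%:Z| <= c - s0)%R)%:R :> R -> forall i, (i <= n)%N -> g' i < L%:Z.
  move=> hc gl' g0' cS H i iN; rewrite ltNge; apply/negP => Lg.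
  have h1 := range_cost b hc s00 gl' g0' iN Lg; have h2 := ler_wpM2l s00 H.
  have : cost c b h 0 i g' <= cost c b h 0 n g' by rewrite [leRHS](cost_cat _ _ _ _ (leq0n i) iN) lerDl cost_ge0.
  by lra.
move=> i iN; have gp := half f g fc gl g0 costS Hp i iN.
have := half (f \o -%R) (fun i => - g i) (fun x => fc _) (lazy_walkN gl).
rewrite g0 oppr0 cost_opp => /(_ erefl costS Hm i iN) gm; lia.
Qed.

End Comparison.

Section NearScales.
Context (R : realType) (k : R) (k0 : 0 < k).

Lemma near_uscale_powR (a e : R) : 0 < a -> 0 < e -> \forall n \near \oo, uscale k n `^ a <= e.
Proof.
move=> a0 e0; have [dl dl0 H] := powR_small a0 e0; have [n0 Hn] := uscale_small k0 dl0.
by exists n0 => // n /Hn[n_gt0 h]; apply: H; rewrite uscale_gt0.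
Qed.

Lemma near_uscale (e : R) : 0 < e -> \forall n \near \oo, uscale k n <= e.
Proof. by move=> e0; have [n0 Hn] := uscale_small k0 e0; exists n0 => // n /Hn[]. Qed.

Lemma near_nscale (C : R) : \forall n \near \oo, C <= nscale k n.
Proof.
have [m [C0 Cm]] : exists m : R, 0 < m /\ C <= m by exists (Num.max 1 C); rewrite lt_max ltr01 le_max lexx orbT.
have p0 : 0 < 2 * k by exact: mulr_gt0.
have iC : 0 < m^-1 by rewrite invr_gt0.
near=> n; have n0 : (0 < n)%N by near: n; exists 1%N.
have up : 0 < uscale k n `^ (2 * k) by rewrite powR_gt0// uscale_gt0.
have Nge0 : 0 <= nscale k n by exact: powR_ge0.
apply: (le_trans Cm).
have h : uscale k n `^ (2 * k) <= m^-1 by near: n; exact: near_uscale_powR.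
have : 1 <= m^-1 * nscale k n by rewrite -(uscale_powM k0 n0) ler_wpM2r.
by rewrite mulrC ler_pdivlMr// mul1r.
Unshelve. all: by end_near. Qed.

End NearScales.

(** For [eps = u^(5/6)] the expected number of triples of neighbouring extreme sites among order [N]
    sites is of order [N * eps^(3k) = u^(k/2)], which tends to 0. *)
Lemma powR_cube (R : realType) (u k N : R) : 0 < u -> u `^ (2 * k) * N = 1 ->
  N * ((u `^ (5 / 6)) `^ k) ^+ 3 = u `^ (k / 2).
Proof.
move=> u0 uN; have -> : ((u `^ (5 / 6)) `^ k) ^+ 3 = u `^ (2 * k) * u `^ (k / 2).
  rewrite -powR_mulrn ?powR_ge0// -!powRrM -powRD; last by rewrite (gt_eqF u0) implybT.
  by congr (_ `^ _); field.
by rewrite mulrA [N * _]mulrC uN mul1r.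
Qed.

Lemma asym_le (R : realType) (f : R -> R) C p : 0 < C -> asym f C p ->
  exists2 dl, 0 < dl & forall x, 0 <= x < dl -> f x <= 2 * C * x `^ p.
Proof.
move=> C0 /(_ C C0)[dl dl0 H]; exists dl => // x /H.
by rewrite ler_norml => /andP[_]; lra.
Qed.

Lemma field_shift (R : realType) (c : R) (v : int + int -> R) (s : nat) :
  field c (fun j => v (shift_index 0 s j)) = field c v.
Proof. by apply/funext => x; rewrite /field /= add0r. Qed.

(** * Typical environments at scale [nscale] *)

Section CheapEdge.
Context (R : realType) d (T : measurableType d) (P : probability T R) (c : R).
Local Notation pr := (pr P).
Context (X : int + int -> T -> R) (eX : iid_env P X) (Xc : forall x t, `|X (inl x) t| <= c).
Context (c0 : 0 < c) (k Ce : R) (k0 : 0 < k) (Ce0 : 0 < Ce).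
Context (extreme_tail : asym (extreme_prob P c X) Ce k).
Context (fair : pr [set t | X (inr 0) t = 1] = 2^-1).

Definition env_cost t n g : R := cost c (bit (X^~ t)) (field c (X^~ t)) 0 n g.

Lemma field_id t x : field c (X^~ t) x = X (inl x) t.
Proof.
have := Xc x t; rewrite ler_norml => /andP[h1 h2].
by rewrite /field (min_idPr h2) (max_idPr h1).
Qed.

Lemma field_bound t x : `|field c (X^~ t) x| <= c.
Proof. by rewrite field_id. Qed.

Lemma discrepancy_field t l : discrepancy c (field c (X^~ t)) l = disc c X l t.
Proof. by rewrite /disc /discrepancy !field_id. Qed.

Lemma extreme_small e : 0 < e -> exists2 s0, 0 < s0 & extreme_prob P c X s0 <= e.
Proof.
move=> e0; have [dl dl0 H] := asym_le Ce0 extreme_tail.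
have eC : 0 < e / (2 * Ce) by rewrite divr_gt0// mulr_gt0.
have [dl' dl'0 H'] := powR_small k0 eC.
have m0 : 0 < Num.min (dl / 2) dl' by rewrite lt_min dl'0 divr_gt0.
exists (Num.min (dl / 2) dl') => //.
apply: le_trans (H _ _) _.
  by rewrite (ltW m0)/= gt_min; apply/orP; left; lra.
by rewrite mulrC -ler_pdivlMr ?mulr_gt0//; apply: H'; rewrite m0 ge_min lexx orbT.
Qed.

Lemma pr_setU4 (A1 A2 A3 A4 : set T) a1 a2 a3 a4 :
  measurable A1 -> measurable A2 -> measurable A3 -> measurable A4 ->
  pr A1 <= a1 -> pr A2 <= a2 -> pr A3 <= a3 -> pr A4 <= a4 ->
  let B := A1 `|` A2 `|` A3 `|` A4 in measurable B /\ pr B <= a1 + a2 + a3 + a4.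
Proof.
move=> m1 m2 m3 m4 h1 h2 h3 h4 B.
have m12 := measurableU _ _ m1 m2; have m123 := measurableU _ _ m12 m3.
split; first exact: measurableU.
apply: le_trans (prU _ m123 m4) _; apply: lerD => //.
apply: le_trans (prU _ m12 m3) _; apply: lerD => //.
by apply: le_trans (prU _ m1 m2) _; apply: lerD.
Qed.

Lemma no_three_extreme_near (C eta : R) : 0 <= C -> 0 < eta ->
  \forall n \near \oo, forall L : nat, L%:R <= C * nscale k n -> exists B, [/\ measurable B, pr B <= eta &
    forall t, ~ B t -> no_three_extreme c (field c (X^~ t)) (uscale k n `^ (5 / 6)) L].
Proof.
move=> C0 eta0; have [dl dl0 H] := asym_le Ce0 extreme_tail.
pose C2 := (2 * C + 1) * (2 * Ce) ^+ 3.
have C20 : 0 < C2 by rewrite mulr_gt0 ?exprn_gt0 ?mulr_gt0//; lra.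
have dl2 : 0 < dl / 2 by rewrite divr_gt0.
have q1 : 0 < 5 / 6 :> R by rewrite divr_gt0.
have q2 : 0 < k / 2 by rewrite divr_gt0.
near=> n => L LN; have n0 : (0 < n)%N by near: n; exists 1%N.
have u0 : 0 < uscale k n := uscale_gt0 k n0.
set u := uscale k n in u0 *; set eps := u `^ (5 / 6).
have eps0 : 0 < eps by exact: powR_gt0.
have [B [mB pB HB]] := no_three_extreme_event c0 eX L eps0.
exists B; split => //; apply: le_trans pB _.
have epsl : eps <= dl / 2 by rewrite /eps /u; near: n; exact: near_uscale_powR.
have N1 : 1 <= nscale k n by near: n; exact: near_nscale.
have uN := uscale_powM k0 n0; rewrite -/u in uN; set N := nscale k n in LN N1 uN.
have : extreme_prob P c X eps <= 2 * Ce * eps `^ k by apply: H; rewrite (ltW eps0)/=; lra.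
set e := extreme_prob _ _ _ _ => eh.
have e0 : 0 <= e by exact: pr_ge0.
apply: (@le_trans _ _ ((2 * C + 1) * N * (2 * Ce * eps `^ k) ^+ 3)).
  apply: ler_pM => //; first by rewrite exprn_ge0.
    by rewrite natrD natrM [leRHS]mulrDl mul1r -[2 * C * _]mulrA lerD// ler_wpM2l.
  by rewrite lerXn2r ?nnegrE//; apply: le_trans eh.
have -> : (2 * C + 1) * N * (2 * Ce * eps `^ k) ^+ 3 = C2 * (N * (eps `^ k) ^+ 3) by rewrite /C2; ring.
have -> : N * (eps `^ k) ^+ 3 = u `^ (k / 2) by exact: powR_cube.
have : u `^ (k / 2) <= eta / C2 by rewrite /u; near: n; apply: near_uscale_powR => //; rewrite divr_gt0.
by rewrite ler_pdivlMr// mulrC.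
Unshelve. all: by end_near. Qed.

Let flip_eX : iid_env P (fun j => X (flip_index j)) := iid_env_flip eX.

(** A walk of cost below [s * nscale] stays within distance of order [nscale]: all later union
    bounds over sites have that length. *)
Lemma range_near s eta : 0 < s -> 0 < eta -> exists2 C, 0 < C &
  \forall n \near \oo, exists2 L : nat, L%:R + 1 <= C * nscale k n & exists B, [/\ measurable B, pr B <= eta &
    forall t, ~ B t -> forall g, lazy_walk n g -> g 0%N = 0 -> env_cost t n g < s * nscale k n ->
      forall i, (i <= n)%N -> `|g i| <= L%:Z].
Proof.
move=> s_gt0 eta0; have e4 : 0 < eta / 4 by rewrite divr_gt0.
have [s0 s00 hs0] := extreme_small e4.
have ss0 : 0 < 2 * s / s0 by rewrite divr_gt0// mulr_gt0.
exists (2 * s / s0 + 2); first exact: addr_gt0.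
near=> n; have N1 : 1 <= nscale k n by near: n; exact: near_nscale.
set N := nscale k n in N1 *.
have x0 : 0 <= 2 * s / s0 * N by rewrite mulr_ge0 ?(ltW ss0)//; exact: le_trans N1.
have /andP[Lx xL] := truncn_itv x0; set L := (Num.truncn _).+1 in xL.
have L1 : L%:R <= 2 * s / s0 * N + 1 by rewrite /L -natr1 lerD2r.
exists L; first by rewrite mulrDl; lra.
have [B1 [mB1 pB1 HB1]] := range_event c0 eX L s00.
have [B2 [mB2 pB2 HB2]] := range_event c0 flip_eX L s00.
have pB2' : pr B2 <= 2 * extreme_prob P c X s0 by [].
exists (B1 `|` B2); split; first exact: measurableU.
  by apply: le_trans (prU _ mB1 mB2) _; lra.
move=> t /not_orP[/HB1 h1 /HB2 h2] g gl g0 gc.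
apply: (range_bound (field_bound t) (ltW s00) gl g0 gc _ h1 h2).
have : s0 * (2 * s / s0 * N) <= s0 * L%:R by rewrite ler_pM2l// ltW.
by rewrite (_ : s0 * (2 * s / s0 * N) = 2 * (s * N)); [lra|field; rewrite gt_eqF].
Unshelve. all: by end_near. Qed.

Lemma passage_lower_near (M J : nat) (dl eta : R) : 0 < dl -> 0 < eta -> let al := speed_cost P c (2 * M + 3) X in
  exists W, forall w, (W <= w)%N -> exists B, [/\ measurable B, pr B <= eta & forall t, ~ B t ->
    (forall a e s, (0 < a <= e)%N -> (e <= (2 * M + 3) * a)%N -> (e <= J)%N -> (s <= J)%N ->
     (al * a%:R - dl) * w%:R <= passage c (fun i => bit (X^~ t) (s * w + i)%N) (field c (X^~ t)) (a * w) (e * w)) /\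
    (forall a e s, (0 < a <= e)%N -> (e <= (2 * M + 3) * a)%N -> (e <= J)%N -> (s <= J)%N ->
     (al * a%:R - dl) * w%:R <= passage c (fun i => bit (X^~ t) (s * w + i)%N) (field c (X^~ t) \o -%R) (a * w) (e * w))].
Proof.
move=> dl0 eta0 al; have K0 : (0 < 2 * M + 3)%N by rewrite addnS.
have e2 : 0 < eta / 2 by rewrite divr_gt0.
have [W1 H1] := passage_lower_uniform c0 eX K0 J dl0 e2.
have [W2 H2] := passage_lower_uniform c0 flip_eX K0 J dl0 e2.
have alE : speed_cost P c (2 * M + 3) (fun j => X (flip_index j)) = al := speed_cost_flip _ c0 eX.
exists (W1 + W2)%N => w wW.
have [B1 [mB1 pB1 HB1]] := H1 _ (leq_trans (leq_addr _ _) wW).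
have [B2 [mB2 pB2 HB2]] := H2 _ (leq_trans (leq_addl _ _) wW).
exists (B1 `|` B2); split; first exact: measurableU.
  by apply: le_trans (prU _ mB1 mB2) _; rewrite [leRHS]splitr lerD.
move=> t /not_orP[/HB1 h1 /HB2 h2]; split=> a e s ae eK eJ sJ.
  have := h1 a e s ae eK eJ sJ; rewrite /passage_at /pass.
  by rewrite (field_shift c (X^~ t)).
have := h2 a e s ae eK eJ sJ; rewrite /passage_at /pass alE.
by rewrite (field_shift c (fun j => X (flip_index j) t)).
Qed.

End CheapEdge.

Section Absorb.
Context (R : realType).

(** The value of [th] makes [1 - 8 * th] equal to [(s + s') / (2 * s')]. Dividing by this factor
    consumes half of the gap [s' - s], and the rounding error [r] another quarter. *)
Lemma absorb_error (a di n s s' N Z r : R) : let th := (s' - s) / (16 * s') in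
  0 <= a -> 0 < s -> s < s' -> 0 < N -> a + di * (n * (2^-1 - 4 * th)) <= Z + r ->
  Z < s * N -> r <= (s' - s) / 4 * N -> a + n / 2 * di < s' * N.
Proof.
move=> th a0 s0 ss N0 h Zs rN; have s'0 : 0 < s' := lt_trans s0 ss.
have ths : th * s' = (s' - s) / 16 by rewrite /th; field; rewrite gt_eqF.
have th0 : 0 <= th by rewrite /th divr_ge0 ?subr_ge0 ?(ltW ss)// mulr_ge0// ltW.
have p : 0 < 1 - 8 * th.
  by rewrite subr_gt0 -(ltr_pM2r s'0) -mulrA ths mul1r; lra.
rewrite -(ltr_pM2l p).
have -> : (1 - 8 * th) * (s' * N) = (s' - 8 * (th * s')) * N by ring.
rewrite ths; have ta : 0 <= th * a by rewrite mulr_ge0.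
have sN : 0 <= (s' - s) * N by rewrite mulr_ge0 ?(ltW N0)// subr_ge0 ltW.
have : (1 - 8 * th) * (a + n / 2 * di) = a + di * (n * (2^-1 - 4 * th)) - 8 * (th * a) by field.
by move=> ->; lra.
Qed.

Lemma truncn_mesh (dl N : R) (W : nat) : 0 < dl -> 2 / dl <= N -> 2 * W%:R / dl <= N ->
  let w := Num.truncn (dl * N) in [/\ (W <= w)%N, (0 < w)%N, w%:R <= dl * N & N <= 2 / dl * w%:R].
Proof.
move=> dl0 h1 h2 w.
have {}h1 : 2 <= dl * N by rewrite mulrC -ler_pdivrMr.
have {}h2 : 2 * W%:R <= dl * N by rewrite [leRHS]mulrC -ler_pdivrMr.
have x0 : 0 <= dl * N by lra.
have /andP[wx xw] := truncn_itv x0; rewrite -/w in wx xw.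
rewrite -natr1 in xw; split => //.
- by rewrite -(ler_nat R); lra.
- by rewrite -(ltr_nat R); lra.
- by rewrite mulrAC ler_pdivlMr// mulrC; lra.
Qed.

End Absorb.

(** * Lower bound: a cheap walk produces a cheap edge *)

Section Sandwich.
Context (R : realType) d (T : measurableType d) (P : probability T R) (c : R).
Local Notation pr := (pr P).
Context (X : int + int -> T -> R) (eX : iid_env P X) (Xc : forall x t, `|X (inl x) t| <= c).
Context (c0 : 0 < c) (k Ce : R) (k0 : 0 < k) (Ce0 : 0 < Ce).
Context (extreme_tail : asym (extreme_prob P c X) Ce k).
Context (fair : pr [set t | X (inr 0) t = 1] = 2^-1).

(** The witness is [l] itself, the minimizer of the discrepancy on the range. The four exceptional
    events concern the range, extreme triples, sign fluctuations and mesh passages. *)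
Lemma cheap_walk_cheap_edge (M : nat) (s s' eta : R) : 0 < s -> s < s' -> 0 < eta ->
  let al := speed_cost P c (2 * M + 3) X in
  \forall n \near \oo, exists B, [/\ measurable B, pr B <= eta & forall t, ~ B t -> forall g l,
    lazy_walk n g -> g 0%N = 0 -> is_ell c (field c (X^~ t)) n g l -> (tau_of n g l < M * `|l|)%N ->
    env_cost c X t n g < s * nscale k n ->
    exists l', al * (edge_dist l')%:R + n%:R / 2 * disc c X l' t < s' * nscale k n].
Proof.
move=> s_gt0 ss eta0 al.
have K0 : (0 < 2 * M + 3)%N by rewrite addnS.
have al0 : 0 <= al := speed_cost_ge0 c0 eX K0.
have s'0 : 0 < s' := lt_trans s_gt0 ss.
have gap : 0 < s' - s by rewrite subr_gt0.
have e4 : 0 < eta / 4 by rewrite divr_gt0.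
have eta4 : eta / 4 + eta / 4 + eta / 4 + eta / 4 <= eta by lra.
set th := (s' - s) / (16 * s').
have th0 : 0 < th by rewrite divr_gt0// mulr_gt0.
have c6 : 0 < 6 * c + 1 by rewrite addr_gt0// mulr_gt0.
pose dl := (s' - s) / (4 * (6 * c + 1)); have dl0 : 0 < dl by rewrite divr_gt0// mulr_gt0.
have [C C0 HR] := range_near eX Xc c0 k0 Ce0 extreme_tail s_gt0 e4.
have HX := no_three_extreme_near eX c0 k0 Ce0 extreme_tail (ltW C0) e4.
have [D D0 HD] := windows_event eX fair th0 e4.
have q0 : 0 <= M%:R * C * (2 / dl) by rewrite mulr_ge0 ?divr_ge0 ?mulr_ge0// ltW.
(* The mesh [w] is about [dl * nscale], so the time [M * (L + 1)] is at most [M * C * (2 / dl)]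
   meshes. This number does not depend on [n], as the union bound over passages requires; the extra
   3 covers the rounding. *)
have := archi_boundP q0; set J0 := Num.bound _ => hJ.
pose J := (J0 + 3)%N.
have [W HW] := passage_lower_near eX c0 M J ltr01 e4.
have DR : 0 < D%:R :> R by rewrite ltr0n.
have MCD : 0 < M%:R * C + D%:R by rewrite ltr_wpDl// mulr_ge0// ltW.
have c1 : 0 < th / (M%:R * C + D%:R) by rewrite divr_gt0.
have c2 : 0 < th / (D%:R * s) by rewrite divr_gt0// mulr_gt0.
have q1 : 0 < 5 / 6 :> R by rewrite divr_gt0.
have q2 : 0 < 1 / 6 :> R by rewrite divr_gt0.
near=> n; have n0 : (0 < n)%N by near: n; exists 1%N.
have N1 : 1 <= nscale k n by near: n; exact: near_nscale.
have N2 : 2 / dl <= nscale k n by near: n; exact: near_nscale.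
have N3 : 2 * W%:R / dl <= nscale k n by near: n; exact: near_nscale.
have u1 : uscale k n <= th / (M%:R * C + D%:R) by near: n; exact: near_uscale.
have u2 : uscale k n `^ (1 / 6) <= th / (D%:R * s) by near: n; exact: near_uscale_powR.
have u3 : uscale k n `^ (5 / 6) <= c by near: n; exact: near_uscale_powR.
have [L LC [B1 [mB1 pB1 HB1]]] : exists2 L : nat, L%:R + 1 <= C * nscale k n &
   exists B, [/\ measurable B, pr B <= eta / 4 &
    forall t, ~ B t -> forall g, lazy_walk n g -> g 0%N = 0 -> env_cost c X t n g < s * nscale k n ->
      forall i, (i <= n)%N -> `|g i| <= L%:Z] by near: n; exact: HR.
have [B2 [mB2 pB2 HB2]] : exists B, [/\ measurable B, pr B <= eta / 4 &
    forall t, ~ B t -> no_three_extreme c (field c (X^~ t)) (uscale k n `^ (5 / 6)) L].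
  have H : forall L : nat, L%:R <= C * nscale k n -> exists B, [/\ measurable B, pr B <= eta / 4 &
    forall t, ~ B t -> no_three_extreme c (field c (X^~ t)) (uscale k n `^ (5 / 6)) L] by near: n; exact: HX.
  by apply: H; apply: le_trans LC; rewrite lerDl.
have [B3 [mB3 pB3 HB3]] := HD n.
have [Ww w0 wN Nw] := truncn_mesh dl0 N2 N3; set w := Num.truncn _ in Ww w0 wN Nw.
have [B4 [mB4 pB4 HB4]] := HW w Ww.
have u0 := uscale_gt0 k n0; have NE := nscaleE k0 n0.
set N := nscale k n in N1 N2 N3 LC HB1 wN Nw NE *; set u := uscale k n in u0 u1 u2 u3 NE HB2 *.
have N0 : 0 < N := lt_le_trans ltr01 N1.
have [mB pB] := pr_setU4 mB1 mB2 mB3 mB4 pB1 pB2 pB3 pB4.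
exists (B1 `|` B2 `|` B3 `|` B4); split => //; first exact: le_trans pB eta4.
move=> t /not_orP[/not_orP[/not_orP[/HB1 h1 /HB2 h2] /HB3 h3] /HB4[h4 h5]] g l gl g0 gell tauM gc.
exists l.
have eps0 : 0 < u `^ (5 / 6) <= c by rewrite u3 powR_gt0.
have nR : 0 < n%:R :> R by rewrite ltr0n.
have MLn : (M * L + D)%N%:R <= th * n%:R.
  apply: (@le_trans _ _ ((M%:R * C + D%:R) * N)).
    rewrite natrD natrM [leRHS]mulrDl; apply: lerD; last by rewrite ler_peMr.
    by rewrite -mulrA ler_wpM2l//; apply: le_trans LC; rewrite lerDl.
  by rewrite NE mulrCA mulrC ler_pM2r// mulrC -ler_pdivlMr.
have Zeps : D%:R * (cost c (bit (X^~ t)) (field c (X^~ t)) 0 n g / u `^ (5 / 6)) <= th * n%:R.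
  have e0 : 0 < u `^ (5 / 6) by exact: powR_gt0.
  apply: (@le_trans _ _ (D%:R * (s * N / u `^ (5 / 6)))).
    by rewrite ler_pM2l// ler_pM2r ?invr_gt0//; exact: ltW.
  (* The share of windows with expensive steps is of order
     [nscale / (eps * n) = u / eps = u^(1/6)]. *)
  rewrite NE; have uE : u = u `^ (1 / 6) * u `^ (5 / 6).
    by rewrite -powRD ?(gt_eqF u0) ?implybT// -mulrDl (_ : (1 + 5) / 6 = 1 :> R) ?powRr1// ?ltW//; field.
  rewrite {1}uE !mulrA mulfK ?gt_eqF//.
  have -> : D%:R * s * n%:R * u `^ (1 / 6) = u `^ (1 / 6) * (D%:R * s) * n%:R by ring.
  by rewrite ler_pM2r// -ler_pdivlMr// mulr_gt0.
have MJ : (M * L.+1 + 3 * w <= J * w)%N.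
  rewrite /J mulnDl leq_add2r -(ler_nat R) !natrM -natr1.
  apply: (@le_trans _ _ (M%:R * (C * N))); first by rewrite ler_wpM2l.
  apply: (@le_trans _ _ (M%:R * (C * (2 / dl * w%:R)))).
    by rewrite ler_wpM2l// ler_wpM2l// ltW.
  rewrite (_ : M%:R * (C * (2 / dl * w%:R)) = M%:R * C * (2 / dl) * w%:R); last by rewrite !mulrA.
  by rewrite ler_wpM2r// ltW.
have := edge_cost_le (field_bound Xc t) gl g0 gell tauM D0 w0 eps0 al0 ler01 (h1 g gl g0 gc) h2 h3 MLn Zeps MJ h4 h5.
rewrite (discrepancy_field Xc) => /absorb_error; apply => //.
- by rewrite mulr_ge0.
- apply: (@le_trans _ _ ((6 * c + 1) * (dl * N))); first by rewrite ler_pM2l.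
  by rewrite mulrA /dl (_ : (6 * c + 1) * _ = (s' - s) / 4)//; field; rewrite gt_eqF.
Unshelve. all: by end_near. Qed.

End Sandwich.

(** * Upper bound: a cheap edge produces a cheap walk *)

Lemma edge_walk (R : realType) (c : R) (b : nat -> bool) (f : int -> R) (n L N1 s1 w J K : nat) (al e : R) :
  (forall x, `|f x| <= c) -> (0 < N1 <= s1)%N -> (s1 <= K * N1)%N -> (0 < w)%N ->
  (L <= J * (N1 * w))%N -> (K * L + N1 * w <= n)%N -> 0 <= al ->
  (forall r, (0 < r <= J)%N -> passage c b f (N1 * (r * w)) (s1 * (r * w)) <= al * (N1 * (r * w))%N%:R) ->
  `|(count (fun i => b i.+1) (iota 0 n))%:R - n%:R / 2| <= e ->
  exists g, [/\ lazy_walk n g, g 0%N = 0 &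
    cost c b f 0 n g <= al * L%:R + 2 * c * (N1 * w)%N%:R + discrepancy c f L%:Z * (n%:R / 2 + e)].
Proof.
move=> fc /andP[N10 Ns] sK w0 LJ Ln al0 H ke; set k := count _ _ in ke.
have c0 : 0 <= c by apply: le_trans (fc 0).
have Nw0 : (0 < N1 * w)%N by rewrite muln_gt0 N10.
(* The largest multiple of [N1 * w] below [L] is reached by a nearly optimal passage; the remaining
   fewer than [N1 * w] sites are crossed straight at cost at most [2 * c] each. *)
set r := (L %/ (N1 * w))%N.
have rJ : (r <= J)%N by rewrite -(leq_pmul2r Nw0); exact: leq_trans (leq_trunc_div _ _) LJ.
have rE : (N1 * (r * w) = r * (N1 * w))%N by rewrite mulnCA.
have NL : (N1 * (r * w) <= L)%N by rewrite rE leq_trunc_div.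
have LN : (L - N1 * (r * w) <= N1 * w)%N.
  by rewrite rE {1}(divn_eq L (N1 * w)) addKn ltnW// ltn_mod.
have sL : (s1 * (r * w) <= K * (N1 * (r * w)))%N by rewrite [leqRHS]mulnA leq_mul2r sK orbT.
have KL : (K * (N1 * (r * w)) <= K * L)%N by rewrite leq_mul2l NL orbT.
have feas : feasible (N1 * (r * w)) (s1 * (r * w)).
  rewrite /feasible leq_mul2r Ns orbT/= !muln_gt0 N10 w0 andbT/= !muln_eq0.
  by case: (r) => [|r'] //; rewrite orbT.
have tn : (s1 * (r * w) + (L - N1 * (r * w)) <= n)%N.
  by apply: leq_trans Ln; apply: leq_add => //; exact: leq_trans KL.
have [g [gl g0 gc]] := walk_to_edge b fc feas NL tn.
exists g; split => //; apply: le_trans gc _.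
have pas : passage c b f (N1 * (r * w)) (s1 * (r * w)) <= al * L%:R.
  have [r0|r0] := posnP r.
    by apply: le_trans (passage_le _ _ _ _ _) _; rewrite r0 mul0n muln0 mulr0 mulr_ge0.
  by apply: le_trans (H r _) _; rewrite ?r0// ler_wpM2l// ler_nat.
have d0 : 0 <= discrepancy c f L%:Z.
  rewrite /discrepancy; have := ler_normB (f (L%:Z + 1)) (f L%:Z).
  by have := fc (L%:Z + 1); have := fc L%:Z; lra.
rewrite -/k; have kn : (k <= n)%N by rewrite /k -[leqRHS](size_iota 0) count_size.
apply: lerD.
  by apply: lerD => //; rewrite ler_wpM2l ?ler_nat// mulr_ge0.
rewrite ler_wpM2l//; move: ke; rewrite ler_norml => /andP[h1 h2].
by rewrite /maxn; case: ltnP => _; rewrite ?natrB//; lra.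
Qed.

(** The excess slope, the straight stretch and the sign fluctuations are each allowed an eighth of
    the gap [(s - s') * N]; the first and third are measured against the two terms of the edge cost,
    both below [s' * N]. *)
Lemma absorb_upper (R : realType) (c al dl th s s' N L n di Q e : R) :
  0 < al -> 0 < s' -> s' < s -> 0 < N -> 0 < c -> 0 <= L -> 0 <= di -> 0 <= n ->
  dl = al * (s - s') / (8 * s') -> th = (s - s') / (32 * s') ->
  al * L + n / 2 * di < s' * N -> Q <= (s - s') / (16 * c) * N -> e <= 2 * th * n ->
  (al + dl) * L + 2 * c * Q + di * (n / 2 + e) < s * N.
Proof.
move=> al0 s'0 ss N0 c0 L0 di0 n0 dlE thE h QN en.
have gap : 0 < s - s' by rewrite subr_gt0.
have nd0 : 0 <= n / 2 * di by rewrite mulr_ge0// divr_ge0.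
have aL0 : 0 <= al * L by rewrite mulr_ge0// ltW.
have q0 : 0 <= (s - s') / (8 * s') by rewrite divr_ge0 ?mulr_ge0 ?ltW.
have h1 : dl * L <= (s - s') / 8 * N.
  rewrite (_ : dl * L = (s - s') / (8 * s') * (al * L)); last by rewrite dlE; field; rewrite gt_eqF.
  rewrite (_ : (s - s') / 8 * N = (s - s') / (8 * s') * (s' * N)); last by field; rewrite gt_eqF.
  by rewrite ler_wpM2l//; lra.
have h2 : 2 * c * Q <= (s - s') / 8 * N.
  rewrite (_ : (s - s') / 8 * N = 2 * c * ((s - s') / (16 * c) * N)); last by field; rewrite gt_eqF.
  by rewrite ler_wpM2l// mulr_ge0// ltW.
have h3 : di * e <= (s - s') / 8 * N.
  apply: (@le_trans _ _ (di * (2 * th * n))); first by rewrite ler_wpM2l.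
  rewrite (_ : di * (2 * th * n) = (s - s') / (8 * s') * (n / 2 * di)); last by rewrite thE; field; rewrite gt_eqF.
  rewrite (_ : (s - s') / 8 * N = (s - s') / (8 * s') * (s' * N)); last by field; rewrite gt_eqF.
  by rewrite ler_wpM2l//; lra.
have gN : 0 < (s - s') * N by rewrite mulr_gt0.
by rewrite mulrDl mulrDr (mulrC di (n / 2)); lra.
Qed.

Section UpperBound.
Context (R : realType) d (T : measurableType d) (P : probability T R) (c : R) (K : nat) (al : R).
Local Notation pr := (pr P).
Context (c0 : 0 < c) (k : R) (k0 : 0 < k) (K0 : (0 < K)%N) (al0 : 0 < al).

Lemma cheap_edge_near (X : int + int -> T -> R) (s' s eta : R) :
  iid_env P X -> (forall x t, `|X (inl x) t| <= c) -> pr [set t | X (inr 0) t = 1] = 2^-1 ->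
  speed_cost P c K X = al -> 0 < s' -> s' < s -> 0 < eta ->
  \forall n \near \oo, exists B, [/\ measurable B, pr B <= eta & forall t, ~ B t -> forall L : nat,
    al * L%:R + n%:R / 2 * disc c X L t < s' * nscale k n ->
    exists g, [/\ lazy_walk n g, g 0%N = 0 & env_cost c X t n g < s * nscale k n]].
Proof.
move=> eX Xc fair alE s'0 ss eta0.
have gap : 0 < s - s' by rewrite subr_gt0.
have e2 : 0 < eta / 2 by rewrite divr_gt0.
pose dl := al * (s - s') / (8 * s'); have dl0 : 0 < dl by rewrite divr_gt0 ?mulr_gt0.
pose th := (s - s') / (32 * s'); have th0 : 0 < th by rewrite divr_gt0 ?mulr_gt0.
pose ep := (s - s') / (16 * c); have ep0 : 0 < ep by rewrite divr_gt0 ?mulr_gt0.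
have q0 : 0 <= 2 * s' / (al * ep) by apply: divr_ge0; apply: mulr_ge0 => //; exact: ltW.
have := archi_boundP q0; set J := Num.bound _ => hJ.
have [D D0 HD] := windows_event eX fair th0 e2.
have [N1 [s1 [N1s s1K [W HW]]]] := passage_upper_uniform c0 eX K0 J dl0 e2.
rewrite alE in HW.
have N10 : (0 < N1)%N by case/andP: N1s.
have N1R : 0 < N1%:R :> R by rewrite ltr0n.
pose de := ep / N1%:R; have de0 : 0 < de by rewrite divr_gt0.
have DR : 0 < D%:R :> R by rewrite ltr0n.
have y1 : 0 < th / D%:R by rewrite divr_gt0.
have y2 : 0 < K%:R * s' / al + ep by rewrite ltr_wpDl//; apply: divr_ge0; [apply: mulr_ge0 => //|]; exact: ltW.
have y3 : 0 < (K%:R * s' / al + ep)^-1 by rewrite invr_gt0.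
near=> n; have n0 : (0 < n)%N by near: n; exists 1%N.
have N1' : 1 <= nscale k n by near: n; exact: near_nscale.
have N2 : 2 / de <= nscale k n by near: n; exact: near_nscale.
have N3 : 2 * W%:R / de <= nscale k n by near: n; exact: near_nscale.
have u1 : uscale k n <= (K%:R * s' / al + ep)^-1 by near: n; exact: near_uscale.
have u2 : uscale k n <= th / D%:R by near: n; exact: near_uscale.
have NE := nscaleE k0 n0.
have [B1 [mB1 pB1 HB1]] := HD n.
have [Ww w0 wN Nw] := truncn_mesh de0 N2 N3; set w := Num.truncn _ in Ww w0 wN Nw.
have [B2 [mB2 pB2 HB2]] := HW w Ww.
set N := nscale k n in N1' N2 N3 wN Nw NE *.
have N0 : 0 < N := lt_le_trans ltr01 N1'.
have nR : 0 < n%:R :> R by rewrite ltr0n.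
exists (B1 `|` B2); split; first exact: measurableU.
  by apply: le_trans (prU _ mB1 mB2) _; rewrite [leRHS]splitr lerD.
move=> t /not_orP[/HB1 h1 /HB2 h2] L h.
have NwN : (N1 * w)%N%:R <= ep * N.
  rewrite natrM -ler_pdivlMl//; apply: le_trans wN _.
  by rewrite /de mulrA [N1%:R^-1 * _]mulrC.
have Dn : D%:R <= th * n%:R.
  apply: (@le_trans _ _ (D%:R * N)); first by rewrite ler_peMr.
  rewrite NE mulrCA [th * _]mulrC ler_pM2l// mulrC.
  by rewrite -ler_pdivlMr.
have d0 : 0 <= disc c X L t by exact: disc_ge0.
have LN : L%:R <= s' / al * N.
  rewrite mulrAC ler_pdivlMr// mulrC; apply/ltW; apply: le_lt_trans h.
  by rewrite lerDl mulr_ge0// divr_ge0.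
have LJ : (L <= J * (N1 * w))%N.
  rewrite -(ler_nat R) !natrM; apply: (le_trans LN).
  apply: (@le_trans _ _ (s' / al * (2 / de * w%:R))); first by rewrite ler_wpM2l// divr_ge0// ltW.
  rewrite (_ : s' / al * (2 / de * w%:R) = 2 * s' / (al * ep) * (N1%:R * w%:R)); last first.
    by rewrite /de; field; rewrite !gt_eqF.
  by rewrite ler_wpM2r ?mulr_ge0// ltW.
have Ln : (K * L + N1 * w <= n)%N.
  rewrite -(ler_nat R) natrD natrM.
  apply: (@le_trans _ _ ((K%:R * s' / al + ep) * N)).
    rewrite mulrDl; apply: lerD => //; rewrite (_ : K%:R * s' / al * N = K%:R * (s' / al * N)); last by rewrite !mulrA.
    by rewrite ler_wpM2l.
  by rewrite NE mulrCA ler_piMr// mulrC -ler_pdivlMr// div1r.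
have ke : `|(count (fun i => bit (X^~ t) i.+1) (iota 0 n))%:R - n%:R / 2| <= 2 * th * n%:R.
  apply: le_trans (count_windows R (bit (X^~ t)) n D0) _.
  by rewrite (_ : 2 * th * n%:R = th * n%:R + th * n%:R) ?lerD//; ring.
have ad0 : 0 <= al + dl by rewrite addr_ge0 ?ltW.
have [g [gl g0 gc]] := edge_walk (field_bound Xc t) N1s s1K w0 LJ Ln ad0 h2 ke.
exists g; split => //; apply: le_lt_trans gc _; rewrite (discrepancy_field Xc).
exact: (absorb_upper al0 s'0 ss N0 c0 (ler0n _ _) d0 (ltW nR) erefl erefl h NwN (lexx _)).
Unshelve. all: by end_near. Qed.

Lemma cheap_edge_cheap_walk (X : int + int -> T -> R) (s' s eta : R) :
  iid_env P X -> (forall x t, `|X (inl x) t| <= c) -> pr [set t | X (inr 0) t = 1] = 2^-1 ->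
  speed_cost P c K X = al -> 0 < s' -> s' < s -> 0 < eta ->
  \forall n \near \oo, exists B, [/\ measurable B, pr B <= eta & forall t, ~ B t -> forall l,
    al * (edge_dist l)%:R + n%:R / 2 * disc c X l t < s' * nscale k n ->
    exists g, [/\ lazy_walk n g, g 0%N = 0 & env_cost c X t n g < s * nscale k n]].
Proof.
move=> eX Xc fair alE s'0 ss eta0; have e2 : 0 < eta / 2 by rewrite divr_gt0.
have H1 := cheap_edge_near eX Xc fair alE s'0 ss e2.
have H2 := @cheap_edge_near (fun j => X (flip_index j)) s' s _ (iid_env_flip eX)
  (fun x => Xc _) fair (etrans (speed_cost_flip _ c0 eX) alE) s'0 ss e2.
apply: filterS2 H1 H2 => n [B1 [mB1 pB1 HB1]] [B2 [mB2 pB2 HB2]].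
exists (B1 `|` B2); split; first exact: measurableU.
  by apply: le_trans (prU _ mB1 mB2) _; rewrite [leRHS]splitr lerD.
move=> t /not_orP[/HB1 h1 /HB2 h2] [m|m]; first exact: h1.
(* Reflection sends the edge from [-(m + 1)] to [-m] onto the edge from [m] to [m + 1], with the
   same discrepancy and distance, and walks are reflected back. *)
have e1 : Negz m + 1 = - m%:Z by rewrite NegzE -addn1 PoszD opprD addrNK.
have e3 : Negz m = - (m%:Z + 1) by rewrite NegzE -addn1 PoszD.
have dE : disc c X (Negz m) t = disc c (fun j => X (flip_index j)) m t.
  by rewrite /disc /discrepancy /= e1 e3 distrC.
rewrite dE => /h2[g [gl g0 gc]].
exists (fun i => - g i); split; [exact: lazy_walkN|by rewrite g0 oppr0|].
rewrite /env_cost -(cost_opp c); apply: le_lt_trans gc; rewrite le_eqVlt; apply/orP; left; apply/eqP.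
by apply: eq_cost => i _; rewrite opprK.
Qed.

End UpperBound.

(** * The environment of the theorem *)

Section ClippedEnvironment.
Context (R : realType) d (T : measurableType d) (P : probability T R) (c q k : R) (rho : R -> R).
Context (F B : int -> T -> R).
Local Notation pr := (pr P).
Context (c0 : 0 < c) (q0 : 0 < q) (k0 : 0 < k) (mrho : measurable_fun setT rho)
  (rho_even : forall x, rho (- x) = rho x)
  (rho_cont : forall x, - c < x < c -> {for x, continuous rho})
  (rho_pos : forall x, - c < x < c -> 0 < rho x)
  (rho_out : forall x, ~ (- c < x < c) -> rho x = 0)
  (rho_lim : (fun x => rho x / (c - x) `^ (k - 1)) @ c^'- --> q)
  (mF : forall x, measurable_fun setT (F x)) (mB : forall i, measurable_fun setT (B i))
  (F_law : forall x A, measurable A ->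
     P (F x @^-1` A) = (\int[lebesgue_measure]_(y in A) (rho y)%:E)%E)
  (B_law : forall i, P [set w | B i w = 1] = (1 / 2)%:E /\ P [set w | B i w = -1] = (1 / 2)%:E)
  (FB_indep : mutually_independent P
     (fun j : int + int => match j with inl x => F x | inr i => B i end)).

Let clip (y : R) : R := Num.max (- c) (Num.min c y).

(* Agrees almost surely with the given environment, and is bounded everywhere. *)
Definition clipped_env (j : int + int) : T -> R :=
  match j with inl x => clip \o F x | inr i => B i end.

Lemma measurable_clip : measurable_fun setT clip.
Proof. by apply: measurable_maxr; [|apply: measurable_minr]; [exact: measurable_cst..|exact: measurable_id]. Qed.

Lemma clipped_env_bound x t : `|clipped_env (inl x) t| <= c.
Proof. by rewrite /= /clip ler_norml le_max lexx/= ge_max ge_min lexx andbT (le_trans _ (ltW c0))// oppr_le0 ltW. Qed.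

Let measurable_preimage (Y : T -> R) A : measurable_fun setT Y -> measurable A -> measurable (Y @^-1` A).
Proof. by move=> mY mA; rewrite -[X in measurable X]setTI; exact: mY. Qed.

Lemma measurable_clipped_env j : measurable_fun setT (clipped_env j).
Proof. by case: j => [x|i] //=; apply: measurableT_comp => //; exact: measurable_clip. Qed.

Lemma clipped_env_law x A : measurable A ->
  P (clipped_env (inl x) @^-1` A) = (\int[lebesgue_measure]_(y in A) (rho y)%:E)%E.
Proof.
move=> mA; rewrite -(F_law x)//.
have mcA : measurable (clip @^-1` A) by rewrite -[X in measurable X]setTI; exact: measurable_clip.
have id y : `]- c, c[%classic y -> clip y = y.
  by rewrite /= in_itv/= => /andP[h1 h2]; rewrite /clip (min_idPr (ltW h2)) (max_idPr (ltW h1)).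
have := @law_eq_null _ _ _ P _ (mF x) (clip @^-1` A) A (~` `]- c, c[) mcA mA.
have m1 : measurable (clipped_env (inl x) @^-1` A) by exact: measurable_preimage (measurable_clipped_env _) mA.
have m2 : measurable (F x @^-1` A) by exact: measurable_preimage.
rewrite /pr => H; rewrite -(probability_fine P m1) -(probability_fine P m2).
congr (_%:E); apply: H; first exact: measurableC.
- exact: (law_outside rho_out (F_law x)).
- move=> y /= yA; have [yc|yc] := pselect (`]- c, c[%classic y); [left|by right].
  by rewrite -(id _ yc).
- move=> y yA; have [yc|yc] := pselect (`]- c, c[%classic y); [left|by right].
  by rewrite /= (id _ yc).
Qed.

Lemma sign_outside i : P (B i @^-1` (~` ([set 1] `|` [set -1]))) = 0%E.
Proof.
have m1 (y : R) : measurable (B i @^-1` [set y]) by exact: measurable_preimage.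
rewrite -preimage_setC probability_setC; last by rewrite preimage_setU; exact: measurableU.
have b1 : P (B i @^-1` [set 1]) = (1 / 2)%:E := (B_law i).1.
have b2 : P (B i @^-1` [set -1]) = (1 / 2)%:E := (B_law i).2.
have -> : P (B i @^-1` ([set 1] `|` [set -1])) = 1%E.
  rewrite preimage_setU measureU//; last first.
    by apply/seteqP; split=> // w [/= -> /eqP]; rewrite -subr_eq0 opprK -(natrD _ 1 1) pnatr_eq0.
  transitivity ((1 / 2)%:E + (1 / 2)%:E : \bar R)%E; first exact: (f_equal2 (@adde R) b1 b2).
  by rewrite -EFinD; congr (_%:E); field.
by rewrite subee.
Qed.

(** The two given point masses already exhaust the probability, so they determine the whole law;
    this yields equality in law of the signs, as [iid_env] demands. *)
Lemma sign_law i A : measurable A ->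
  P (B i @^-1` A) = ((\1_A 1 + \1_A (-1)) / 2)%:E :> \bar R.
Proof.
move=> mA; have mp A' : measurable A' -> measurable (B i @^-1` A') by exact: measurable_preimage.
have one (y : R) : P [set w | B i w = y] = (1 / 2)%:E -> P (B i @^-1` (A `&` [set y])) = (\1_A y / 2)%:E.
  move=> By; rewrite indicE; have [yA|yA] := boolP (y \in A).
    rewrite -By; congr (P _); apply/seteqP; split=> w /= => [[]//|->]; split=> //; exact: set_mem.
  rewrite mul0r (_ : _ @^-1` _ = set0) ?measure0//; apply/seteqP; split=> // w /= [wA wy].
  by move: yA; rewrite -wy => /negP; apply; exact: mem_set.
have mS : measurable (A `&` [set 1 : R]) /\ measurable (A `&` [set -1 : R]).
  by split; apply: measurableI.
have mC : measurable (A `&` ~` ([set 1] `|` [set -1] : set R)).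
  by apply: measurableI => //; apply: measurableC; exact: measurableU.
rewrite (_ : B i @^-1` A = (B i @^-1` (A `&` [set 1]) `|` B i @^-1` (A `&` [set -1])) `|`
   B i @^-1` (A `&` ~` ([set 1] `|` [set -1]))); last first.
  rewrite -!preimage_setU -!setIUr setUv setIT//.
rewrite measureU0; [|by apply: measurableU; apply: mp; case: mS|exact: mp|]; last first.
  apply/eqP; rewrite eq_le measure_ge0 andbT -(sign_outside i).
  apply: le_measure; rewrite ?inE; [exact: mp|apply: mp|by apply: preimage_subset => y []].
  by apply: measurableC; exact: measurableU.
rewrite measureU; [|by apply: mp; case: mS|by apply: mp; case: mS|]; last first.
  apply/seteqP; split=> // w [[_ /= ->] [_ /eqP]].
  by rewrite -subr_eq0 opprK -(natrD _ 1 1) pnatr_eq0.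
by rewrite mulrDl EFinD; exact: (f_equal2 (@adde R) (one _ (B_law i).1) (one _ (B_law i).2)).
Qed.

Lemma iid_clipped_env : iid_env P clipped_env.
Proof.
split.
- move=> S uS A mA.
  pose A' (j : int + int) := match j with inl _ => clip @^-1` A j | inr _ => A j end.
  have mA' j : measurable (A' j).
    by case: j => x /=; [rewrite -[X in measurable X]setTI; exact: measurable_clip|exact: mA].
  have := FB_indep uS mA'; rewrite (_ : \bigcap_(i in _) _ =
    \bigcap_(i in [set` S]) (clipped_env i @^-1` A i)); last by apply: eq_bigcapr => -[].
  by move=> ->; apply: eq_bigr => -[].
- exact: measurable_clipped_env.
- by move=> x A mA; rewrite !clipped_env_law.
- by move=> i A mA; rewrite !sign_law.
Qed.

Lemma clipped_env_fair : pr [set t | clipped_env (inr 0) t = 1] = 2^-1.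
Proof. by rewrite /pr (B_law 0).1 /= div1r. Qed.

(** Countably many null events, one per site and one per sign, are joined through an enumeration of
    the index type. Off their union the clipped environment is the original one. *)
Lemma atypical_null : exists O, [/\ measurable O, pr O = 0 & forall t, ~ O t ->
  (forall x, F x t = clipped_env (inl x) t) /\ (forall i, B i t = 1 \/ B i t = -1)].
Proof.
pose bad (j : int + int) := match j with inl x => F x @^-1` (~` `]- c, c[)
  | inr i => B i @^-1` (~` ([set 1] `|` [set -1])) end.
have mbad j : measurable (bad j).
  by case: j => x; apply: measurable_preimage => //; apply: measurableC => //; exact: measurableU.
have bad0 j : P (bad j) = 0%E.
  by case: j => x; [exact: (law_outside rho_out (F_law x))|exact: sign_outside].
pose G n := if unpickle n is Some j then bad j else set0.
have mG n : measurable (G n) by rewrite /G; case: unpickle.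
have mO : measurable (\bigcup_n G n) by exact: bigcupT_measurable.
exists (\bigcup_n G n); split => //.
  rewrite /pr (_ : P _ = 0%E)//; apply/negligibleP => //; apply: negligible_bigcup => n.
  by apply/negligibleP; rewrite ?/G; case: unpickle => //; rewrite measure0.
move=> t Ot; have good j : ~ bad j t by move=> bj; apply: Ot; exists (pickle j) => //; rewrite /G pickleK.
split=> [x|i]; last by have /contrapT[] := good (inr i); [left|right].
have /contrapT := good (inl x); rewrite /= in_itv/= => /andP[h1 h2].
by rewrite /clip (min_idPr (ltW h2)) (max_idPr (ltW h1)).
Qed.

Lemma clipped_tails x :
  asym (fun s => pr (clipped_env (inl x) @^-1` `]c - s, +oo[)) (q / k) k /\
  asym (fun s => pr (clipped_env (inl x) @^-1` `]-oo, - (c - s)[)) (q / k) k.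
Proof.
exact: (tails_asym c0 q0 k0 mrho rho_even rho_cont rho_pos rho_out rho_lim
  (measurable_clipped_env (inl x)) (clipped_env_law x)).
Qed.

Lemma clipped_extreme : asym (extreme_prob P c clipped_env) (q / k + q / k) k.
Proof.
have [t1 t2] := clipped_tails 0; move=> e e0.
have [dl dl0 H] := asymD t1 t2 e0.
exists (Num.min dl c); first by rewrite lt_min dl0.
move=> s /andP[s0]; rewrite lt_min => /andP[sd sc].
have := H s; rewrite s0 sd => /(_ isT); congr (`|_ - _| <= _).
rewrite -pr_disjointU.
- rewrite /extreme_prob; congr pr; apply/seteqP; split=> t /=; rewrite !in_itv/= andbT.
    by case=> h; rewrite ltr_normr; apply/orP; [left|right; rewrite ltrNr].
  by rewrite ltr_normr => /orP[h|h]; [left|right; rewrite ltrNr].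
- exact: (measurable_preimage (measurable_clipped_env (inl 0))).
- exact: (measurable_preimage (measurable_clipped_env (inl 0))).
- apply/disj_set2P/seteqP; split=> // t /= []; rewrite !in_itv/= andbT; lra.
Qed.

Lemma clipped_disc : exists2 K, 0 < K &
  asym (fun e => pr [set t | disc c clipped_env 0 t < e]) K (2 * k).
Proof.
have qk : 0 < q / k by rewrite divr_gt0.
apply: (disc_asym c0 qk k0 (measurable_clipped_env (inl 0)) (measurable_clipped_env (inl 1))).
  move=> A A' mA mA'; have [iX _ _ _] := iid_clipped_env.
  pose A2 (j : int + int) := if j == inl 0 then A else A'.
  have mA2 j : measurable (A2 j) by rewrite /A2; case: ifP.
  have := iX [:: inl 0; inl 1] isT A2 mA2; rewrite !big_cons big_nil mulr1 /A2 /= => E.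
  rewrite -E; congr pr; apply/seteqP; split=> [t [h1 h2] j|t h].
    by rewrite /= !inE => /orP[]/eqP->.
  by split; [apply: (h (inl 0))|apply: (h (inl 1))]; rewrite /= !inE.
by move=> Z [->|->]; exact: clipped_tails.
Qed.

End ClippedEnvironment.

(** * Homogeneity and continuity of the intensity *)

Section Intensity.
Context (R : realType) (k Kd al : R) (k0 : 0 < k) (Kd0 : 0 < Kd) (al0 : 0 < al).
Local Notation I := (intensity k Kd al).

Lemma intensity_gt0 s : 0 < s -> 0 < I s.
Proof.
move=> s0; have p1 : 0 < 2 * k + 1 by rewrite addr_gt0// mulr_gt0.
have s2 : 0 < (2 * s) `^ (2 * k) by rewrite powR_gt0// mulr_gt0.
apply: divr_gt0 => //; apply: mulr_gt0; first exact: mulr_gt0.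
by apply: divr_gt0 => //; exact: mulr_gt0.
Qed.

Lemma intensity_power s : 0 < s -> I s = I 1 * s `^ (2 * k + 1).
Proof.
move=> s0; rewrite /intensity !mulr1 powRM ?(ltW s0)// powRD ?(gt_eqF s0) ?implybT//.
have p1 : 2 * k + 1 != 0 by rewrite gt_eqF// addr_gt0// mulr_gt0.
by rewrite powRr1 ?(ltW s0)//; field; rewrite p1 gt_eqF.
Qed.

(** By homogeneity, rescaling [s] by [x^(1/(2k+1))] multiplies the intensity by [x]; taking
    [x = 1 - e] and [x = 1 + e] moves it by [e * I s] at most. *)
Lemma intensity_near s eta : 0 < s -> 0 < eta -> exists s1 s2, [/\ 0 < s1 < s, s < s2,
  `|expR (- I s1) - expR (- I s)| <= eta & `|expR (- I s2) - expR (- I s)| <= eta].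
Proof.
move=> s0 eta0; have p1 : 0 < 2 * k + 1 by rewrite addr_gt0// mulr_gt0.
have I0 := intensity_gt0 s0.
pose e := Num.min (1 / 2) (eta / I s).
have e0 : 0 < e by rewrite lt_min; apply/andP; split; exact: divr_gt0.
have e1 : e <= 1 / 2 by rewrite ge_min lexx.
have eI : I s * e <= eta by rewrite mulrC -ler_pdivlMr// ge_min lexx orbT.
pose sc x := s * x `^ (2 * k + 1)^-1.
have sc0 x : 0 < x -> 0 < sc x by move=> x0; rewrite mulr_gt0// powR_gt0.
have scE x : 0 < x -> I (sc x) = I s * x.
  move=> x0; rewrite intensity_power ?sc0// [in RHS]intensity_power// /sc powRM ?(ltW s0) ?powR_ge0//.
  by rewrite -powRrM mulVf ?gt_eqF// powRr1 ?(ltW x0)// mulrA.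
have mono x y : 0 < x -> x < y -> sc x < sc y.
  move=> x0 xy; rewrite ltr_pM2l//; apply: gt0_ltr_powR => //; rewrite ?invr_gt0//.
    by rewrite nnegrE ltW.
  by rewrite nnegrE ltW// (lt_trans x0).
have sc1 : sc 1 = s by rewrite /sc powR1 mulr1.
have close x : 0 < x -> `|x - 1| <= e -> `|expR (- I (sc x)) - expR (- I s)| <= eta.
  move=> x0 xe; apply: le_trans (expRN_lipschitz _ _) _; [exact/ltW/intensity_gt0/sc0|exact: ltW|].
  rewrite scE// -[X in _ - X]mulr1 -mulrBr normrM gtr0_norm//; apply: le_trans eI.
  by rewrite ler_wpM2l// ltW.
have x1 : 0 < 1 - e by lra.
have x2 : 0 < 1 + e by lra.
exists (sc (1 - e)), (sc (1 + e)); split.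
- by rewrite sc0//= -[ltRHS]sc1 mono//; lra.
- by rewrite -[ltLHS]sc1 mono//; lra.
- by apply: close => //; rewrite (_ : 1 - e - 1 = - e) ?normrN ?gtr0_norm//; ring.
- by apply: close => //; rewrite (_ : 1 + e - 1 = e) ?gtr0_norm//; ring.
Qed.

End Intensity.

Lemma cost_action (R : realType) (c : R) n (B F : int -> R) g : (forall i, B i = 1 \/ B i = -1) ->
  cost c (fun i => B i%:Z == 1) F 0 n g = c * n%:R + action n B F g.
Proof.
move=> Bs; rewrite /action big_add1 /= /cost big_split/= sumr_const_nat subn0 mulr_natr; congr (_ + _).
apply: eq_bigr => i _; have [->|->] := Bs i.+1; first by rewrite eqxx mul1r.
by rewrite -subr_eq0 -opprD oppr_eq0 -(natrD _ 1 1) pnatr_eq0 mulN1r.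
Qed.

(** The selection of the minimizer need not be measurable, but its action is a minimum over finitely
    many coded walks. Subtracting the action [a] of a reference walk makes the default 0 of the
    minimum harmless, as that walk attains it. *)
Lemma measurable_min_action (R : realType) d (T : measurableType d) (F B : int -> T -> R) n
  (g : T -> nat -> int) : (forall x, measurable_fun setT (F x)) -> (forall i, measurable_fun setT (B i)) ->
  (forall w, is_minimizer n (B^~ w) (F^~ w) (g w)) ->
  measurable_fun setT (fun w => action n (B^~ w) (F^~ w) (g w)).
Proof.
move=> mF mB gmin.
have mA g' : measurable_fun setT (fun w => action n (B^~ w) (F^~ w) g').
  rewrite /action; apply: measurable_sum => i; exact: measurable_funM.
pose a w := action n (B^~ w) (F^~ w) (walk_of ([ffun=> ord0] : {ffun 'I_n -> 'I_3})).
apply: (@eq_measurable_fun _ _ _ _ _ (fun w => a w +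
  \big[Num.min/0]_(h : {ffun 'I_n -> 'I_3}) (action n (B^~ w) (F^~ w) (walk_of h) - a w))); last first.
  have ma : measurable_fun setT a by exact: mA.
  apply: measurable_funD => //; apply: (@measurable_bigmin R _ T) => h _.
  by apply: measurable_funB => //; exact: mA.
move=> w _; have [gl g0 gm] := gmin w.
have walk_ok (h : {ffun 'I_n -> 'I_3}) : action n (B^~ w) (F^~ w) (g w) <= action n (B^~ w) (F^~ w) (walk_of h).
  by apply: gm; [exact: walk_of_lazy|exact: walk_of0].
have gE : action n (B^~ w) (F^~ w) (g w) = action n (B^~ w) (F^~ w) (walk_of (incr n (g w))).
  by apply: eq_big_nat => i /andP[_ iN]; rewrite incrK.
apply/le_anti/andP; split.
  rewrite -lerBrDl gE; exact: bigmin_le_cond.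
rewrite -lerBlDl; apply/bigmin_geP; split=> [|h _]; first by rewrite subr_le0; exact: walk_ok.
by rewrite lerD2r.
Qed.

Section ProbabilityBounds.
Context (R : realType) d (T : measurableType d) (P : probability T R) (c : R).
Local Notation pr := (pr P).

Lemma pr_le_except A E D : measurable A -> measurable E -> measurable D ->
  A `<=` E `|` D -> pr A <= pr E + pr D.
Proof.
move=> mA mE mD AED; apply: le_trans (prU _ mE mD).
by apply: pr_le => //; exact: measurableU.
Qed.

Lemma speed_cost_positive (X : int + int -> T -> R) (k Ce : R) K : 0 < c -> iid_env P X -> (0 < K)%N ->
  0 < k -> 0 < Ce -> asym (extreme_prob P c X) Ce k -> 0 < speed_cost P c K X.
Proof.
move=> c0 eX K0 k0 Ce0 ext.
have [s s0 hs] := extreme_small k0 Ce0 ext (divr_gt0 ltr01 (ltr0Sn R 1)).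
have s1 : 0 < Num.min s (c / 2) < c.
  rewrite lt_min s0 divr_gt0//= gt_min; apply/orP; right; lra.
apply: (speed_cost_gt0 c0 eX K0 s1); set s' := Num.min _ _ in s1 *.
have mE x : measurable [set t | c - x < `|X (inl 0) t|] by exact: (measurable_extreme c eX).
have -> : [set w | `|X (inl 0) w| <= c - s'] = ~` [set t | c - s' < `|X (inl 0) t|].
  by apply/seteqP; split=> t /=; rewrite leNgt => /negP.
rewrite prC// subr_gt0; apply: (@le_lt_trans _ _ (1 / 2)); last by lra.
apply: le_trans hs; apply: pr_le => // t /=; apply: le_lt_trans.
by rewrite lerD2l lerN2 ge_min lexx.
Qed.

End ProbabilityBounds.

(** * The tail of the minimal cost *)

Section MinimalCost.
Context (R : realType) d (T : measurableType d) (P : probability T R) (c : R).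
Local Notation pr := (pr P).
Context (X : int + int -> T -> R) (eX : iid_env P X) (Xc : forall x t, `|X (inl x) t| <= c).
Context (c0 : 0 < c) (k Kd Ce : R) (k0 : 0 < k) (Kd0 : 0 < Kd) (Ce0 : 0 < Ce).
Context (disc_tail : asym (fun e => pr [set t | disc c X 0 t < e]) Kd (2 * k)).
Context (extreme_tail : asym (extreme_prob P c X) Ce k).
Context (fair : pr [set t | X (inr 0) t = 1] = 2^-1).
Context (M : nat) (gb : nat -> T -> nat -> int) (l : nat -> T -> int) (O : set T) (A : nat -> set T).
Let al := speed_cost P c (2 * M + 3) X.
Let min_cost n t := env_cost c X t n (gb n t).
Context (mO : measurable O) (pO : pr O = 0) (mA : forall n, measurable (A n))
  (pA : forall eta, 0 < eta -> \forall n \near \oo, pr (~` A n) <= eta)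
  (gb_walk : forall n t, lazy_walk n (gb n t) /\ gb n t 0%N = 0)
  (gb_min : forall n t g, ~ O t -> lazy_walk n g -> g 0%N = 0 -> min_cost n t <= env_cost c X t n g)
  (gb_ell : forall n t, ~ O t -> is_ell c (field c (X^~ t)) n (gb n t) (l n t))
  (gb_tau : forall n t, A n t -> (tau_of n (gb n t) (l n t) < M * `|l n t|)%N).

(** The event is squeezed between the absence of edges cheaper at level [s2 > s] and at level
    [s1 < s]; the gaps absorb the comparison errors, and continuity of the intensity closes them.
    [E] is any measurable event that agrees with the tail event off the null set [O], because in the
    application it is written in the original, unclipped environment. *)
Lemma minimal_cost_tail s eta : 0 < s -> 0 < eta ->
  \forall n \near \oo, forall E, measurable E ->
    (forall t, ~ O t -> E t <-> s * nscale k n <= min_cost n t) ->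
    `|pr E - expR (- intensity k Kd al s)| <= eta.
Proof.
move=> s0 eta0; have K0 : (0 < 2 * M + 3)%N by rewrite addnS.
have al0 : 0 < al := speed_cost_positive c0 eX K0 k0 Ce0 extreme_tail.
have e4 : 0 < eta / 4 by rewrite divr_gt0.
have [s1 [s2 [/andP[s10 s1s] ss2 c1 c2]]] := intensity_near k0 Kd0 al0 s0 e4.
have s20 : 0 < s2 := lt_trans s0 ss2.
have poisson r : 0 < r -> \forall n \near \oo, measurable (no_cheap_edge c X k al n r) /\
    `|pr (no_cheap_edge c X k al n r) - expR (- intensity k Kd al r)| <= eta / 4.
  by move=> r0; have [n0 H] := poisson_limit eX Xc c0 k0 Kd0 al0 Ce0 disc_tail extreme_tail r0 e4; exists n0.
have H3 := cheap_walk_cheap_edge eX Xc c0 k0 Ce0 extreme_tail fair M s0 ss2 e4.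
have H4 := cheap_edge_cheap_walk c0 k0 K0 al0 eX Xc fair erefl s10 s1s e4.
apply: filterS3 (filterI (poisson _ s10) (poisson _ s20)) (filterI H3 H4) (pA e4).
move=> n [[mQ1 Q1] [mQ2 Q2]] [[B3 [mB3 pB3 HB3]] [B4 [mB4 pB4 HB4]]] pAn E mE HE.
have mAn : measurable (~` A n) by exact: measurableC.
have lower : pr (no_cheap_edge c X k al n s2) <= pr E + (eta / 4 + eta / 4).
  apply: le_trans (@pr_le_except _ _ _ _ _ E (O `|` (B3 `|` ~` A n)) mQ2 mE _ _) _.
  - by apply: measurableU => //; exact: measurableU.
  - move=> t Qt; apply: contrapT => /not_orP[Et /not_orP[Ot /not_orP[B3t /contrapT At]]].
    have lt : min_cost n t < s * nscale k n by rewrite ltNge; apply/negP => h; apply: Et; exact/(HE t Ot).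
    have [gl g0] := gb_walk n t.
    have [l' hl'] := HB3 t B3t _ _ gl g0 (gb_ell n Ot) (gb_tau At) lt.
    by have := Qt l'; rewrite leNgt hl'.
  - rewrite lerD2l; apply: le_trans (prU _ mO (measurableU _ _ mB3 mAn)) _; rewrite pO add0r.
    by apply: le_trans (prU _ mB3 mAn) _; exact: lerD.
have upper : pr E <= pr (no_cheap_edge c X k al n s1) + eta / 4.
  apply: le_trans (@pr_le_except _ _ _ _ _ _ (O `|` B4) mE mQ1 _ _) _.
  - exact: measurableU.
  - move=> t Et; apply: contrapT => /not_orP[Qt /not_orP[Ot B4t]].
    apply: Qt => l'; rewrite leNgt; apply/negP => /(HB4 t B4t)[g [gl g0 gc]].
    by have := lt_le_trans gc (le_trans ((HE t Ot).1 Et) (gb_min Ot gl g0)); rewrite ltxx.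
  - by rewrite lerD2l; apply: le_trans (prU _ mO mB4) _; rewrite pO add0r.
move: lower upper Q1 Q2 c1 c2; move: (pr (no_cheap_edge _ _ _ _ _ s1)) (pr (no_cheap_edge _ _ _ _ _ s2)) (pr E).
move: (expR (- intensity _ _ _ s)) (expR (- intensity _ _ _ s1)) (expR (- intensity _ _ _ s2)) => x x1 x2 y1 y2 y.
rewrite !ler_norml => lower upper /andP[? ?] /andP[? ?] /andP[? ?] /andP[? ?]; apply/andP; split; lra.
Qed.

End MinimalCost.

Theorem theorem2p6 (R : realType) (d : measure_display) (T : measurableType d)
    (P : probability T R) (c q kappa : R) (rho : R -> R)
    (F B : int -> T -> R)
    (gbar : nat -> T -> nat -> int) (ell : nat -> T -> int) :
  0 < c -> 0 < q -> -1 < kappa ->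
  (* the density rho *)
  measurable_fun setT rho ->
  (forall x : R, rho (- x) = rho x) ->
  (forall x : R, - c < x < c -> {for x, continuous rho}) ->
  (forall x : R, - c < x < c -> 0 < rho x) ->
  (forall x : R, ~ (- c < x < c) -> rho x = 0) ->
  (fun x => rho x / (c - x) `^ kappa) @ c^'- --> q ->
  (* the environment F and the signs B *)
  (forall x, measurable_fun setT (F x)) ->
  (forall i, measurable_fun setT (B i)) ->
  (forall x (A : set R), measurable A ->
     P (F x @^-1` A) = (\int[lebesgue_measure]_(y in A) (rho y)%:E)%E) ->
  (forall i, P [set w | B i w = 1] = (1 / 2)%:E /\ P [set w | B i w = -1] = (1 / 2)%:E) ->
  mutually_independent P
    (fun j : int + int => match j with inl x => F x | inr i => B i end) ->
  (* bar gamma_n is a minimizer, ell_n an argmin of the discrepancy on its range *)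
  (forall n w, is_minimizer n (fun i => B i w) (fun x => F x w) (gbar n w)) ->
  (forall n w, is_ell c (fun x => F x w) n (gbar n w) (ell n w)) ->
  (* Assumption *)
  (exists M : R, 1 < M /\
     (forall n, measurable [set w | (tau_of n (gbar n w) (ell n w))%:R < M * `|(ell n w)%:~R|]) /\
     (fun n => P [set w | (tau_of n (gbar n w) (ell n w))%:R < M * `|(ell n w)%:~R|])
       @ \oo --> 1%E) ->
  exists2 h : R, 0 < h &
    forall t : R, 0 <= t ->
      (fun n : nat => P [set w | t <= (c * n%:R + action n (fun i => B i w) (fun x => F x w) (gbar n w))
                                   / (h * n%:R `^ ((2 * kappa + 2) / (2 * kappa + 3)))])
        @ \oo --> (expR (- t `^ (2 * kappa + 3)))%:E.
Proof.
move=> c0 q0 kap mrho rho_even rho_cont rho_pos rho_out rho_lim mF mB F_law B_law FB_indep.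
move=> gmin gell [M [M1 [mA cA]]].
pose k := kappa + 1.
have k0 : 0 < k by rewrite /k; lra.
have kE : k - 1 = kappa by rewrite /k; ring.
have e1 : 2 * kappa + 2 = 2 * k by rewrite /k; ring.
have e2 : 2 * kappa + 3 = 2 * k + 1 by rewrite /k; ring.
have p0 : 0 < 2 * k + 1 by lra.
rewrite e1 e2; rewrite -kE in rho_lim.
pose X := clipped_env c F B.
have eX : iid_env P X := iid_clipped_env rho_out mF mB F_law B_law FB_indep.
have Xc : forall x t, `|X (inl x) t| <= c := clipped_env_bound F B c0.
have fair : pr P [set t | X (inr 0) t = 1] = 2^-1 := clipped_env_fair c F B_law.
have [Kd Kd0 disc_tail] := clipped_disc c0 q0 k0 mrho rho_even rho_cont rho_pos rho_out rho_lim mF mB F_law B_law FB_indep.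
have ext : asym (extreme_prob P c X) (q / k + q / k) k := @clipped_extreme _ _ _ P _ _ _ _ _ B c0 q0 k0 mrho rho_even rho_cont rho_pos rho_out rho_lim mF mB F_law.
have Ce0 : 0 < q / k + q / k by rewrite addr_gt0// divr_gt0.
have [D [mD pD HD]] := atypical_null rho_out mF mB F_law B_law.
have fieldE w : ~ D w -> field c (X^~ w) = F^~ w.
  by move=> /HD[h _]; apply/funext => x; rewrite (field_id Xc) h.
have costE n w g : ~ D w -> env_cost c X w n g = c * n%:R + action n (B^~ w) (F^~ w) g.
  move=> Dw; have [_ Bs] := HD w Dw.
  by rewrite /env_cost fieldE// -(cost_action _ _ _ _ Bs).
(* The walk estimates count steps in natural numbers; enlarging [M] only weakens the Assumption. *)
pose M' := Num.bound M; have MM' : M <= M'%:R by apply/ltW/archi_boundP; lra.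
pose A n := [set w | (tau_of n (gbar n w) (ell n w))%:R < M * `|(ell n w)%:~R| :> R].
have pA eta : 0 < eta -> \forall n \near \oo, pr P (~` A n) <= eta.
  move=> eta0; have /fine_cvgP[_ /cvgrPdist_le /(_ eta eta0)] := cA.
  apply: filterS => n; rewrite (prC _ (mA n)) => /(le_trans (ler_norm _)); exact.
have gtau n w : A n w -> (tau_of n (gbar n w) (ell n w) < M' * `|ell n w|)%N.
  rewrite /A /= => h; rewrite -(ltr_nat R) natrM natr_absz; apply: lt_le_trans h _.
  by rewrite -intr_norm ler_wpM2r.
have gwalk n w : lazy_walk n (gbar n w) /\ gbar n w 0%N = 0 by have [] := gmin n w.
have gcost n w g : ~ D w -> lazy_walk n g -> g 0%N = 0 ->
    env_cost c X w n (gbar n w) <= env_cost c X w n g.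
  by move=> Dw gl g0; rewrite !costE// lerD2l; have [_ _] := gmin n w; apply.
have gl n w : ~ D w -> is_ell c (field c (X^~ w)) n (gbar n w) (ell n w).
  by move=> /fieldE->.
have tail := minimal_cost_tail eX Xc c0 k0 Kd0 Ce0 disc_tail ext fair mD pD mA pA gwalk gcost gl gtau.
pose al := speed_cost P c (2 * M' + 3) X.
have al0 : 0 < al by apply: (speed_cost_positive c0 eX _ k0 Ce0 ext); rewrite addnS.
pose Lam := intensity k Kd al 1; have Lam0 : 0 < Lam := intensity_gt0 k0 Kd0 al0 ltr01.
(* The intensity is homogeneous of degree [2 * k + 1], so this [h] gives
   [intensity (h * t) = t^(2k+1)]. *)
pose h := Lam `^ (- (2 * k + 1)^-1); have h0 : 0 < h by exact: powR_gt0.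
exists h => // t t0.
pose Z n w := c * n%:R + action n (B^~ w) (F^~ w) (gbar n w).
pose E n := [set w | t <= Z n w / (h * nscale k n)].
have mE n : measurable (E n).
  apply: measurable_ge; apply: measurable_funM; last exact: measurable_cst.
  apply: measurable_funD; first exact: measurable_cst.
  exact: measurable_min_action.
have -> : (fun n => P (E n)) = (fun n => (pr P (E n))%:E).
  by apply/funext => n; rewrite probability_fine.
apply: cvg_EFin; first by near=> n.
apply/cvgrPdist_le => eta eta0.
(* The Poisson limit requires a positive level. At [t = 0] the limit is 1, since the shifted cost is
   nonnegative off the null set [D]. *)
move: t0; rewrite le_eqVlt => /predU1P[t0|t0].
  near=> n; have : pr P (~` D) <= pr P (E n).
    apply: pr_le => //; first exact: measurableC.
    move=> w Dw; rewrite /E /= -t0; apply: divr_ge0.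
      by rewrite /Z -costE//; apply: cost_ge0 => x; exact: (field_bound Xc).
    by apply: mulr_ge0; [exact: ltW|exact: powR_ge0].
  rewrite prC// pD subr0 -t0 powR0 ?gt_eqF// oppr0 expR0 => E1.
  by rewrite ger0_norm ?subr_ge0 ?pr_le1//; apply: le_trans (ltW eta0); rewrite subr_le0.
have ht : 0 < h * t by exact: mulr_gt0.
have <- : intensity k Kd al (h * t) = t `^ (2 * k + 1).
  rewrite intensity_power// powRM ?(ltW h0) ?(ltW t0)// mulrA /h -powRrM mulNr mulVf ?gt_eqF//.
  by rewrite powRN powRr1 ?(ltW Lam0)// mulfV ?mul1r// gt_eqF.
have [n0 _ Hn] := tail (h * t) eta ht eta0.
exists n0.+1 => // n /= n0n; rewrite distrC.
apply: (Hn n (ltnW n0n) _ (mE n)) => w Dw.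
have N0 : 0 < nscale k n by rewrite powR_gt0// ltr0n; exact: leq_ltn_trans n0n.
rewrite /E /= ler_pdivlMr ?mulr_gt0// costE// -/(Z n w) mulrCA mulrA.
by [].
Unshelve. all: by end_near. Qed.
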